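(* Assume that $X$ is a log-correlated field on a domain $U\subset\mathbf{R}^d$ with $0\in U$, with covariance $C_X(x,y)=\log(1/|x-y|)+g(x,y)$, where $g\in H^s_{loc}(U\times U)$ for some $s>d$. Then there is a neighbourhood $B(0,\varepsilon)\subset U$ of the origin and a constant $C$ such that for any $n\ge2$, any $q_1,\dots,q_n\in\{-1,1\}$ and any distinct $x_1,\dots,x_n\in B(0,\varepsilon)$ it holds that $$-\sum_{1\le j<k\le n}q_jq_k\,\mathbb{E}X(x_j)X(x_k)\le\frac12\sum_{j=1}^n\log\frac{1}{\frac12\min_{k\ne j}|x_j-x_k|}+Cn.$$ Here $C$ is independent of the points $x_j$ and of $n$, but may depend on the neighbourhood $B(0,\varepsilon)$.
   Context: For $s\in\mathbf{R}$, $H^s(\mathbf{R}^m)$ is the space of tempered distributions $\varphi$ with $\int_{\mathbf{R}^m}(1+|\xi|^2)^s|\widehat\varphi(\xi)|^2\,d\xi<\infty$; for a domain $V\subset\mathbf{R}^m$, $\lambda\in H^s_{loc}(V)$ means $\varphi\lambda\in H^s(\mathbf{R}^m)$ for all $\varphi\in C_c^\infty(V)$. A log-correlated field on $U$ is a (distribution-valued) real centered Gaussian process $X$ with covariance kernel $C_X(x,y)=\log(1/|x-y|)+g(x,y)$, where $g\in C(U\times U)$; that is, $\mathbb{E}[\langle X,\varphi\rangle\langle X,\psi\rangle]=\int\int C_X(x,y)\varphi(x)\psi(y)\,dx\,dy$ for test functions. For distinct points $x,y$ the notation $\mathbb{E}X(x)X(y)$ stands for $C_X(x,y)$. $B(0,\varepsilon)$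 is the open Euclidean ball. *)

(* Defs.v *)
From HB Require Import structures.
From mathcomp Require Import all_boot all_order all_algebra.
From mathcomp Require Import all_classical all_reals all_analysis.

Set Implicit Arguments.
Unset Strict Implicit.
Unset Printing Implicit Defensive.

Import Order.TTheory GRing.Theory Num.Theory.
Import numFieldNormedType.Exports.

Local Open Scope classical_set_scope.
Local Open Scope ring_scope.

(** Points of R^n are row vectors ['rV[R]_n].  The library norm on them is the
  sup norm; it is only used for its topology. *)

Section euclidean.
Context {R : realType}.

Definition dotv n (x y : 'rV[R]_n) : R := \sum_(i < n) x 0 i * y 0 i.

Definition enorm n (x : 'rV[R]_n) : R := Num.sqrt (dotv x x).

Definition eball n (c : 'rV[R]_n) (r : R) : set 'rV[R]_n :=
  [set x | enorm (x - c) < r].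

Definition domain n (U : set 'rV[R]_n) : Prop :=
  [/\ open U, connected U & U !=set0].

End euclidean.

(** The library has no measurable structure on row vectors, but it has one on
  tuples, hence the detour through tuples for Lebesgue measure. *)

(** The library's sigma-finite instance for products is not found by
  inference, the one for products of subprobabilities being tried instead. *)
Lemma product_sigma_finite (R : realType) d1 d2 (T1 : measurableType d1)
    (T2 : measurableType d2) (m1 : {sigma_finite_measure set T1 -> \bar R})
    (m2 : {sigma_finite_measure set T2 -> \bar R}) :
  sigma_finite setT (m1 \x m2)%E.
Proof.
have /sigma_finiteP[F [TF ndF Foo]] := sigma_finiteT m1.
have /sigma_finiteP[G [TG ndG Goo]] := sigma_finiteT m2.
exists (fun n => F n `*` G n).
  rewrite -setXTT TF TG predeqE => -[x y]; split.
    move=> [/= [n _ Fnx] [k _ Gky]]; exists (maxn n k) => //; split.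
    - by move: x Fnx; exact/subsetPset/ndF/leq_maxl.
    - by move: y Gky; exact/subsetPset/ndG/leq_maxr.
  by move=> [n _ []/= ? ?]; split; exists n.
move=> k; have [? ?] := Foo k; have [? ?] := Goo k.
split; first exact: measurableX.
by rewrite product_measure1E// lte_mul_pinfty// ge0_fin_numE.
Qed.

Section lebesgue_measure_n.
Context (R : realType).
Local Notation RM := (measurableTypeR R).
Local Open Scope ereal_scope.

Definition tcons n (p : RM * n.-tuple RM) : n.+1.-tuple RM :=
  [tuple of p.1 :: p.2].

Lemma measurable_tcons n : measurable_fun setT (@tcons n).
Proof.
exact: (@measurable_cons _ _ (RM * n.-tuple RM)%type RM fst n snd).
Qed.

Section step.
Variables (n : nat) (m1 : {sigma_finite_measure set RM -> \bar R}).
Variable m : {sigma_finite_measure set (n.-tuple RM) -> \bar R}.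

Definition leb_step : set (n.+1.-tuple RM) -> \bar R :=
  pushforward (m1 \x m) (@tcons n).

Let mpre A : measurable A -> measurable (@tcons n @^-1` A).
Proof. by move=> mA; rewrite -[X in measurable X]setTI; exact: measurable_tcons. Qed.

Let leb_step0 : leb_step set0 = 0.
Proof. by rewrite /leb_step /pushforward preimage_set0 measure0. Qed.

Let leb_step_ge0 A : 0 <= leb_step A.
Proof. exact: (measure_ge0 (m1 \x m)). Qed.

Let leb_step_sigma_additive : semi_sigma_additive leb_step.
Proof.
move=> F mF tF mUF; rewrite /leb_step /pushforward preimage_bigcup.
apply: measure_semi_sigma_additive.
- by move=> k; exact: mpre.
- apply/trivIsetP => /= i j _ _ ij; rewrite -preimage_setI.
  by move/trivIsetP : tF => /(_ _ _ _ _ ij) ->//; rewrite preimage_set0.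
- by rewrite -preimage_bigcup; exact: mpre.
Qed.

HB.instance Definition _ := isMeasure.Build _ _ _ leb_step
  leb_step0 leb_step_ge0 leb_step_sigma_additive.

Let leb_step_sigma_finite : sigma_finite setT leb_step.
Proof.
have [F FT mF] : sigma_finite setT (m1 \x m) by exact: product_sigma_finite.
pose unc (t : n.+1.-tuple RM) : RM * n.-tuple RM :=
  (thead t, [tuple of behead t]).
have uncK : cancel (@tcons n) unc.
  by move=> [x t]; congr pair; apply: val_inj.
have munc : measurable_fun setT unc.
  apply/measurable_fun_pairP; split; first exact: measurable_tnth.
  exact: measurable_behead.
exists (fun k => unc @^-1` F k).
  by rewrite -preimage_bigcup -FT preimage_setT.
move=> k; have [mFk Fky] := mF k; split.
  by rewrite -[X in measurable X]setTI; exact: munc.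
rewrite /leb_step /pushforward/= -comp_preimage.
by rewrite (_ : unc \o _ = id)//; apply/funext => p; exact: uncK.
Qed.

HB.instance Definition _ :=
  Measure_isSigmaFinite.Build _ _ _ leb_step leb_step_sigma_finite.

End step.

(** Lebesgue measure on R^n, as the n-fold product of Lebesgue measure on R. *)
Fixpoint leb n : {sigma_finite_measure set (n.-tuple RM) -> \bar R} :=
  match n with
  | 0 => \d_([tuple] : 0.-tuple RM)
  | n'.+1 => leb_step lebesgue_measure (leb n')
  end.

End lebesgue_measure_n.

Section Rn_integral.
Context {R : realType}.

Definition rvec n (t : n.-tuple (measurableTypeR R)) : 'rV[R]_n :=
  \row_i tnth t i.

Definition integral_Rn n (f : 'rV[R]_n -> R) : R :=
  \int[leb R n]_t f (rvec t).

(** Extended-real valued version, meant for nonnegative integrands. *)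
Definition eintegral_Rn n (f : 'rV[R]_n -> R) : \bar R :=
  (\int[leb R n]_t (f (rvec t))%:E)%E.

Definition measurable_Rn n (f : 'rV[R]_n -> R) : Prop :=
  measurable_fun setT (fun t : n.-tuple (measurableTypeR R) => f (rvec t)).

End Rn_integral.

Section distributions.
Context {R : realType}.

Definition basis_vec n (i : 'I_n) : 'rV[R]_n := delta_mx 0 i.

(** [iter_partial [:: i1; ...; ik] f] is d_{i1} ... d_{ik} f *)
Fixpoint iter_partial n (L : seq 'I_n) (f : 'rV[R]_n -> R) : 'rV[R]_n -> R :=
  if L is i :: L' then fun x => 'D_(basis_vec i) (iter_partial L' f) x else f.

Definition smooth n (f : 'rV[R]_n -> R) : Prop :=
  forall L : seq 'I_n, continuous (iter_partial L f) /\
    (forall i x, derivable (iter_partial L f) x (basis_vec i)).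

Definition supp n (f : 'rV[R]_n -> R) : set 'rV[R]_n :=
  closure [set x | f x != 0].

(** Elements of C_c^oo(V) are identified with their extension by zero. *)
Definition test_fun n (V : set 'rV[R]_n) (f : 'rV[R]_n -> R) : Prop :=
  [/\ smooth f, compact (supp f) & supp f `<=` V].

Definition schwartz n (f : 'rV[R]_n -> R) : Prop :=
  smooth f /\
  forall (k : nat) (L : seq 'I_n), exists C : R, forall x,
    (1 + enorm x ^+ 2) ^+ k * `|iter_partial L f x| <= C.

Definition linear_on (T : Type) (D : set (T -> R)) (u : (T -> R) -> R) :=
  forall (a b : R) (f h : T -> R), D f -> D h ->
    u (fun x => a * f x + b * h x) = a * u f + b * u h.

(** Distributions on V; continuity is expressed by the usual seminorm
  estimates, with "M bounds the seminorm" in place of a supremum. *)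
Definition is_distribution n (V : set 'rV[R]_n)
    (u : ('rV[R]_n -> R) -> R) : Prop :=
  linear_on (test_fun V) u /\
  forall K : set 'rV[R]_n, compact K -> K `<=` V ->
    exists (C : R) (N : nat), forall f, test_fun V f -> supp f `<=` K ->
      forall M : R,
        (forall (L : seq 'I_n) x, (size L <= N)%N ->
           `|iter_partial L f x| <= M) ->
        `|u f| <= C * M.

Definition is_tempered n (u : ('rV[R]_n -> R) -> R) : Prop :=
  linear_on (@schwartz n) u /\
  exists (C : R) (N : nat), forall f, schwartz f ->
    forall M : R,
      (forall (L : seq 'I_n) x, (size L <= N)%N ->
         (1 + enorm x ^+ 2) ^+ N * `|iter_partial L f x| <= M) ->
      `|u f| <= C * M.

Definition fun_distribution n (f : 'rV[R]_n -> R) : ('rV[R]_n -> R) -> R :=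
  fun psi => integral_Rn (fun x => f x * psi x).

(** Real and imaginary parts of the Fourier transform
  xi |-> \int psi(x) exp(- 2 i pi x.xi) dx of a real function psi. *)
Definition fourier_re n (psi : 'rV[R]_n -> R) (xi : 'rV[R]_n) : R :=
  integral_Rn (fun x => psi x * cos (2 * pi * dotv x xi)).

Definition fourier_im n (psi : 'rV[R]_n -> R) (xi : 'rV[R]_n) : R :=
  - integral_Rn (fun x => psi x * sin (2 * pi * dotv x xi)).

(** The Fourier transform of the real tempered distribution u is (represented
  by) the complex function h1 + i h2, i.e., u(\hat psi) = \int (h1 + i h2) psi.
  By linearity real test functions suffice, and for those
  u(\hat psi) = u(Re \hat psi) + i u(Im \hat psi). *)
Definition has_fourier n (u : ('rV[R]_n -> R) -> R)
    (h1 h2 : 'rV[R]_n -> R) : Prop :=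
  forall psi, schwartz psi ->
    u (fourier_re psi) = integral_Rn (fun xi => h1 xi * psi xi) /\
    u (fourier_im psi) = integral_Rn (fun xi => h2 xi * psi xi).

(** Real-valued elements of H^s(R^n). *)
Definition sobolev n (s : R) (u : ('rV[R]_n -> R) -> R) : Prop :=
  is_tempered u /\
  exists h1 h2 : 'rV[R]_n -> R,
    [/\ measurable_Rn h1, measurable_Rn h2, has_fourier u h1 h2 &
      (eintegral_Rn (fun xi =>
         ((1 + enorm xi ^+ 2) `^ s * (h1 xi ^+ 2 + h2 xi ^+ 2))%R) < +oo)%E].

Definition sobolev_loc n (s : R) (V : set 'rV[R]_n)
    (lambda : 'rV[R]_n -> R) : Prop :=
  forall phi, test_fun V phi ->
    sobolev s (fun_distribution (fun x => phi x * lambda x)).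

End distributions.

Section log_correlated.
Context {R : realType}.

Definition prod_dom d (U : set 'rV[R]_d) : set 'rV[R]_(d + d) :=
  [set z | U (lsubmx z) /\ U (rsubmx z)].

(** A kernel g(x, y) seen as a function of one variable in R^(d + d). *)
Definition kernel_fun d (g : 'rV[R]_d -> 'rV[R]_d -> R) (z : 'rV[R]_(d + d)) :=
  g (lsubmx z) (rsubmx z).

Definition log_kernel d (g : 'rV[R]_d -> 'rV[R]_d -> R) (x y : 'rV[R]_d) : R :=
  ln (1 / enorm (x - y)) + g x y.

Context {dO : measure_display} {Omega : measurableType dO}
  (P : probability Omega R).

(** The library's [normal_prob m 0] is not a Dirac mass, whence the separate
  degenerate case. *)
Definition centered_gaussian (Y : Omega -> R) : Prop :=
  (forall A : set (measurableTypeR R), measurable A ->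
     P (Y @^-1` A) = \d_(0 : R) A) \/
  (exists2 sigma : R, 0 < sigma &
     forall A : set (measurableTypeR R), measurable A ->
       P (Y @^-1` A) = normal_prob 0 sigma A).

Definition log_correlated_field d (U : set 'rV[R]_d)
    (g : 'rV[R]_d -> 'rV[R]_d -> R)
    (X : ('rV[R]_d -> R) -> {RV P >-> R}) : Prop :=
  [/\ {within prod_dom U, continuous (kernel_fun g)},
      {ae P, forall w, is_distribution U (fun phi => X phi w)},
      (forall (k : nat) (a : 'I_k -> R) (phi : 'I_k -> 'rV[R]_d -> R),
         (forall i, test_fun U (phi i)) ->
         centered_gaussian (fun w => \sum_(i < k) a i * X (phi i) w)) &
      (forall phi psi, test_fun U phi -> test_fun U psi ->
         ('E_P[fun w => (X phi w * X psi w)%R])%E =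
         (integral_Rn (fun x => integral_Rn (fun y =>
            log_kernel g x y * phi x * psi y)))%:E)].

End log_correlated.

(* Main.v *)
(** Let kappa(x) be the normalised autocorrelation of the ball of radius 1/2,
  so that kappa(0) = 1 and kappa(x) = 0 for |x| >= 1, and write
  log (1/|x|) = \int_R (kappa(e^tau x) - 1_{tau < 0}) dtau + c.
  For points x_j and signs q_j, put
  D(tau) = sum_{j,k} q_j q_k kappa(e^tau (x_j - x_k)): up to a factor it is the
  squared L^2 norm of the charges e^tau x_j smeared over balls, hence D >= 0,
  and D(tau) >= n - #{j | log (1/r_j) > tau}, where r_j is half the distance
  from x_j to the other points.  Integrating over tau, the logarithmic energy
  sum_{j <> k} q_j q_k log (1/|x_j - x_k|) is at least
  - sum_j log (1/r_j) - O(n) plus \int rho(tau) D(tau) dtau, for any weight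
  0 <= rho <= 1 carried by large tau.

  The part of the energy due to g must be absorbed by this last integral.
  Localising g by a bump and using Fourier inversion, AM-GM and
  g in H^s_loc bound it by A I + B, where A and B depend on g only,
  I = \int |S(xi)|^2 w(xi) dxi, S(xi) = sum_j q_j e^{2 i pi x_j.xi} and w(xi)
  is of the order of (1 + |xi|^2)^(-s/2).  At the scale e^tau, |S|^2 is
  controlled by D(tau), pointwise for e^tau |x_j| <= 1 and in mean over the
  ball |xi| <= e^tau/pi in general; as s > d this gives A I <= \int rho D with
  0 <= rho <= 1, provided that the points are close enough to the origin for a
  long range of scales to be of the first kind. *)

Require Import Defs.
From HB Require Import structures.
From mathcomp Require Import all_boot all_order all_algebra.
From mathcomp Require Import all_classical all_reals all_analysis.
From mathcomp Require Import measurable_realfun ring lra.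
Import Order.TTheory GRing.Theory Num.Theory.
Import numFieldNormedType.Exports.
Local Open Scope classical_set_scope.
Local Open Scope ring_scope.
Set Implicit Arguments.
Unset Strict Implicit.
Unset Printing Implicit Defensive.

(** * Lebesgue measure on R^n *)

(** The constant A depends on g and need not be small, whereas the logarithmic energy offers only a
    density rho <= 1. Two resources make A I cheap. Frequencies of scale e^tau carry the weight
    e^(-s tau) against the volume e^(d tau), so beyond a large tau0 the excess s - d leaves a small
    density. Lower frequencies are controlled pointwise by D(sigma) at any one later scale sigma
    with e^sigma |x_j| <= 1; averaging over sigma in an interval of length L divides their cost by
    L. The radius is chosen last, once tau0 and L are known. The weight w arises because (1 + |(xi,
    eta)|^2)^s dominates (1 + |xi|^2)^(s/2) (1 + |eta|^2)^(s/2): the weighted L^2 norm of S(xi)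
    S(eta) factors into I^2, and the AM-GM parameter I + 1 makes the bound linear in I. The charges
    need not be neutral. The constant c yields a multiple of (sum_j q_j)^2 of favourable sign. The
    indicator of tau < 0 yields another one, which D nearly cancels at those scales; the rest is
    paid for by the scales 0 <= tau < 1, where D is at least half of that square. *)

Section leb_basics.
Context {R : realType}.
Local Notation RM := (measurableTypeR R).
Local Notation mu := (@lebesgue_measure R).
Local Open Scope ereal_scope.

Lemma ge0_integral_leb_cons1 n (f : n.+1.-tuple RM -> \bar R) :
  measurable_fun setT f -> (forall t, 0 <= f t) ->
  \int[leb R n.+1]_t f t =
  \int[mu]_x \int[leb R n]_t f (tcons (x, t)).
Proof.
move=> mf f0; rewrite [LHS]ge0_integral_pushforward//=.
  rewrite preimage_setT fubini_tonelli1//.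
  by apply: measurableT_comp => //; exact: measurable_tcons.
exact: measurable_tcons.
Qed.

Lemma ge0_integral_leb_cons2 n (f : n.+1.-tuple RM -> \bar R) :
  measurable_fun setT f -> (forall t, 0 <= f t) ->
  \int[leb R n.+1]_t f t =
  \int[leb R n]_t \int[mu]_x f (tcons (x, t)).
Proof.
move=> mf f0; rewrite [LHS]ge0_integral_pushforward//=.
  rewrite preimage_setT fubini_tonelli2//.
  by apply: measurableT_comp => //; exact: measurable_tcons.
exact: measurable_tcons.
Qed.

Lemma measurable_tuple0 (A : set (0.-tuple RM)) : measurable A.
Proof.
have [->//|/set0P[x Ax]] := eqVneq A set0.
rewrite (_ : A = setT)//; apply/seteqP; split=> // y _.
by rewrite (tuple0 y) -(tuple0 x).
Qed.

Lemma integral_leb0 (f : 0.-tuple RM -> \bar R) :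
  \int[leb R 0]_t f t = f [tuple].
Proof.
rewrite /= integral_dirac//= ?diracT ?mul1e//.
by move=> _ Y mY; exact: measurable_tuple0.
Qed.

(** Measurability of [f] is expressed on tuples and that of [g] by coordinates; the composite is
    factored through the tuple of coordinates. *)
Lemma measurable_comp_rvec d (T : measurableType d) d' (U : measurableType d')
    n (f : 'rV[R]_n -> U) (g : T -> 'rV[R]_n) :
  measurable_fun setT (fun t : n.-tuple RM => f (rvec t)) ->
  (forall i, measurable_fun setT (fun x => g x 0%R i)) ->
  measurable_fun setT (fun x => f (g x)).
Proof.
move=> mf mg.
pose h x : n.-tuple RM := [tuple g x 0%R i | i < n].
have mh : measurable_fun setT h.
  apply/measurable_fun_tnthP => i; rewrite (_ : _ \o _ = fun x => g x 0%R i); first exact: mg.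
  by apply/funext => x /=; rewrite tnth_mktuple.
rewrite (_ : (fun x => f (g x)) = (fun t => f (rvec t)) \o h).
  exact: measurableT_comp.
apply/funext => x /=; congr (f _); apply/rowP => i.
by rewrite mxE tnth_mktuple.
Qed.

Lemma measurable_rvec_coord n (i : 'I_n) :
  measurable_fun setT (fun t : n.-tuple RM => rvec t 0%R i).
Proof.
rewrite (_ : (fun _ => _) = (fun t : n.-tuple RM => tnth t i)).
  exact: measurable_tnth.
by apply/funext => t; rewrite mxE.
Qed.

Lemma rvec_tcons n x (t : n.-tuple RM) :
  rvec (tcons (x, t)) = row_mx (x%:M%R : 'M[R]_1) (rvec t) :> 'rV[R]_(1 + n).
Proof.
apply/rowP => i; rewrite !mxE; case: splitP => j ij.
  by rewrite ord1 in ij; rewrite ord1 mxE eqxx mulr1n (_ : i = ord0)//; apply/val_inj.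
rewrite mxE (_ : i = lift ord0 j) ?tnthS//.
exact/val_inj.
Qed.

Lemma measurable_row_mx1 d (T : measurableType d) n (g : T -> R)
    (h : T -> 'rV[R]_n) : measurable_fun setT g ->
  (forall i, measurable_fun setT (fun x => h x 0%R i)) ->
  forall i, measurable_fun setT
    (fun x => (row_mx ((g x)%:M%R : 'M[R]_1) (h x) : 'rV[R]_(1 + n)) 0%R i).
Proof.
move=> mg mh i.
have [j ij|j ij] := splitP i.
  rewrite (_ : (fun _ => _) = g)//; apply/funext => x.
  rewrite (_ : i = lshift n j); last exact/val_inj.
  by rewrite row_mxEl !ord1 mxE eqxx.
rewrite (_ : (fun _ => _) = fun x => h x 0%R j)//; apply/funext => x.
by rewrite (_ : i = rshift 1 j) ?row_mxEr//; exact/val_inj.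
Qed.

(* Rational boxes form a countable basis of the topology of R^n. *)
Lemma measurable_rvec_open n (O : set 'rV[R]_n) : open O ->
  measurable ((@rvec R n) @^-1` O).
Proof.
move=> oO.
pose box (p : {ffun 'I_n -> rat} * rat) : set (n.-tuple RM) :=
  [set t | forall i, (`|tnth t i - ratr (p.1 i)| < ratr p.2)%R].
have mbox p : measurable (box p).
  rewrite (_ : box p = \bigcap_(i in [set: 'I_n])
      ((@tnth n RM ^~ i) @^-1` [set x | (`|x - ratr (p.1 i)| < ratr p.2)%R])).
    apply: fin_bigcap_measurable => // i _.
    rewrite -[X in measurable X]setTI; apply: measurable_tnth => //.
    have := @measurable_ball R (ratr (p.1 i)) (ratr p.2).
    by congr measurable; apply/seteqP; split => x /=; rewrite /ball/= distrC.
  by apply/seteqP; split => t /= H i; [move=> _|]; exact: H.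
pose F k : set (n.-tuple RM) := if @unpickle ({ffun 'I_n -> rat} * rat)%type k is Some p then
  (if `[< box p `<=` (@rvec R n) @^-1` O >] then box p else set0) else set0.
rewrite (_ : _ @^-1` _ = \bigcup_k F k).
  apply: bigcupT_measurable => k; rewrite /F.
  by case: unpickle => [p|]//; case: ifP.
apply/seteqP; split => [t /= Ot|t [k _]]; last first.
  by rewrite /F; case: unpickle => [p|]//; case: ifP => // /asboolP; exact.
have /nbhs_ballP[e /= e0 eO] := open_nbhs_nbhs (conj oO Ot).
have e20 : (0 < e / 2)%R by rewrite divr_gt0.
have [r] := rat_in_itvoo e20.
rewrite in_itv/= => /andP[r0 re].
have /choice[c cP] : forall i : 'I_n, exists q : rat, (`|tnth t i - ratr q| < ratr r)%R.
  move=> i; have tr : (tnth t i - ratr r < tnth t i :> R)%R by rewrite ltrBlDr ltrDl.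
  have [q] := rat_in_itvoo tr.
  rewrite in_itv/= => /andP[q1 q2]; exists q; rewrite gtr0_norm ?subr_gt0//.
  by rewrite ltrBlDr -ltrBlDl.
pose p := ([ffun i => c i], r).
exists (pickle p) => //; rewrite /F pickleK.
case: ifPn => [_|/asboolP]; first by move=> i /=; rewrite ffunE.
case=> u /= up; apply: eO; split => // i j.
rewrite /ball /= !mxE.
have := up j; have := cP j; rewrite ffunE => h1 h2.
rewrite -(subrKA (ratr (c j))) (le_lt_trans (ler_normD _ _))//.
by rewrite (splitr e) ltrD// ?(lt_trans h1)// distrC (lt_trans h2).
Qed.

Lemma continuous_measurable_rvec n (f : 'rV[R]_n -> R) : continuous f ->
  measurable_fun setT (fun t : n.-tuple RM => f (rvec t)).
Proof.
move=> cf; apply: (measurability _ (RGenOpens.measurableE R)).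
move=> _ [_ [x [y ->]] <-]; rewrite setTI.
rewrite (_ : _ @^-1` _ = (@rvec R n) @^-1` (f @^-1` `]x, y[))//.
apply: measurable_rvec_open; apply: open_comp => // z _; exact: cf.
Qed.

End leb_basics.

(** * Affine and linear changes of variables *)

Section invariance.
Context {R : realType}.
Local Notation RM := (measurableTypeR R).
Local Notation mu := (@lebesgue_measure R).
Local Open Scope ereal_scope.

(** The pushforward of Lebesgue measure by the affine map, multiplied by |a|, has the right value on
    half-open intervals, hence is Lebesgue measure by uniqueness. *)
Lemma ge0_integral_affine (a b : R) (f : R -> \bar R) : a != 0%R ->
  measurable_fun setT f -> (forall x, 0 <= f x) ->
  \int[mu]_x f (a * x + b)%R = (`|a|^-1)%:E * \int[mu]_x f x.
Proof.
move=> a0 mf f0.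
pose phi : RM -> RM := fun x => (a * x + b)%R.
have mphi : measurable_fun setT phi.
  by apply: measurable_funD => //; exact: measurable_funM.
have na0 : (0 < `|a|)%R by rewrite normr_gt0.
pose k := NngNum (normr_ge0 a).
have E : \int[mu]_x f x = `|a|%:E * \int[mu]_x f (a * x + b)%R.
  pose nu := measure_function_pushforward__canonical__measure_function_Measure mu mphi.
  transitivity (\int[mscale k nu]_x f x).
    apply: eq_measure_integral => A mA _.
    apply: (@lebesgue_measure_unique _ (mscale k nu)) => //.
    move=> _ [[u v] _ <-].
    change (mu `]u, v] = `|a|%:E * mu (phi @^-1` `]u, v]))%classic.
    have [{}a0|{}a0] : (0 < a \/ a < 0)%R by apply/orP; rewrite orbC -neq_lt.
      rewrite (_ : _ @^-1` _ = `](u - b) / a, (v - b) / a]%classic)%R.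
        rewrite !lebesgue_measure_itv/= !lte_fin ltr_pM2r ?invr_gt0// ltrD2r.
        case: ifPn => _; last by rewrite mule0.
        by rewrite -EFinD gtr0_norm// -EFinM; congr EFin; field; rewrite gt_eqF.
      by apply/seteqP; split => x/=; rewrite !in_itv/= /phi ltr_pdivrMr// ler_pdivlMr//
        ltrBlDr lerBrDr (mulrC x).
    rewrite (_ : _ @^-1` _ = `[(v - b) / a, (u - b) / a[%classic)%R.
      rewrite !lebesgue_measure_itv/= !lte_fin ltr_nM2r ?invr_lt0// ltrD2r.
      case: ifPn => _; last by rewrite mule0.
      by rewrite -EFinD ltr0_norm// -EFinM; congr EFin; field; rewrite lt_eqF.
    by apply/seteqP; split => x/=; rewrite !in_itv/= /phi ler_ndivrMr// ltr_ndivlMr//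
        lerBrDr ltrBlDr (mulrC x) andbC.
  rewrite ge0_integral_mscale//= ge0_integral_pushforward//.
by rewrite E muleA -EFinM mulVf ?mul1e// gt_eqF.
Qed.

Lemma ge0_integral_shift (b : R) (f : R -> \bar R) :
  measurable_fun setT f -> (forall x, 0 <= f x) ->
  \int[mu]_x f (x + b)%R = \int[mu]_x f x.
Proof.
move=> mf f0; have := @ge0_integral_affine 1%R b f (oner_neq0 _) mf f0.
by rewrite normr1 invr1 mul1e => <-; apply: eq_integral => x _; rewrite mul1r.
Qed.

Section Rn.
Variable n : nat.
Implicit Type f : 'rV[R]_n -> \bar R.

Definition mRn (f : 'rV[R]_n -> \bar R) :=
  measurable_fun setT (fun t : n.-tuple RM => f (rvec t)).

End Rn.

Lemma ge0_integral_rV1 n (f : 'rV[R]_(1 + n) -> \bar R) :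
  mRn f -> (forall x, 0 <= f x) ->
  \int[leb R n.+1]_t f (rvec t) =
  \int[mu]_x \int[leb R n]_t f (row_mx (x%:M : 'M[R]_1)%R (rvec t)).
Proof.
move=> mf f0; rewrite (ge0_integral_leb_cons1 mf); last by [].
by under eq_integral do under eq_integral do rewrite rvec_tcons.
Qed.

Lemma ge0_integral_rV2 n (f : 'rV[R]_(1 + n) -> \bar R) :
  mRn f -> (forall x, 0 <= f x) ->
  \int[leb R n.+1]_t f (rvec t) =
  \int[leb R n]_t \int[mu]_x f (row_mx (x%:M : 'M[R]_1)%R (rvec t)).
Proof.
move=> mf f0; rewrite (ge0_integral_leb_cons2 mf); last by [].
by under eq_integral do under eq_integral do rewrite rvec_tcons.
Qed.

Lemma mRn_row1 n (f : 'rV[R]_(1 + n) -> \bar R) x :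
  mRn f -> mRn (fun v => f (row_mx (x%:M : 'M[R]_1)%R v)).
Proof.
move=> mf; apply: (measurable_comp_rvec mf); apply: measurable_row_mx1 => //.
exact: measurable_rvec_coord.
Qed.

Lemma mRn_row2 n (f : 'rV[R]_(1 + n) -> \bar R) v :
  mRn f -> measurable_fun setT (fun x : RM => f (row_mx (x%:M : 'M[R]_1)%R v)).
Proof.
move=> mf; apply: (measurable_comp_rvec mf); apply: measurable_row_mx1 => //.
Qed.

Lemma mRn_lin n m (f : 'rV[R]_n -> \bar R) (M : 'M[R]_(m, n)) b :
  mRn f -> mRn (fun v => f (v *m M + b)%R).
Proof.
move=> mf; apply: (measurable_comp_rvec mf) => i.
rewrite (_ : (fun _ => _) = (fun t => \sum_j rvec t ord0 j * M j i + b ord0 i)%R).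
  apply: measurable_funD => //; apply: measurable_sum => j.
  by apply: measurable_funM => //; exact: measurable_rvec_coord.
by apply/funext => t; rewrite !mxE.
Qed.

Lemma rV_split n (b : 'rV[R]_n.+1) :
  b = row_mx ((b ord0 ord0)%:M : 'M[R]_1)%R (rsubmx (b : 'rV_(1 + n))).
Proof.
apply/rowP => i; rewrite mxE; case: splitP => j ij.
  by rewrite !mxE !ord1 eqxx; congr (b _ _); apply/val_inj; rewrite /= ij ord1.
by rewrite mxE; congr (b _ _); exact/val_inj.
Qed.

Lemma measurable_integral_rV1 n (f : 'rV[R]_(1 + n) -> \bar R) :
  mRn f -> (forall x, 0 <= f x) -> measurable_fun setT (fun x : RM =>
    \int[leb R n]_t f (row_mx (x%:M : 'M[R]_1)%R (rvec t))).
Proof.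
move=> mf f0; apply: (measurable_fun_fubini_tonelli_F
    (fun p : RM * n.-tuple RM => f (row_mx (p.1%:M : 'M[R]_1)%R (rvec p.2)))) => //.
apply: (measurable_comp_rvec mf); apply: measurable_row_mx1 => // i.
exact: (measurableT_comp (measurable_rvec_coord i)).
Qed.

Lemma ge0_integral_translate n (f : 'rV[R]_n -> \bar R) b :
  mRn f -> (forall x, 0 <= f x) ->
  \int[leb R n]_t f (rvec t + b)%R = \int[leb R n]_t f (rvec t).
Proof.
elim: n => [|n IH] in f b *; move=> mf f0.
  by rewrite !integral_leb0; congr f; apply/rowP => -[].
have mfb := mRn_lin 1%:M%R b mf.
rewrite (ge0_integral_rV1 (f := fun x => f (x + b)%R))//; last first.
  by apply: eq_measurable_fun mfb => t _ /=; rewrite mulmx1.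
rewrite (rV_split b).
under eq_integral do under eq_integral do rewrite add_row_mx -raddfD/=.
transitivity (\int[mu]_x \int[leb R n]_t
    f (row_mx ((x + b ord0 ord0)%:M : 'M[R]_1)%R (rvec t))).
  apply: eq_integral => x _; rewrite -(IH (fun v => f (row_mx ((x + b ord0 ord0)%:M : 'M[R]_1)%R v))
    (rsubmx (b : 'rV[R]_(1 + n))))//.
  exact: mRn_row1.
rewrite (ge0_integral_shift _ (f := fun x => \int[leb R n]_t
    f (row_mx (x%:M : 'M[R]_1)%R (rvec t))))//.
- by rewrite ge0_integral_rV1.
- exact: measurable_integral_rV1.
- by move=> x; exact: integral_ge0.
Qed.

Lemma ge0_integral_dilate n (f : 'rV[R]_n -> \bar R) c : c != 0%R ->
  mRn f -> (forall x, 0 <= f x) ->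
  \int[leb R n]_t f (c *: rvec t)%R = ((`|c| ^+ n)^-1)%:E * \int[leb R n]_t f (rvec t).
Proof.
move=> c0; elim: n => [|n IH] in f *; move=> mf f0.
  by rewrite !integral_leb0 expr0 invr1 mul1e; congr f; apply/rowP => -[].
have mfc := mRn_lin c%:M%R 0%R mf.
rewrite (ge0_integral_rV1 (f := fun x => f (c *: x)%R))//; last first.
  by apply: eq_measurable_fun mfc => t _ /=; rewrite addr0 mul_mx_scalar.
under eq_integral do under eq_integral do rewrite (scale_row_mx c) scale_scalar_mx.
transitivity (\int[mu]_x (((`|c| ^+ n)^-1)%:E * \int[leb R n]_t
    f (row_mx ((c * x + 0)%:M : 'M[R]_1)%R (rvec t)))).
  apply: eq_integral => x _; rewrite addr0.
  by rewrite -(IH (fun v => f (row_mx ((c * x)%:M : 'M[R]_1)%R v)))//; exact: mRn_row1.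
have mG : measurable_fun setT (fun x : RM => \int[leb R n]_t
    f (row_mx (x%:M : 'M[R]_1)%R (rvec t))).
  exact: measurable_integral_rV1.
rewrite ge0_integralZl_EFin//; last 2 first.
- by move=> x _; exact: integral_ge0.
- apply: (measurableT_comp mG); apply: measurable_funD => //; exact: measurable_funM.
rewrite (ge0_integral_affine _ _ mG)//; last by move=> x; exact: integral_ge0.
rewrite muleA -EFinM -invfM -exprSr ge0_integral_rV1//.
Qed.

(** The factor, which is the inverse of |det M|, is only asserted to exist; [integral_Rn_orthogonal]
    recovers its value from the unit ball. *)
Definition scales_leb n (M : 'M[R]_n) := exists2 c : R, (0 < c)%R &
  forall f : 'rV[R]_n -> \bar R, mRn f -> (forall x, 0 <= f x) ->
    \int[leb R n]_t f (rvec t *m M)%R = c%:E * \int[leb R n]_t f (rvec t).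

Lemma mRn_mul n (f : 'rV[R]_n -> \bar R) (M : 'M[R]_n) :
  mRn f -> mRn (fun v => f (v *m M)%R).
Proof.
by move=> mf; apply: eq_measurable_fun (mRn_lin M 0%R mf) => t _; rewrite addr0.
Qed.

Lemma scales_lebM n (M N : 'M[R]_n) : scales_leb M -> scales_leb N ->
  scales_leb (M *m N).
Proof.
move=> [c c0 cM] [e e0 eN]; exists (c * e)%R; first exact: mulr_gt0.
move=> f mf f0; under eq_integral do rewrite mulmxA.
rewrite (cM (fun v => f (v *m N)%R))//; last exact: mRn_mul.
by rewrite eN// EFinM muleA.
Qed.

(** With the tail fixed, the head undergoes an affine map of slope m; the head is therefore
    integrated innermost. *)
Lemma scales_leb_head n (m : R) (c : 'cV[R]_n) : m != 0%R ->
  scales_leb (block_mx m%:M%R 0%R c 1%:M%R : 'M[R]_(1 + n)).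
Proof.
move=> m0; exists (`|m|^-1)%R; first by rewrite invr_gt0 normr_gt0.
move=> f mf f0.
rewrite (ge0_integral_rV2 (f := fun x => f (x *m block_mx m%:M%R 0%R c 1%:M%R)%R))//;
  last exact: mRn_mul.
rewrite ge0_integral_rV2// -ge0_integralZl_EFin//; last 2 first.
- by move=> t _; exact: integral_ge0.
- apply: (measurable_fun_fubini_tonelli_G
    (fun p : RM * n.-tuple RM => f (row_mx (p.1%:M : 'M[R]_1)%R (rvec p.2)))) => //.
  apply: (measurable_comp_rvec mf); apply: measurable_row_mx1 => // i.
  exact: (measurableT_comp (measurable_rvec_coord i)).
apply: eq_integral => t _.
rewrite -(ge0_integral_affine ((rvec t *m c) ord0 ord0) m0)//; last exact: mRn_row2.
apply: eq_integral => x _; congr f; rewrite mul_row_block !mulmx0 mulmx1 add0r.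
congr (row_mx _ _); apply/rowP => i; rewrite ord1 !mxE eqxx !big_ord1 !mxE eqxx.
by rewrite mulrC.
Qed.

(** With the head x fixed, the tail is transformed by D and then translated by x b; the tail is
    therefore integrated innermost. *)
Lemma scales_leb_tail n (b : 'rV[R]_n) (D : 'M[R]_n) : scales_leb D ->
  scales_leb (block_mx 1%:M%R b 0%R D : 'M[R]_(1 + n)).
Proof.
move=> [c c0 cD]; exists c => // f mf f0.
rewrite (ge0_integral_rV1 (f := fun x => f (x *m block_mx 1%:M%R b 0%R D)%R))//;
  last exact: mRn_mul.
rewrite ge0_integral_rV1// -ge0_integralZl_EFin//; last 3 first.
- by move=> t _; exact: integral_ge0.
- exact: measurable_integral_rV1.
- exact: ltW.
apply: eq_integral => x _.
pose h v := f (row_mx (x%:M : 'M[R]_1) v)%R.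
have mh : mRn h by exact: mRn_row1.
have h0 v : 0 <= h v by exact: f0.
rewrite -/(h _) -(ge0_integral_translate (x *: b)%R mh)//.
rewrite -(cD (fun v => h (v + x *: b)%R)); [|  |by move=> v; exact: h0]; last first.
  by apply: eq_measurable_fun (mRn_lin 1%:M%R (x *: b)%R mh) => t _; rewrite mulmx1.
apply: eq_integral => t _; rewrite /h; congr f.
rewrite mul_row_block mulmx0 mulmx1 addr0 mul_scalar_mx addrC//.
Qed.

(* Block LU decomposition, after making the pivot nonzero by adding a row. *)
Lemma unitmx_scales_leb n (M : 'M[R]_n) : M \in unitmx -> scales_leb M.
Proof.
elim: n => [|n IH] in M *; move=> uM.
  exists 1%R => // f _ _; rewrite mul1e; apply: eq_integral => t _.
  by congr f; apply/rowP => -[].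
have pivot (N : 'M[R]_(1 + n)) : N \in unitmx -> N ord0 ord0 != 0%R -> scales_leb N.
  move=> uN N0; set m := N ord0 ord0 in N0.
  pose c := dlsubmx N; pose b := (m^-1 *: ursubmx N)%R.
  pose D := (drsubmx N - c *m b)%R.
  have NE : N = block_mx m%:M%R 0%R c 1%:M%R *m block_mx 1%:M%R b 0%R D.
    rewrite mulmx_block !mulmx0 !mul0mx !mulmx1 !mul1mx !addr0.
    rewrite /D addrC subrK mul_scalar_mx /b scalerA divff// scale1r.
    rewrite -[LHS]submxK; congr (block_mx _ _ _ _).
    apply/matrixP => i j; rewrite !ord1 !mxE eqxx.
    by congr (N _ _); exact/val_inj.
  have uD : D \in unitmx.
    move: uN; rewrite NE unitmx_mul => /andP[_].
    by rewrite !unitmxE det_ublock det1 mul1r.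
  rewrite NE; apply: scales_lebM; first exact: scales_leb_head.
  by apply: scales_leb_tail; exact: IH.
have [M0|] := eqVneq (M ord0 ord0) 0%R; last exact: pivot.
have [i Mi] : exists i : 'I_n, (M : 'M[R]_(1 + n)) (rshift 1 i) ord0 != 0%R.
  apply/existsP; rewrite -[[exists _, _]]negbK; apply/negP => /existsPn M0'.
  have : (M *m delta_mx ord0 ord0 = 0 :> 'cV[R]_(1 + n))%R.
    rewrite -colE; apply/colP => k; rewrite !mxE.
    case: (split_ordP k) => j ->.
      rewrite ord1 -[RHS]M0; congr (M _ _); exact/val_inj.
    by apply/eqP; have := M0' j; rewrite negbK.
  move/(congr1 (mulmx (invmx M))); rewrite mulKmx// mulmx0 => /matrixP/(_ ord0 ord0).
  by rewrite !mxE eqxx => /eqP; rewrite oner_eq0.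
pose P (a : R) : 'M[R]_(1 + n) := block_mx 1%:M (a *: delta_mx ord0 i) 0 1%:M.
have PK : P (- 1)%R *m P 1%R = 1%:M.
  rewrite /P mulmx_block !mulmx0 !mul0mx !mulmx1 !mul1mx !addr0 add0r scaleN1r scale1r.
  by rewrite subrr scalar_mx_block.
have sP a : scales_leb (P a).
  apply: scales_leb_tail; exists 1%R => // f _ _; rewrite mul1e.
  by apply: eq_integral => t _; rewrite mulmx1.
have -> : M = P (- 1)%R *m (P 1%R *m M) by rewrite mulmxA PK mul1mx.
apply: scales_lebM => //; apply: pivot.
  rewrite unitmx_mul uM andbT.
  by have := unitmx1 R (1 + n); rewrite -PK unitmx_mul => /andP[].
have e0 : ord0 = lshift n ord0 :> 'I_(1 + n) by exact/val_inj.
have P0 : P 1%R ord0 (lshift n ord0) = 1%R by rewrite e0 block_mxEul mxE eqxx.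
have Pr k : P 1%R ord0 (rshift 1 k) = (k == i)%:R%R.
  by rewrite e0 block_mxEur !mxE eqxx mul1r.
rewrite mxE (@big_split_ord _ _ _ 1%N n)/= big_ord1 P0 mul1r -e0.
rewrite M0 add0r (bigD1 i)//= Pr eqxx mul1r big1 ?addr0// => j ji.
by rewrite Pr (negbTE ji) mul0r.
Qed.

End invariance.

(** * Euclidean norm and scalar product *)

Section euclid.
Context {R : realType}.
Implicit Types (n : nat).

Lemma dotvC n (x y : 'rV[R]_n) : dotv x y = dotv y x.
Proof. by apply: eq_bigr => i _; rewrite mulrC. Qed.

Lemma dotvDl n (x y z : 'rV[R]_n) : dotv (x + y) z = dotv x z + dotv y z.
Proof. by rewrite /dotv -big_split/=; apply: eq_bigr => i _; rewrite mxE mulrDl. Qed.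

Lemma dotvDr n (x y z : 'rV[R]_n) : dotv x (y + z) = dotv x y + dotv x z.
Proof. by rewrite dotvC dotvDl !(dotvC x). Qed.

Lemma dotvZl n a (x z : 'rV[R]_n) : dotv (a *: x) z = a * dotv x z.
Proof. by rewrite /dotv mulr_sumr; apply: eq_bigr => i _; rewrite mxE mulrA. Qed.

Lemma dotvZr n a (x z : 'rV[R]_n) : dotv x (a *: z) = a * dotv x z.
Proof. by rewrite dotvC dotvZl dotvC. Qed.

Lemma dotvNl n (x z : 'rV[R]_n) : dotv (- x) z = - dotv x z.
Proof. by rewrite -scaleN1r dotvZl mulN1r. Qed.

Lemma dotvNr n (x z : 'rV[R]_n) : dotv x (- z) = - dotv x z.
Proof. by rewrite dotvC dotvNl dotvC. Qed.

Lemma dotvBl n (x y z : 'rV[R]_n) : dotv (x - y) z = dotv x z - dotv y z.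
Proof. by rewrite dotvDl dotvNl. Qed.

Lemma dotvBr n (x y z : 'rV[R]_n) : dotv x (y - z) = dotv x y - dotv x z.
Proof. by rewrite dotvDr dotvNr. Qed.

Lemma dotv0l n (z : 'rV[R]_n) : dotv 0 z = 0.
Proof. by rewrite -(scale0r 0) dotvZl mul0r. Qed.

Lemma dotv_mx n (x y : 'rV[R]_n) : dotv x y = (x *m y^T) ord0 ord0.
Proof. by rewrite mxE; apply: eq_bigr => i _; rewrite mxE. Qed.

Lemma dotv_ge0 n (x : 'rV[R]_n) : 0 <= dotv x x.
Proof. by apply: sumr_ge0 => i _; rewrite -expr2 sqr_ge0. Qed.

Lemma sqr_enorm n (x : 'rV[R]_n) : enorm x ^+ 2 = dotv x x.
Proof. by rewrite sqr_sqrtr// dotv_ge0. Qed.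

Lemma enorm_ge0 n (x : 'rV[R]_n) : 0 <= enorm x.
Proof. exact: sqrtr_ge0. Qed.
Hint Resolve enorm_ge0 : core.

Lemma enorm0 n : enorm (0 : 'rV[R]_n) = 0.
Proof. by rewrite /enorm dotv0l sqrtr0. Qed.

Lemma enormN n (x : 'rV[R]_n) : enorm (- x) = enorm x.
Proof. by rewrite /enorm dotvNl dotvNr opprK. Qed.

Lemma enormZ n a (x : 'rV[R]_n) : enorm (a *: x) = `|a| * enorm x.
Proof. by rewrite /enorm dotvZl dotvZr mulrA -expr2 sqrtrM ?sqr_ge0// sqrtr_sqr. Qed.

Lemma ler_coord_enorm n (x : 'rV[R]_n) i : `|x 0 i| <= enorm x.
Proof.
rewrite -sqrtr_sqr ler_sqrt ?dotv_ge0// /dotv (bigD1 i)//= -expr2 lerDl.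
by apply: sumr_ge0 => j _; rewrite -expr2 sqr_ge0.
Qed.

Lemma enorm_eq0 n (x : 'rV[R]_n) : (enorm x == 0) = (x == 0).
Proof.
apply/eqP/eqP => [x0|->]; last exact: enorm0.
apply/rowP => i; apply/eqP; rewrite mxE -normr_le0 -x0; exact: ler_coord_enorm.
Qed.

Lemma enorm_gt0 n (x : 'rV[R]_n) : (0 < enorm x) = (x != 0).
Proof. by rewrite lt_def enorm_eq0 enorm_ge0 andbT. Qed.

Lemma ler_dotv_enorm n (x y : 'rV[R]_n) : `|dotv x y| <= enorm x * enorm y.
Proof.
have [->|y0] := eqVneq y 0; first by rewrite dotvC dotv0l enorm0 mulr0 normr0.
rewrite -[leRHS]ger0_norm ?mulr_ge0// -ler_sqr ?nnegrE ?normr_ge0//.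
rewrite !real_normK ?num_real// exprMn !sqr_enorm.
have y2 : 0 < dotv y y by rewrite -sqr_enorm exprn_gt0 ?enorm_gt0.
(* This square equals |y|^2 (|x|^2 |y|^2 - (x.y)^2), a form of the projection argument without
   division. *)
have := dotv_ge0 (dotv y y *: x - dotv x y *: y).
rewrite dotvBl !dotvBr !dotvZl !dotvZr (dotvC y x).
set a := dotv x x; set b := dotv y y in y2 *; set c := dotv x y => H.
have {}H : 0 <= b * (a * b - c ^+ 2) by apply: le_trans H _; rewrite le_eqVlt; apply/orP; left; apply/eqP; ring.
by rewrite -subr_ge0 -(pmulr_rge0 _ y2).
Qed.

Lemma ler_enormD n (x y : 'rV[R]_n) : enorm (x + y) <= enorm x + enorm y.
Proof.
rewrite -ler_sqr ?nnegrE ?addr_ge0// sqrrD !sqr_enorm dotvDl !dotvDr (dotvC y x).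
have : dotv x y <= enorm x * enorm y by apply: le_trans (ler_dotv_enorm _ _); exact: ler_norm.
lra.
Qed.

Lemma ler_enormB n (x y z : 'rV[R]_n) : enorm (x - z) <= enorm (x - y) + enorm (y - z).
Proof. by rewrite -(subrKA y); exact: ler_enormD. Qed.

Lemma enorm_le_sum n (x : 'rV[R]_n) : enorm x <= \sum_i `|x 0 i|.
Proof.
rewrite -ler_sqr ?nnegrE ?sumr_ge0// sqr_enorm [leRHS]expr2 mulr_suml.
apply: ler_sum => i _; rewrite -expr2 -real_normK ?num_real// expr2 ler_wpM2l//.
by rewrite (bigD1 i)//= lerDl sumr_ge0.
Qed.

Lemma ball_sub_eball n (c : 'rV[R]_n) (r : R) : 0 < r ->
  exists2 e, 0 < e & forall x : 'rV[R]_n, (forall i, `|x 0 i - c 0 i| < e) -> enorm (x - c) < r.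
Proof.
move=> r0; exists (r / n.+1%:R); first by rewrite divr_gt0.
move=> x xc; apply: le_lt_trans (enorm_le_sum _) _.
apply: (@le_lt_trans _ _ (\sum_(i < n) r / n.+1%:R)).
  by apply: ler_sum => i _; rewrite !mxE ltW.
rewrite sumr_const card_ord -[_ *+ n]mulr_natr -mulrA gtr_pMr// mulrC ltr_pdivrMr// mul1r.
by rewrite ltr_nat.
Qed.

(* Householder reflection. *)
Lemma orthogonal_transitive n (x y : 'rV[R]_n) : enorm x = enorm y ->
  exists M : 'M[R]_n, [/\ M \in unitmx, x *m M = y &
    forall u, enorm (u *m M) = enorm u].
Proof.
move=> xy; have [<-|xNy] := eqVneq x y.
  by exists 1%:M; split; [exact: unitmx1|exact: mulmx1|move=> u; rewrite mulmx1].
pose v := x - y; have v0 : 0 < dotv v v.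
  by rewrite -sqr_enorm exprn_gt0// enorm_gt0 subr_eq0.
pose M : 'M[R]_n := 1%:M - (2 / dotv v v) *: (v^T *m v).
have ME u : u *m M = u - (2 / dotv v v * dotv u v) *: v.
  rewrite mulmxBr mulmx1 -scalemxAr mulmxA; congr (_ - _).
  by rewrite [u *m v^T]mx11_scalar -dotv_mx mul_scalar_mx scalerA.
have Mv u : dotv (u *m M) v = - dotv u v.
  by rewrite ME dotvBl dotvZl; field; rewrite gt_eqF.
have MM : M *m M = 1%:M.
  apply/row_matrixP => i; rewrite 2!rowE mulmx1 mulmxA ME Mv ME.
  by rewrite mulrN scaleNr opprK subrK.
exists M; split.
- by have [] := mulmx1_unit MM.
- rewrite ME; suff -> : 2 / dotv v v * dotv x v = 1 by rewrite scale1r subKr.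
  have : dotv x x = dotv y y by rewrite -!sqr_enorm xy.
  move: v0; rewrite /v !dotvBl !dotvBr (dotvC y x) => + xxyy.
  rewrite -xxyy => xy0; field; rewrite gt_eqF//; lra.
- move=> u; rewrite /enorm; congr Num.sqrt; rewrite [in LHS]ME dotvBr dotvZr.
  have dB (a b w : 'rV[R]_n) (c : R) : dotv (a - c *: b) w = dotv a w - c * dotv b w.
    by rewrite dotvBl dotvZl.
  by rewrite !dB (dotvC v u); field; rewrite gt_eqF.
Qed.

Lemma measurable_dotv d (T : measurableType d) n (f g : T -> 'rV[R]_n) :
  (forall i, measurable_fun setT (fun x => f x 0 i)) ->
  (forall i, measurable_fun setT (fun x => g x 0 i)) ->
  measurable_fun setT (fun x => dotv (f x) (g x)).
Proof.
by move=> mf mg; apply: measurable_sum => i; exact: measurable_funM.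
Qed.

Lemma measurable_sqrt : measurable_fun setT (@Num.sqrt R).
Proof. by apply: continuous_measurable_fun; exact: sqrt_continuous. Qed.

Lemma measurable_enorm d (T : measurableType d) n (f : T -> 'rV[R]_n) :
  (forall i, measurable_fun setT (fun x => f x 0 i)) ->
  measurable_fun setT (fun x => enorm (f x)).
Proof.
move=> mf; apply: (measurableT_comp measurable_sqrt).
exact: measurable_dotv.
Qed.

End euclid.
#[global] Hint Resolve enorm_ge0 : core.

(** * Integrable real functions *)

Section real_integrals.
Context d (T : measurableType d) {R : realType} (m : {measure set T -> \bar R}).
Implicit Types (f g : T -> R).

Definition rint f := m.-integrable setT (EFin \o f).

Lemma rint_measurable f : rint f -> measurable_fun setT f.
Proof. by move=> /integrableP[/measurable_EFinP]. Qed.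

Lemma rintP f : measurable_fun setT f ->
  (\int[m]_x (`|f x|)%:E < +oo)%E -> rint f.
Proof. by move=> mf foo; apply/integrableP; split => //; exact/measurable_EFinP. Qed.

Lemma rint_lty f : rint f -> (\int[m]_x (`|f x|)%:E < +oo)%E.
Proof. by move=> /integrableP[]. Qed.

Lemma rint_le f g : measurable_fun setT f -> rint g -> (forall x, `|f x| <= g x) -> rint f.
Proof.
move=> mf ig fg; apply: le_integrable ig => //; first exact/measurable_EFinP.
by move=> x _ /=; rewrite lee_fin (le_trans (fg x))// ler_norm.
Qed.

Lemma rint0 : rint (fun=> 0).
Proof. exact: integrable0. Qed.

Lemma rintD f g : rint f -> rint g -> rint (fun x => f x + g x).
Proof.
by move=> fi gi; apply: eq_integrable (integrableD _ fi gi) => // x _ /=; rewrite EFinD.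
Qed.

Lemma rintZ a f : rint f -> rint (fun x => a * f x).
Proof.
by move=> fi; apply: eq_integrable (integrableZl measurableT a fi) => // x _ /=; rewrite EFinM.
Qed.

Lemma rintN f : rint f -> rint (fun x => - f x).
Proof.
by move=> fi; apply: eq_integrable (rintZ (-1) fi) => // x _ /=; rewrite mulN1r.
Qed.

Lemma rintB f g : rint f -> rint g -> rint (fun x => f x - g x).
Proof. by move=> fi gi; apply: rintD => //; exact: rintN. Qed.

Lemma rint_sum I (r : seq I) (P : pred I) (h : I -> T -> R) :
  (forall i, P i -> rint (h i)) -> rint (fun x => \sum_(i <- r | P i) h i x).
Proof.
move=> hi; elim: r => [|i r IH].
  by apply: eq_integrable rint0 => // x _ /=; rewrite big_nil.
case Pi : (P i).
  apply: eq_integrable (rintD (hi i Pi) IH) => // x _ /=.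
  by rewrite big_cons Pi.
by apply: eq_integrable IH => // x _ /=; rewrite big_cons Pi.
Qed.

Lemma Rintegral_sum I (r : seq I) (P : pred I) (h : I -> T -> R) :
  (forall i, P i -> rint (h i)) ->
  \int[m]_x (\sum_(i <- r | P i) h i x) = \sum_(i <- r | P i) \int[m]_x h i x.
Proof.
move=> hi; elim: r => [|i r IH].
  rewrite big_nil; under eq_Rintegral do rewrite big_nil.
  by rewrite Rintegral_cst// mul0r.
rewrite big_cons; case Pi : (P i); last first.
  by under eq_Rintegral do rewrite big_cons Pi.
under eq_Rintegral do rewrite big_cons Pi.
by rewrite RintegralD// ?IH//; [exact: hi|exact: rint_sum].
Qed.

Lemma rintMbd a f g : rint f -> measurable_fun setT g -> (forall x, `|g x| <= a) ->
  rint (fun x => g x * f x).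
Proof.
move=> fi mg ga; apply: (@rint_le _ (fun x => a * `|f x|)).
- by apply: measurable_funM => //; exact: rint_measurable.
- apply: rintZ; exact: integrable_norm.
- by move=> x; rewrite normrM ler_wpM2r.
Qed.

Lemma EFin_Rintegral f : rint f -> (\int[m]_x f x)%:E = (\int[m]_x (f x)%:E)%E.
Proof. by move=> fi; rewrite fineK//; exact: integrable_fin_num. Qed.

Lemma Rintegral_sqr_CS f g : rint (fun x => f x ^+ 2) -> rint (fun x => g x ^+ 2) ->
  rint (fun x => f x * g x) ->
  (\int[m]_x (f x * g x)) ^+ 2 <= \int[m]_x (f x ^+ 2) * \int[m]_x (g x ^+ 2).
Proof.
move=> f2 g2 fg; set A := \int[m]_x (f x ^+ 2); set C := \int[m]_x (g x ^+ 2).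
set B := \int[m]_x (f x * g x).
have H l : 0 <= A - l * (2 * B) + l ^+ 2 * C.
  have : 0 <= \int[m]_x ((f x - l * g x) ^+ 2).
    by apply: Rintegral_ge0 => x _; exact: sqr_ge0.
  suff -> : \int[m]_x ((f x - l * g x) ^+ 2) = A - l * (2 * B) + l ^+ 2 * C by [].
  transitivity (\int[m]_x (f x ^+ 2 - l * (2 * (f x * g x)) + l ^+ 2 * g x ^+ 2)).
    by apply: eq_Rintegral => x _; ring.
  rewrite RintegralD//; [|by apply: rintB => //; do 2 apply: rintZ|exact: rintZ].
  rewrite RintegralB//; [|by do 2 apply: rintZ].
  by rewrite !RintegralZl//; exact: rintZ.
have C0 : 0 <= C by apply: Rintegral_ge0 => x _; exact: sqr_ge0.
have A0 : 0 <= A by apply: Rintegral_ge0 => x _; exact: sqr_ge0.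
have [C00|Cn0] := eqVneq C 0.
  rewrite C00 mulr0; have [->|B0] := eqVneq B 0; first by rewrite expr2 mulr0.
  (* When C = 0 the polynomial is affine in l, and this l gives it the value -1. *)
  have := H ((A + 1) / (2 * B)); rewrite C00 mulr0 addr0 divfK; last by rewrite mulf_neq0// pnatr_eq0.
  lra.
have Cp : 0 < C by rewrite lt_def Cn0.
have := H (B / C); rewrite -(pmulr_rge0 _ Cp).
rewrite -[B ^+ 2 <= _]subr_ge0.
suff -> : C * (A - B / C * (2 * B) + (B / C) ^+ 2 * C) = A * C - B ^+ 2 by [].
by field; exact: lt0r_neq0.
Qed.

End real_integrals.

(** * Fubini under domination by a product *)

Section real_fubini.
Context d1 d2 (T1 : measurableType d1) (T2 : measurableType d2) {R : realType}.
Variables (m1 : {sigma_finite_measure set T1 -> \bar R})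
          (m2 : {sigma_finite_measure set T2 -> \bar R}).
Variables (f : T1 * T2 -> R) (a : T1 -> R) (b : T2 -> R).
Hypotheses (mf : measurable_fun setT f) (ia : rint m1 a) (ib : rint m2 b).
Hypothesis fab : forall x y, `|f (x, y)| <= a x * b y.

Let fx x : rint m2 (fun y => f (x, y)).
Proof.
apply: (@rint_le _ _ _ _ _ (fun y => a x * b y)) => //.
- exact: measurableT_comp.
- exact: rintZ.
Qed.

Let fy y : rint m1 (fun x => f (x, y)).
Proof.
apply: (@rint_le _ _ _ _ _ (fun x => b y * a x)) => //.
- exact: measurableT_comp.
- exact: rintZ.
- by move=> x; rewrite mulrC.
Qed.

(** Tonelli for the majorant [a x * b y], whose integral is a product of two finite ones. *)
Lemma dominated_rint_prod : ((m1 \x m2)%E).-integrable setT (EFin \o f).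
Proof.
apply/integrable12ltyP; first exact/measurable_EFinP.
apply: (@le_lt_trans _ _ (\int[m1]_x (`|a x|%:E * \int[m2]_y (`|b y|)%:E))%E).
  apply: ge0_le_integral => //.
  - by move=> x _; exact: integral_ge0.
  - apply: (measurable_fun_fubini_tonelli_F (fun p => `|(f p)%:E|)%E) => //.
    by apply: measurableT_comp => //; exact/measurable_EFinP.
  - apply: emeasurable_funM => //; apply/measurable_EFinP.
    by apply: measurableT_comp => //; exact: rint_measurable ia.
  move=> x _; rewrite -ge0_integralZl//; last first.
    by apply/measurable_EFinP/measurableT_comp => //; exact: rint_measurable ib.
  apply: ge0_le_integral => //.
  - by apply/measurable_EFinP; do 2 apply: measurableT_comp => //.
  - apply/measurable_EFinP; apply: measurable_funM => //; apply: measurableT_comp => //.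
    exact: rint_measurable ib.
  - by move=> y _; rewrite lee_fin (le_trans (fab _ _))// -normrM ler_norm.
rewrite ge0_integralZr//.
- apply: lte_mul_pinfty; [exact: integral_ge0| |exact: rint_lty].
  by rewrite ge0_fin_numE ?integral_ge0//; exact: rint_lty.
- by apply/measurable_EFinP/measurableT_comp => //; exact: rint_measurable ia.
- exact: integral_ge0.
Qed.

Lemma dominated_rint_fst : rint m1 (fun x => \int[m2]_y f (x, y)).
Proof.
apply: eq_integrable (integrable_fubini_F dominated_rint_prod) => // x _ /=.
by rewrite /fubini_F EFin_Rintegral.
Qed.

Lemma dominated_Rfubini :
  \int[m1]_x \int[m2]_y f (x, y) = \int[m2]_y \int[m1]_x f (x, y).
Proof.
have := Fubini dominated_rint_prod => /= H.
rewrite /Rintegral; congr fine.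
transitivity (\int[m1]_x \int[m2]_y (f (x, y))%:E)%E.
  by apply: eq_integral => x _; rewrite -EFin_Rintegral.
by rewrite H; apply: eq_integral => x _; rewrite -EFin_Rintegral.
Qed.

End real_fubini.

(** * Signed integrands, cubes and balls in R^n *)

Section Rn_integrals.
Context {R : realType}.
Local Notation RM := (measurableTypeR R).
Local Notation mu := (@lebesgue_measure R).

(** Transfers the change of variables rules, proved for nonnegative integrands, to signed ones. *)
Lemma integral_posneg d (T : measurableType d) (m : {measure set T -> \bar R})
   (f : T -> R) : (\int[m]_x (f x)%:E =
   \int[m]_x (Num.max (f x) 0)%:E - \int[m]_x (Num.max (- f x) 0)%:E)%E.
Proof.
rewrite integralE; congr (_ - _)%E; apply: eq_integral => x _.
  by rewrite funeposE EFin_max.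
by rewrite funenegE EFin_max.
Qed.

Lemma measurable_max0 d (T : measurableType d) (f : T -> R) :
  measurable_fun setT f -> measurable_fun setT (fun x => (Num.max (f x) 0)%:E).
Proof. by move=> mf; apply/measurable_EFinP; exact: measurable_maxr. Qed.

Lemma integral_Rn_translate n (f : 'rV[R]_n -> R) b : measurable_Rn f ->
  integral_Rn (fun x => f (x + b)) = integral_Rn f.
Proof.
move=> mf; rewrite /integral_Rn /Rintegral; congr fine.
rewrite [LHS]integral_posneg [RHS]integral_posneg; congr (_ - _)%E.
  rewrite (ge0_integral_translate (f := fun x => (Num.max (f x) 0)%:E) b)//.
    exact: measurable_max0.
  by move=> x; rewrite lee_fin le_max lexx orbT.
rewrite (ge0_integral_translate (f := fun x => (Num.max (- f x) 0)%:E) b)//.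
  by apply: measurable_max0; exact: measurableT_comp.
by move=> x; rewrite lee_fin le_max lexx orbT.
Qed.

(** Used for the volume of cubes, which bound balls from outside ([rint_ball]) and from inside
    ([integral_chi_gt0]). *)
Lemma ge0_integral_prod n (phi : R -> R) : measurable_fun setT phi ->
  (forall x, (0 <= phi x)) -> (\int[mu]_x (phi x)%:E < +oo)%E ->
  (\int[leb R n]_t (\prod_i phi (rvec t ord0 i))%:E =
  (\int[mu]_x (phi x)%:E) ^+ n)%E.
Proof.
move=> mphi p0 poo.
have mP k : mRn (fun v : 'rV[R]_k => (\prod_i phi (v ord0 i))%:E).
  apply/measurable_EFinP; apply: measurable_prod => i _.
  by apply: (measurableT_comp mphi); exact: measurable_rvec_coord.
have P0 k (v : 'rV[R]_k) : (0 <= (\prod_i phi (v ord0 i))%:E)%E.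
  by rewrite lee_fin; apply: prodr_ge0.
elim: n => [|n IH]; first by rewrite integral_leb0 big_ord0.
rewrite (ge0_integral_rV1 (mP _))//.
transitivity (\int[mu]_x ((phi x)%:E * (\int[mu]_x (phi x)%:E) ^+ n))%E.
  apply: eq_integral => x _; rewrite -IH -ge0_integralZl_EFin//; last exact: mP.
  apply: eq_integral => t _.
  rewrite (@big_split_ord _ _ _ 1%N n)/= big_ord1 -EFinM row_mxEl mxE eqxx.
  by congr ((_ * _)%:E); apply: eq_bigr => i _; rewrite row_mxEr.
rewrite ge0_integralZr//; last 3 first.
- exact/measurable_EFinP.
- by move=> x _; rewrite lee_fin.
- by apply: expe_ge0; apply: integral_ge0 => x _; rewrite lee_fin.
by rewrite expeS.
Qed.

Lemma measurable_natr_bool d (T : measurableType d) (f : T -> bool) :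
  measurable_fun setT f -> measurable_fun setT (fun x => (f x)%:R : R).
Proof.
move=> mf; apply: (eq_measurable_fun (fun x => if f x then 1 else 0 : R)).
  by move=> x _; case: (f x).
exact: measurable_fun_ifT.
Qed.

Lemma integral_ball1 (a b : R) : a <= b ->
  (\int[mu]_x ((a <= x <= b)%R%:R)%:E = (b - a)%:E)%E.
Proof.
move=> ab; transitivity (\int[mu]_x (\1_(`[a, b]%classic) x)%:E)%E.
  by apply: eq_integral => x _; rewrite indicE mem_setE in_itv.
rewrite integral_indic// setIT [LHS]lebesgue_measure_itv/= lte_fin.
by move: ab; rewrite le_eqVlt => /predU1P[->|->]; rewrite ?ltxx ?subrr// -EFinB.
Qed.

Lemma measurable_enorm_rvec n (c : 'rV[R]_n) :
  measurable_fun setT (fun t : n.-tuple RM => enorm (rvec t - c)).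
Proof.
apply: measurable_enorm => i.
rewrite (_ : (fun _ => _) = fun t : n.-tuple RM => rvec t 0 i - c 0 i).
  by apply: measurable_funB => //; exact: measurable_rvec_coord.
by apply/funext => t; rewrite !mxE.
Qed.

Lemma rint_ball n (c : 'rV[R]_n) r :
  rint (leb R n) (fun t => (enorm (rvec t - c) <= r)%R%:R).
Proof.
have mb : measurable_fun setT
    (fun t : n.-tuple RM => (enorm (rvec t - c) <= r)%R%:R : R).
  by apply: measurable_natr_bool; apply: measurable_fun_ler => //; exact: measurable_enorm_rvec.
apply: rintP => //.
have [r0|r0] := ltP r 0.
  by rewrite integral0_eq// => t _; rewrite leNgt (lt_le_trans r0 (enorm_ge0 _)) /= normr0.
pose phi (x : R) : R := (- r <= x <= r)%R%:R.
have mphi : measurable_fun setT phi.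
  apply: measurable_natr_bool.
  by apply: measurable_and; exact: measurable_fun_ler.
have phiE : (\int[mu]_x (phi x)%:E = (r + r)%:E)%E.
  by rewrite integral_ball1 ?opprK//; lra.
rewrite -(ge0_integral_translate (f := fun x => (`|(enorm (x - c) <= r)%R%:R|)%:E) c)//; last first.
  by apply/measurable_EFinP; exact: measurableT_comp.
apply: (@le_lt_trans _ _ (\int[leb R n]_t (\prod_i phi (rvec t ord0 i))%:E)%E); last first.
  by rewrite ge0_integral_prod// phiE ?ltry// -EFin_expe ltry.
apply: ge0_le_integral => //.
- under eq_fun do rewrite addrK.
  apply/measurable_EFinP; apply: measurableT_comp => //; apply: measurable_natr_bool.
  apply: measurable_fun_ler => //; apply: measurable_enorm; exact: measurable_rvec_coord.
- apply/measurable_EFinP; apply: measurable_prod => i _.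
  by apply: (measurableT_comp mphi); exact: measurable_rvec_coord.
move=> t _; rewrite lee_fin addrK.
have [tr|] := boolP (enorm _ <= r); last by rewrite normr0 prodr_ge0.
rewrite normr1 big1// => i _; rewrite /phi.
by rewrite -ler_norml (le_trans (ler_coord_enorm _ _)).
Qed.

End Rn_integrals.

(** * Indicators of balls and orthogonal invariance *)

Section ball_indicators.
Context {R : realType}.
Local Notation RM := (measurableTypeR R).
Local Notation mu := (@lebesgue_measure R).

Lemma rint_bounded_ball n (f : 'rV[R]_n -> R) (c : 'rV[R]_n) (M r : R) : measurable_Rn f ->
  (forall z, `|f z| <= M * (enorm (z - c) <= r)%R%:R) ->
  rint (leb R n) (fun t => f (rvec t)).
Proof. by move=> mf fM; apply: rint_le mf (rintZ M (rint_ball c r)) _ => t. Qed.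

Lemma le_integral_Rn n (f g : 'rV[R]_n -> R) :
  rint (leb R n) (fun t => f (rvec t)) -> rint (leb R n) (fun t => g (rvec t)) ->
  (forall z, f z <= g z) -> integral_Rn f <= integral_Rn g.
Proof. by move=> fi gi fg; apply: le_Rintegral => // x _; exact: fg. Qed.

Lemma eq_integral_Rn n (f g : 'rV[R]_n -> R) : f =1 g -> integral_Rn f = integral_Rn g.
Proof. by move=> fg; apply: eq_Rintegral => t _; exact: fg. Qed.

Lemma integral_Rn_ge0 n (f : 'rV[R]_n -> R) : (forall z, 0 <= f z) -> 0 <= integral_Rn f.
Proof. by move=> f0; apply: Rintegral_ge0 => t _; exact: f0. Qed.

Lemma measurable_Rn_comp_affine n (f : 'rV[R]_n -> R) (M : 'M[R]_n) b : measurable_Rn f ->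
  measurable_Rn (fun z => f (z *m M + b)).
Proof.
move=> mf; apply/measurable_EFinP.
by apply: (@mRn_lin _ _ _ (fun z => (f z)%:E)); exact/measurable_EFinP.
Qed.

Lemma measurable_Rn_translate n (f : 'rV[R]_n -> R) b : measurable_Rn f ->
  measurable_Rn (fun z => f (z + b)).
Proof.
move=> mf; apply: eq_measurable_fun (measurable_Rn_comp_affine 1%:M b mf) => t _.
by rewrite mulmx1.
Qed.

Lemma measurable_Rn_dilate n (f : 'rV[R]_n -> R) a : measurable_Rn f ->
  measurable_Rn (fun z => f (a *: z)).
Proof.
move=> mf; apply: eq_measurable_fun (measurable_Rn_comp_affine a%:M 0 mf) => t _.
by rewrite addr0 mul_mx_scalar.
Qed.

Lemma rint_translate n (f : 'rV[R]_n -> R) b :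
  rint (leb R n) (fun t => f (rvec t)) -> rint (leb R n) (fun t => f (rvec t + b)).
Proof.
move=> fi; have mf := rint_measurable fi; apply: rintP.
  exact: measurable_Rn_translate.
rewrite (ge0_integral_translate (f := fun z => `|f z|%:E) b)//; first exact: rint_lty.
by apply/measurable_EFinP; exact: measurableT_comp.
Qed.

Definition chi n (r : R) (z : 'rV[R]_n) : R := (enorm z < r)%R%:R.

Lemma chi_ge0 n r (z : 'rV[R]_n) : 0 <= chi r z.
Proof. exact: ler0n. Qed.

Lemma chi_le1 n r (z : 'rV[R]_n) : chi r z <= 1.
Proof. by rewrite /chi lern1 leq_b1. Qed.

Lemma measurable_chi n r : measurable_Rn (@chi n r).
Proof.
apply: measurable_natr_bool; apply: measurable_fun_ltr => //.
by apply: measurable_enorm => i; exact: measurable_rvec_coord.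
Qed.

Lemma rint_chi n r : rint (leb R n) (fun t => chi r (rvec t)).
Proof.
apply: (@rint_bounded_ball n (@chi n r) 0 1 r); first exact: measurable_chi.
move=> z; rewrite subr0 mul1r ger0_norm ?chi_ge0// ler_nat.
by have [/ltW ->|] := ltP (enorm z) r.
Qed.

Lemma integral_chi_gt0 n (r : R) : 0 < r -> 0 < integral_Rn (@chi n r).
Proof.
move=> r0; have [e e0 eP] := ball_sub_eball (0 : 'rV[R]_n) r0.
(* The half-width e / 2 keeps the closed cube inside the open one to which [eP] applies. *)
pose phi (x : R) : R := (- (e / 2) <= x <= e / 2)%R%:R.
have mphi : measurable_fun setT phi.
  apply: measurable_natr_bool.
  by apply: measurable_and; exact: measurable_fun_ler.
have phiE : (\int[mu]_x (phi x)%:E = e%:E)%E.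
  by rewrite integral_ball1 ?opprK//; [congr EFin; lra|lra].
have prodE := ge0_integral_prod n mphi (fun x => ler0n _ _) _.
have {}prodE : (\int[leb R n]_t (\prod_i phi (rvec t ord0 i))%:E = (e ^+ n)%:E)%E.
  by rewrite prodE phiE ?ltry// EFin_expe.
have mprod : measurable_Rn (fun z : 'rV[R]_n => \prod_i phi (z ord0 i)).
  apply: measurable_prod => i _.
  by apply: (measurableT_comp mphi); exact: measurable_rvec_coord.
have prod0 (z : 'rV[R]_n) : 0 <= \prod_i phi (z ord0 i) by apply: prodr_ge0.
have iprod : rint (leb R n) (fun t => \prod_i phi (rvec t ord0 i)).
  apply: rintP => //; under eq_integral do rewrite ger0_norm//.
  by rewrite prodE ltry.
have : integral_Rn (fun z : 'rV[R]_n => \prod_i phi (z ord0 i)) = e ^+ n.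
  by rewrite /integral_Rn /Rintegral prodE.
have : 0 < e ^+ n by rewrite exprn_gt0.
move=> /[swap] <- /lt_le_trans; apply.
apply: le_integral_Rn => //; first exact: rint_chi.
move=> z; rewrite /chi; have [zr|rz] := ltP (enorm z) r.
  by apply: prodr_ile1 => i _; rewrite /phi ler0n lern1 leq_b1.
have [i zi] : exists i, ~~ (- (e / 2) <= z ord0 i <= e / 2).
  apply/existsP; rewrite -[[exists _, _]]negbK; apply/negP => /existsPn H.
  move: rz; rewrite leNgt => /negP; apply; rewrite -[z]subr0; apply: eP => i.
  rewrite mxE subr0; have := H i; rewrite negbK -ler_norml => /le_lt_trans; apply; lra.
by rewrite (bigD1 i)//= /phi (negbTE zi) mul0r.
Qed.

(** The factor of [scales_leb] must be 1: the unit ball is preserved and its volume is positive and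
    finite. *)
Lemma integral_Rn_orthogonal n (M : 'M[R]_n) (f : 'rV[R]_n -> R) : M \in unitmx ->
  (forall u : 'rV[R]_n, enorm (u *m M) = enorm u) -> measurable_Rn f ->
  integral_Rn (fun z => f (z *m M)) = integral_Rn f.
Proof.
move=> uM nM mf; have [c c0 cP] := unitmx_scales_leb uM.
have c1 : c = 1.
  have := cP (fun z => (chi 1 z)%:E); under eq_integral do rewrite /chi nM.
  rewrite -!EFin_Rintegral; [|exact: rint_chi..].
  move=> /(_ _)/wrap[]; first by apply/measurable_EFinP; exact: measurable_chi.
  move=> /(_ _)/wrap[]; first by move=> z; rewrite lee_fin chi_ge0.
  rewrite -EFinM => -[] /eqP; rewrite -[X in X == _]mul1r -subr_eq0 -mulrBl mulf_eq0.
  by rewrite (gt_eqF (integral_chi_gt0 _ _))// orbF subr_eq0 => /eqP.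
move: cP; rewrite c1 => cP.
rewrite /integral_Rn /Rintegral; congr fine.
rewrite [LHS]integral_posneg [RHS]integral_posneg; congr (_ - _)%E.
  rewrite (cP (fun z => (Num.max (f z) 0)%:E)) ?mul1e//; first exact: measurable_max0.
  by move=> x; rewrite lee_fin le_max lexx orbT.
rewrite (cP (fun z => (Num.max (- f z) 0)%:E)) ?mul1e//.
  by apply: measurable_max0; exact: measurableT_comp.
by move=> x; rewrite lee_fin le_max lexx orbT.
Qed.

End ball_indicators.

(** * Smeared charges *)

Section ball_kernel.
Context {R : realType}.
Local Notation RM := (measurableTypeR R).
Variable n : nat.

Lemma integral_RnZ a (f : 'rV[R]_n -> R) : rint (leb R n) (fun t => f (rvec t)) ->
  integral_Rn (fun z => a * f z) = a * integral_Rn f.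
Proof. by move=> fi; rewrite /integral_Rn RintegralZl. Qed.

Lemma integral_RnD (f g : 'rV[R]_n -> R) : rint (leb R n) (fun t => f (rvec t)) ->
  rint (leb R n) (fun t => g (rvec t)) ->
  integral_Rn (fun z => f z + g z) = integral_Rn f + integral_Rn g.
Proof. by move=> fi gi; rewrite /integral_Rn RintegralD. Qed.

Lemma integral_RnB (f g : 'rV[R]_n -> R) : rint (leb R n) (fun t => f (rvec t)) ->
  rint (leb R n) (fun t => g (rvec t)) ->
  integral_Rn (fun z => f z - g z) = integral_Rn f - integral_Rn g.
Proof. by move=> fi gi; rewrite /integral_Rn RintegralB. Qed.

Lemma integral_Rn_sum I (r : seq I) (P : pred I) (h : I -> 'rV[R]_n -> R) :
  (forall i, P i -> rint (leb R n) (fun t => h i (rvec t))) ->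
  integral_Rn (fun z => \sum_(i <- r | P i) h i z) =
  \sum_(i <- r | P i) integral_Rn (h i).
Proof. by move=> hi; rewrite /integral_Rn Rintegral_sum. Qed.

Lemma integral_Rn_CS (f g : 'rV[R]_n -> R) : rint (leb R n) (fun t => f (rvec t) ^+ 2) ->
  rint (leb R n) (fun t => g (rvec t) ^+ 2) ->
  rint (leb R n) (fun t => f (rvec t) * g (rvec t)) ->
  integral_Rn (fun z => f z * g z) ^+ 2 <=
  integral_Rn (fun z => f z ^+ 2) * integral_Rn (fun z => g z ^+ 2).
Proof. by move=> f2 g2 fg; exact: Rintegral_sqr_CS f2 g2 fg. Qed.

Local Notation V := (integral_Rn (@chi R n (1/2))).

Lemma integral_chi_scale (c r : R) : 0 < c ->
  integral_Rn (@chi R n (c * r)) = c ^+ n * integral_Rn (@chi R n r).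
Proof.
move=> c0; apply: EFin_inj; rewrite EFinM !EFin_Rintegral; [|exact: rint_chi..].
have := @ge0_integral_dilate R n (fun z => (chi (c * r) z)%:E) c (lt0r_neq0 c0).
move=> /(_ _ _)/wrap[]; first by apply/measurable_EFinP; exact: measurable_chi.
  by move=> z; rewrite lee_fin chi_ge0.
rewrite (gtr0_norm c0).
have -> : (\int[leb R n]_t (chi (c * r) (c *: rvec t))%:E =
           \int[leb R n]_t (chi r (rvec t))%:E)%E.
  by apply: eq_integral => t _; rewrite /chi enormZ gtr0_norm// ltr_pM2l.
by move=> ->; rewrite muleA -EFinM divff ?mul1e// expf_neq0// gt_eqF.
Qed.

(** The kernel kappa before normalisation: the volume common to two balls of radius 1/2 centred at 0
    and x. *)
Definition corr (x : 'rV[R]_n) : R :=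
  integral_Rn (fun z => chi (1/2) z * chi (1/2) (z - x)).

Lemma measurable_chi_shift r (x : 'rV[R]_n) : measurable_Rn (fun z => chi r (z - x)).
Proof. exact: (measurable_Rn_translate (- x) (@measurable_chi R n r)). Qed.

Lemma rint_chi_shift r (x : 'rV[R]_n) : rint (leb R n) (fun t => chi r (rvec t - x)).
Proof. exact: (rint_translate (- x) (rint_chi n r)). Qed.

Lemma chi_norm r (z : 'rV[R]_n) : `|chi r z| <= 1.
Proof. by rewrite ger0_norm ?chi_ge0// chi_le1. Qed.

Lemma rint_chi2 (x y : 'rV[R]_n) :
  rint (leb R n) (fun t => chi (1/2) (rvec t - x) * chi (1/2) (rvec t - y)).
Proof.
apply: rintMbd; [exact: rint_chi_shift|exact: measurable_chi_shift|].
by move=> t; exact: chi_norm.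
Qed.

Lemma corr_shift (x y : 'rV[R]_n) :
  integral_Rn (fun z => chi (1/2) (z - x) * chi (1/2) (z - y)) = corr (y - x).
Proof.
rewrite /corr -(@integral_Rn_translate _ _ _ x).
  by apply: eq_integral_Rn => z; rewrite addrK opprB addrA.
by apply: measurable_funM; exact: measurable_chi_shift.
Qed.

(** A reflection carries x to y and preserves both the balls and the measure. *)
Lemma corr_radial (x y : 'rV[R]_n) : enorm x = enorm y -> corr x = corr y.
Proof.
move=> /orthogonal_transitive[M [uM <- nM]].
rewrite /corr -[RHS](integral_Rn_orthogonal uM nM); last first.
  by apply: measurable_funM; [exact: measurable_chi|exact: measurable_chi_shift].
by apply: eq_integral_Rn => z; rewrite /chi -mulmxBl !nM.
Qed.

Lemma corr0 : corr 0 = V.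
Proof.
apply: eq_integral_Rn => z; rewrite subr0 /chi.
by case: (_ < _); rewrite ?mulr1 ?mulr0.
Qed.

Lemma corr_ge0 x : 0 <= corr x.
Proof. by apply: integral_Rn_ge0 => z; rewrite mulr_ge0 ?chi_ge0. Qed.

Lemma corr_le x : corr x <= V.
Proof.
apply: le_integral_Rn.
- by have := rint_chi2 0 x; under eq_fun do rewrite subr0.
- exact: rint_chi.
- by move=> z; rewrite ler_piMr ?chi_ge0// chi_le1.
Qed.

Lemma corr_far x : 1 <= enorm x -> corr x = 0.
Proof.
move=> x1; rewrite /corr (@eq_integral_Rn _ _ _ (fun=> 0)).
  by rewrite /integral_Rn Rintegral_cst// mul0r.
move=> z; rewrite /chi; have [z1|] := ltP (enorm z); last by rewrite mul0r.
case: ltP => [zx|]; last by rewrite mulr0.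
have := ler_enormB 0 z x; rewrite !sub0r !enormN; lra.
Qed.

Variables (N : nat) (q : 'I_N -> R) (y : 'I_N -> 'rV[R]_n).

Definition smear (z : 'rV[R]_n) : R := \sum_j q j * chi (1/2) (z - y j).

Lemma measurable_smear : measurable_Rn smear.
Proof.
by apply: measurable_sum => j; apply: measurable_funM => //; exact: measurable_chi_shift.
Qed.

Lemma rint_smear : rint (leb R n) (fun t => smear (rvec t)).
Proof. by apply: rint_sum => j _; apply: rintZ; exact: rint_chi_shift. Qed.

Lemma smear_le z : `|smear z| <= \sum_j `|q j|.
Proof.
apply: le_trans (ler_norm_sum _ _ _) _; apply: ler_sum => j _.
by rewrite normrM ler_piMr// chi_norm.
Qed.

Lemma rint_smearM (f : 'rV[R]_n -> R) M : measurable_Rn f -> (forall z, `|f z| <= M) ->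
  rint (leb R n) (fun t => f (rvec t) * smear (rvec t)).
Proof. by move=> mf fM; exact: rintMbd rint_smear mf (fun t => fM (rvec t)). Qed.

Lemma rint_smear2 : rint (leb R n) (fun t => smear (rvec t) ^+ 2).
Proof. exact: (rint_smearM measurable_smear smear_le). Qed.

(** This identity makes [corr] positive definite: its quadratic form is an L^2 norm. *)
Lemma integral_smear_sqr :
  integral_Rn (fun z => smear z ^+ 2) = \sum_j \sum_k q j * q k * corr (y j - y k).
Proof.
transitivity (integral_Rn (fun z => \sum_j \sum_k q j * q k *
    (chi (1/2) (z - y k) * chi (1/2) (z - y j)))).
  apply: eq_integral_Rn => z; rewrite expr2 mulr_suml; apply: eq_bigr => j _.
  by rewrite mulr_sumr; apply: eq_bigr => k _; ring.
have i2 j k : rint (leb R n) (fun t => q j * q k *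
    (chi (1/2) (rvec t - y k) * chi (1/2) (rvec t - y j))).
  by apply: rintZ; exact: rint_chi2.
rewrite integral_Rn_sum; last by move=> j _; apply: rint_sum => k _.
apply: eq_bigr => j _; rewrite integral_Rn_sum; last by move=> k _.
apply: eq_bigr => k _; rewrite integral_RnZ; last exact: rint_chi2.
by rewrite -corr_shift.
Qed.

Lemma integral_smearM (f : 'rV[R]_n -> R) M : measurable_Rn f -> (forall z, `|f z| <= M) ->
  integral_Rn (fun z => f z * smear z) =
  \sum_j q j * integral_Rn (fun z => f (z + y j) * chi (1/2) z).
Proof.
move=> mf fM.
transitivity (integral_Rn (fun z => \sum_j q j * (f z * chi (1/2) (z - y j)))).
  apply: eq_integral_Rn => z; rewrite mulr_sumr; apply: eq_bigr => j _; ring.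
have fi j : rint (leb R n) (fun t => f (rvec t) * chi (1/2) (rvec t - y j)).
  by apply: rintMbd (rint_chi_shift _ _) mf (fun t => fM (rvec t)).
rewrite integral_Rn_sum; last by move=> j _; apply: rintZ; exact: fi.
apply: eq_bigr => j _; rewrite integral_RnZ; last exact: fi.
congr (_ * _); rewrite -(@integral_Rn_translate _ _ _ (y j)).
  by apply: eq_integral_Rn => z; rewrite addrK.
by apply: measurable_funM => //; exact: measurable_chi_shift.
Qed.

Hypothesis V0 : 0 < V.

(* Cauchy-Schwarz on the support of the smeared charge. *)
Lemma integral_smearM_sqr_le (f : 'rV[R]_n -> R) (rho : R) : measurable_Rn f ->
  (forall z, `|f z| <= 1) -> (forall j, enorm (y j) <= rho) ->
  (integral_Rn (fun z => f z * smear z)) ^+ 2 <=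
  integral_Rn (@chi R n (1/2 + rho)) * integral_Rn (fun z => smear z ^+ 2).
Proof.
move=> mf f1 yrho.
pose g z := f z * chi (1/2 + rho) z.
have mg : measurable_Rn g by apply: measurable_funM => //; exact: measurable_chi.
have fg z : f z * smear z = g z * smear z.
  rewrite /g /chi; have [_|zr] := ltP; first by rewrite mulr1.
  rewrite mulr0 mul0r /smear big1 ?mulr0// => j _; rewrite /chi.
  case: ltP => [zj|]; last by rewrite mulr0.
  have := ler_enormD (z - y j) (y j); rewrite subrK; have := yrho j; lra.
rewrite (eq_integral_Rn fg).
have g2 z : g z ^+ 2 <= chi (1/2 + rho) z.
  rewrite /g exprMn -[leRHS]mul1r ler_pM ?sqr_ge0//.
    by rewrite -real_normK ?num_real// expr_le1.
  by rewrite expr2 ler_piMr ?chi_ge0 ?chi_le1.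
have ig2 : rint (leb R n) (fun t => g (rvec t) ^+ 2).
  apply: rint_le (rint_chi n (1/2 + rho)) _; first exact: measurable_funX.
  by move=> t; rewrite ger0_norm ?sqr_ge0.
apply: (le_trans (integral_Rn_CS _ _ _)) => //; first exact: rint_smear2.
  apply: (rint_smearM mg (M := 1)) => z.
  by rewrite normrM -[leRHS]mul1r ler_pM// chi_norm.
rewrite ler_wpM2r//; first by apply: integral_Rn_ge0 => z; exact: sqr_ge0.
by apply: le_integral_Rn => //; exact: rint_chi.
Qed.

(** The case f = 1 of [integral_smearM_sqr_le]: the smeared charge has integral V times the total
    charge, and the ball of radius 1/2 + rho has volume (1 + 2 rho)^n V. *)
Lemma charge_sqr_le (rho : R) : 0 <= rho -> (forall j, enorm (y j) <= rho) ->
  (\sum_j q j) ^+ 2 <= (1 + 2 * rho) ^+ n * (V^-1 * integral_Rn (fun z => smear z ^+ 2)).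
Proof.
move=> rho0 yrho.
have := @integral_smearM_sqr_le (fun=> 1) rho (measurable_cst _) _ yrho.
move=> /(_ (fun=> _))/wrap[]; first by rewrite normr1.
rewrite (@integral_smearM (fun=> 1) 1)//; last by move=> _; rewrite normr1.
under eq_bigr do under eq_integral_Rn do rewrite mul1r.
rewrite -mulr_suml.
have -> : 1/2 + rho = (1 + 2 * rho) * (1/2) by lra.
rewrite integral_chi_scale; last lra.
set S := \sum_j _; set I := integral_Rn (fun z => smear z ^+ 2); move=> H.
rewrite -(ler_pM2r (exprn_gt0 2 V0)) -exprMn (le_trans H)//.
rewrite le_eqVlt; apply/orP; left; apply/eqP; field; exact: lt0r_neq0.
exact: measurable_cst.
Qed.

End ball_kernel.

(** * Gaussians and their Fourier transforms *)

Section gaussian1.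
Context {R : realType}.
Local Notation RM := (measurableTypeR R).
Local Notation mu := (@lebesgue_measure R).

Lemma rint_leR (f g : R -> R) : measurable_fun setT f -> rint mu g ->
  (forall x, `|f x| <= g x) -> rint mu f.
Proof.
move=> mf gi fg; exact: (@rint_le _ (measurableTypeR R : measurableType _) R mu f g mf gi fg).
Qed.

Lemma is_derive_affine (a b x : R) : is_derive x 1 (fun x => a * x + b) a.
Proof.
have : is_derive x 1 (a *: id + cst b : R -> R) (a *: 1 + 0) by apply: is_deriveD.
by move=> /is_derive_eq; apply; rewrite addr0 /GRing.scale/= mulr1.
Qed.

Lemma is_derive1_comp_affine (f : R -> R) (df a b x : R) :
  is_derive (a * x + b) 1 f df -> is_derive x 1 (fun x => f (a * x + b)) (df * a).
Proof.
move=> fd; have := is_derive_affine a b x => gd.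
exact: (@is_derive1_comp _ f (fun x => a * x + b) x df a fd gd).
Qed.

Lemma is_derive1_comp_linear (f : R -> R) (df a x : R) :
  is_derive (a * x) 1 f df -> is_derive x 1 (fun x => f (a * x)) (df * a).
Proof.
move=> fd; have := @is_derive1_comp_affine f df a 0 x; rewrite addr0 => /(_ fd).
by under eq_fun do rewrite addr0.
Qed.

Lemma is_derive1_mul (f g : R -> R) (df dg x : R) :
  is_derive x 1 f df -> is_derive x 1 g dg ->
  is_derive x 1 (fun x => f x * g x) (df * g x + f x * dg).
Proof.
move=> fd gd; have := @is_deriveM _ _ f g x 1 df dg fd gd.
by move=> /is_derive_eq; apply; rewrite /GRing.scale/=; ring.
Qed.

Lemma is_derive1_scale (c : R) (f : R -> R) (df x : R) :
  is_derive x 1 f df -> is_derive x 1 (fun x => c * f x) (c * df).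
Proof. by move=> fd; exact: (@is_deriveZ _ _ _ f c x 1 df fd). Qed.

Lemma is_derive_gauss (x : R) : is_derive x 1 gauss_fun (- 2 * x * gauss_fun x).
Proof.
have sq : is_derive x 1 (fun x : R => - x ^+ 2) (- (2 * x)).
  have : is_derive x 1 (- (@id R ^+ 2)) (- ((2%:R * id x ^+ 1) *: 1)).
    apply: is_deriveN.
  by rewrite [_ *: _]mulr1 expr1.
have := @is_derive1_comp _ expR (fun x => - x ^+ 2) x _ _ (is_derive_expR _) sq.
by rewrite /gauss_fun => /is_derive_eq; apply; ring.
Qed.

Lemma is_derive_under_integral (f f' : R -> R -> R) (G : R -> R) (a : R) :
  (forall x y : R, is_derive x 1 (f^~ y) (f' x y)) -> (forall x, rint mu (f x)) ->
  rint mu G -> (forall x y, `|x - a| < 1 -> `|f' x y| <= G y) ->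
  is_derive a 1 (fun x => \int[mu]_y f x y) (\int[mu]_y f' a y).
Proof.
move=> fd fi Gi fG.
have Ia : `]a - 1, a + 1[%classic a by rewrite /= in_itv/= ltrBlDr ltrDl; lra.
have Iz x : `]a - 1, a + 1[%classic x -> `|x - a| < 1.
  by rewrite /= in_itv/= ltr_norml => /andP[? ?]; lra.
have d1 x y : partial1of2 f x y = f' x y by rewrite partial1of2E; apply: derive_val.
have G0 y : 0 <= G y.
  by apply: le_trans (fG a y _); rewrite ?subrr ?normr0.
have dI := @derivable_under_integral R _ _ mu f setT measurableT a _ _ Ia
   (fun x _ => fi x) (fun x y _ _ => @ex_derive _ _ _ _ _ _ _ (fd x y)) G G0 Gi.
have DI := @differentiation_under_integral R _ _ mu f setT measurableT a _ _ Ia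
   (fun x _ => fi x) (fun x y _ _ => @ex_derive _ _ _ _ _ _ _ (fd x y)) G G0 Gi.
have bd x y : `]a - 1, a + 1[%classic x -> setT y -> `|partial1of2 f x y| <= G y.
  by move=> xI _; rewrite d1; apply: fG; exact: Iz.
apply: DeriveDef; first by apply: dI.
by rewrite -derive1E DI//; apply: eq_Rintegral => y _; rewrite d1.
Qed.

Lemma measurable_gauss : measurable_fun setT (@gauss_fun R).
Proof. exact: measurable_gauss_fun. Qed.

Lemma rint_gauss_scaled (a : R) : a != 0 -> rint mu (fun x => gauss_fun (a * x)).
Proof.
move=> a0; have gi : rint mu (@gauss_fun R) := integrableT_gauss.
have mga : measurable_fun setT (fun x : R => gauss_fun (a * x)).
  by apply: (measurableT_comp measurable_gauss); exact: measurable_funM.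
apply: rintP => //.
have := @ge0_integral_affine R a 0 (fun x => `|gauss_fun x|%:E) a0.
have -> : (\int[mu]_x `|gauss_fun (a * x + 0)|%:E =
    \int[mu]_x `|gauss_fun (a * x)|%:E)%E.
  by apply: eq_integral => x _; rewrite addr0.
move=> ->//; first by rewrite lte_mul_pinfty// ?lee_fin ?invr_ge0//; exact: rint_lty gi.
by apply/measurable_EFinP; apply: measurableT_comp => //; exact: measurable_gauss.
Qed.

(** A wider Gaussian absorbs the linear factor: e^u >= 1 + u at u = 3 x^2 / 4, together with (|x| -
    2/3)^2 >= 0. It provides the majorants for differentiation under the integral. *)
Lemma normM_gauss_le (x : R) : `|x| * gauss_fun x <= gauss_fun (1/2 * x).
Proof.
rewrite /gauss_fun.
have -> : - x ^+ 2 = - (1/2 * x) ^+ 2 - (3/4 * x ^+ 2) by field.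
rewrite expRD mulrCA ger_pMr ?expR_gt0// expRN ler_pdivrMr ?expR_gt0// mul1r.
apply: le_trans (expR_ge1Dx _); have : 0 <= (`|x| - 2/3) ^+ 2 := sqr_ge0 _.
have <- : `|x| ^+ 2 = x ^+ 2 by rewrite real_normK ?num_real.
lra.
Qed.

Definition cos_gauss (t : R) : R := \int[mu]_x (gauss_fun x * cos (t * x)).

Lemma rint_gauss_bd (f : R -> R) : measurable_fun setT f -> (forall x, `|f x| <= 1) ->
  rint mu (fun x => f x * gauss_fun x).
Proof. by move=> mf f1; apply: rintMbd integrableT_gauss mf f1. Qed.

Lemma measurable_sin : measurable_fun setT (@sin R).
Proof. by apply: continuous_measurable_fun; exact: continuous_sin. Qed.

Lemma measurable_cos : measurable_fun setT (@cos R).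
Proof. by apply: continuous_measurable_fun; exact: continuous_cos. Qed.

Lemma norm_sin_le1 (x : R) : `|sin x| <= 1.
Proof. by rewrite ler_norml sin_geN1 sin_le1. Qed.

Lemma norm_cos_le1 (x : R) : `|cos x| <= 1.
Proof. by rewrite ler_norml cos_geN1 cos_le1. Qed.

Lemma rint_gauss_cos t : rint mu (fun x => gauss_fun x * cos (t * x)).
Proof.
have := @rint_gauss_bd (fun y => cos (t * y)).
rewrite (_ : (fun x => cos (t * x) * _) = fun x => gauss_fun x * cos (t * x)); last first.
  by apply/funext => x; rewrite mulrC.
apply; last by move=> y; exact: norm_cos_le1.
by apply: (measurableT_comp measurable_cos); exact: measurable_funM.
Qed.

Lemma rint_gauss_sin t : rint mu (fun x => gauss_fun x * sin (t * x)).
Proof.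
have := @rint_gauss_bd (fun y => sin (t * y)).
rewrite (_ : (fun x => sin (t * x) * _) = fun x => gauss_fun x * sin (t * x)); last first.
  by apply/funext => x; rewrite mulrC.
apply; last by move=> y; exact: norm_sin_le1.
by apply: (measurableT_comp measurable_sin); exact: measurable_funM.
Qed.

Lemma rint_gauss_sinM t : rint mu (fun x => gauss_fun x * (sin (t * x) * x)).
Proof.
apply: (@rint_leR _ (fun x : R => gauss_fun (1/2 * x))).
- apply: measurable_funM; first exact: measurable_gauss.
  apply: measurable_funM => //.
  by apply: (measurableT_comp measurable_sin); exact: measurable_funM.
- by apply: rint_gauss_scaled; rewrite mul1r invr_neq0// pnatr_eq0.
- move=> y; rewrite !normrM (ger0_norm (gauss_fun_ge0 _)).
  apply: le_trans (normM_gauss_le y); rewrite mulrC ler_wpM2r ?gauss_fun_ge0//.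
  by rewrite ler_piMl// norm_sin_le1.
Qed.

Lemma is_derive_cos_gauss (t : R) : is_derive t 1 cos_gauss (\int[mu]_x (- (gauss_fun x * (sin (t * x) * x)))).
Proof.
apply: (@is_derive_under_integral (fun t x => gauss_fun x * cos (t * x))
  (fun t x => - (gauss_fun x * (sin (t * x) * x))) (fun x => gauss_fun (1/2 * x))).
- move=> x y; have H := is_derive1_comp_linear (is_derive_cos (y * x)).
  have := is_derive1_scale (gauss_fun y) H.
  under eq_fun do rewrite (mulrC y).
  by move=> /is_derive_eq; apply; rewrite (mulrC x); ring.
- exact: rint_gauss_cos.
- by apply: rint_gauss_scaled; rewrite mul1r invr_neq0// pnatr_eq0.
- move=> x y _; rewrite normrN !normrM (ger0_norm (gauss_fun_ge0 _)).
  apply: le_trans (normM_gauss_le y); rewrite mulrC ler_wpM2r ?gauss_fun_ge0//.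
  by rewrite ler_piMl// norm_sin_le1.
Qed.

(* Differentiating in h the translation invariant integral of
   gauss (x + h) * sin (t (x + h)) is an integration by parts. *)
Lemma gauss_parts t : \int[mu]_x (gauss_fun x * (sin (t * x) * x)) = t / 2 * cos_gauss t.
Proof.
pose F x := gauss_fun x * sin (t * x).
pose F' x := - 2 * x * gauss_fun x * sin (t * x) + gauss_fun x * (cos (t * x) * t).
have FD (x : R) : is_derive x 1 F (F' x).
  have H := is_derive1_comp_linear (is_derive_sin (t * x)).
  exact: (is_derive1_mul (is_derive_gauss x) H).
have mF : measurable_fun setT F.
  apply: measurable_funM; first exact: measurable_gauss.
  by apply: (measurableT_comp measurable_sin); exact: measurable_funM.
have iF : rint mu F.
  have gi : rint mu (@gauss_fun R) := integrableT_gauss.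
  apply: rint_leR mF gi _ => x.
  by rewrite normrM (ger0_norm (gauss_fun_ge0 _)) ler_piMr ?gauss_fun_ge0// norm_sin_le1.
have Fshift h : rint mu (fun x => F (x + h)).
  apply: rintP; first by apply: (measurableT_comp mF); exact: measurable_funD.
  rewrite (ge0_integral_shift h (f := fun x => `|F x|%:E))//; first exact: rint_lty.
  by apply/measurable_EFinP; exact: measurableT_comp.
(* A shift by |h| < 1 costs the factor e and a further widening: exp (- (x + h)^2 / 4) <= e exp (-
   x^2 / 16). *)
pose G (x : R) := (2 + `|t|) * expR 1 * gauss_fun (1/4 * x).
have iG : rint mu G by apply: rintZ; apply: rint_gauss_scaled; rewrite mul1r invr_neq0// pnatr_eq0.
have H := @is_derive_under_integral (fun h x => F (x + h)) (fun h x => F' (x + h)) G 0.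
have {}H : is_derive (0 : R) 1 (fun h => \int[mu]_x F (x + h)) (\int[mu]_x F' (x + 0)).
  apply: H => //.
  - move=> h x; have := @is_derive1_comp_affine F (F' (x + h)) 1 x h.
    rewrite mul1r addrC => /(_ (FD _)); rewrite mulr1.
    by under eq_fun do rewrite mul1r addrC.
  - move=> h x; rewrite subr0 => h1; rewrite /F' /G; set y := x + h.
    have gle : gauss_fun (1/2 * y) <= expR 1 * gauss_fun (1/4 * x).
      rewrite /gauss_fun -expRD ler_expR; move: h1; rewrite ltr_norml => /andP[? ?].
      have : h ^+ 2 <= 1 by rewrite -[h ^+ 2]real_normK ?num_real// expr_le1// ler_norml; apply/andP; split; lra.
      have := sqr_ge0 (x + 2 * h); have := sqr_ge0 x; rewrite /y; nra.
    have gle2 : gauss_fun y <= gauss_fun (1/2 * y).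
      by rewrite /gauss_fun ler_expR; have := sqr_ge0 y; nra.
    have g0 := gauss_fun_ge0 y.
    apply: (@le_trans _ _ ((2 + `|t|) * gauss_fun (1/2 * y))); last first.
      by rewrite -[leRHS]mulrA ler_wpM2l ?addr_ge0.
    apply: le_trans (ler_normD _ _) _; rewrite mulrDl lerD//.
      rewrite !normrM normrN (ger0_norm g0) normr_nat -mulrA.
      apply: le_trans (_ : 2 * (`|y| * gauss_fun y) <= _).
        by rewrite -[2 * `|y| * _]mulrA ler_wpM2l// mulrA ler_piMr ?mulr_ge0// norm_sin_le1.
      by rewrite ler_wpM2l// normM_gauss_le.
    rewrite !normrM (ger0_norm g0) mulrA mulrC ler_wpM2l//.
    by rewrite (le_trans _ gle2)// ler_piMr// norm_cos_le1.
have cF : (fun h => \int[mu]_x F (x + h)) = cst (\int[mu]_x F x).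
  apply/funext => h /=; rewrite /Rintegral; congr fine.
  rewrite [LHS]integral_posneg [RHS]integral_posneg; congr (_ - _)%E.
    rewrite (ge0_integral_shift h (f := fun x => (Num.max (F x) 0)%:E))//.
      exact: measurable_max0.
    by move=> x; rewrite lee_fin le_max lexx orbT.
  rewrite (ge0_integral_shift h (f := fun x => (Num.max (- F x) 0)%:E))//.
    by apply: measurable_max0; exact: measurableT_comp.
  by move=> x; rewrite lee_fin le_max lexx orbT.
have {H} : \int[mu]_x F' (x + 0) = 0.
  by have := @derive_val _ _ _ _ _ _ _ H; rewrite cF derive_cst.
rewrite (@eq_Rintegral _ _ _ mu setT (fun x => t * (gauss_fun x * cos (t * x)) -
  2 * (gauss_fun x * (sin (t * x) * x)))); last first.
  by move=> x _; rewrite addr0 /F'; ring.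
have i1 := rint_gauss_cos t.
have i2 := rint_gauss_sinM t.
rewrite RintegralB//; [|exact: rintZ..].
by rewrite !RintegralZl// -/(cos_gauss t) => E; lra.
Qed.

(** By [gauss_parts], [cos_gauss] solves y' = - (t / 2) y, so its product with exp (t^2 / 4) is
    constant; the value at 0 is the Gaussian integral. *)
Lemma cos_gaussE (t : R) : cos_gauss t = Num.sqrt pi * expR (- (t ^+ 2 / 4)).
Proof.
pose L t := cos_gauss t * expR (t ^+ 2 / 4).
have LD (x : R) : is_derive x 1 L 0.
  have sq : is_derive x 1 (fun x : R => 4^-1 * (x * x)) (4^-1 * (1 * x + x * 1)).
    by apply: is_derive1_scale; apply: is_derive1_mul.
  have ex := @is_derive1_comp _ expR _ x _ _ (is_derive_expR _) sq.
  have := is_derive1_mul (is_derive_cos_gauss x) ex.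
  rewrite (_ : (fun x => cos_gauss x * _) = L); last first.
    by apply/funext => z; rewrite /L /= mulrC -expr2 (mulrC 4^-1) mulrC.
  move=> /is_derive_eq; apply.
  rewrite (_ : (\int[mu]__ _) = - (x / 2 * cos_gauss x)); last first.
    rewrite -gauss_parts -mulN1r -RintegralZl//.
      by apply: eq_Rintegral => y _; rewrite mulN1r.
    exact: rint_gauss_sinM.
  by rewrite /=; field.
have L0 : L 0 = Num.sqrt pi.
  rewrite /L expr2 mul0r mul0r expR0 mulr1 /cos_gauss /Rintegral.
  under eq_integral do rewrite mul0r cos0 mulr1.
  by rewrite integralT_gauss.
have := is_derive_0_is_cst 0 t LD; rewrite L0 /L => ->.
by rewrite -mulrA -expRD subrr expR0 mulr1.
Qed.

Lemma rint_affine (a b : R) (f : R -> R) : a != 0 -> rint mu f ->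
  rint mu (fun x => f (a * x + b)).
Proof.
move=> a0 fi; have mf : measurable_fun setT f := rint_measurable fi.
apply: rintP.
  apply: (measurableT_comp mf); apply: measurable_funD => //; exact: measurable_funM.
rewrite (ge0_integral_affine b (f := fun x => `|f x|%:E) a0)//.
  by rewrite lte_mul_pinfty// ?lee_fin ?invr_ge0//; exact: rint_lty.
by apply/measurable_EFinP; exact: measurableT_comp.
Qed.

Lemma Rintegral_affine (a b : R) (f : R -> R) : a != 0 -> rint mu f ->
  \int[mu]_x f (a * x + b) = `|a|^-1 * \int[mu]_x f x.
Proof.
move=> a0 fi; have mf : measurable_fun setT f := rint_measurable fi.
apply: EFin_inj.
have ni : rint mu (fun x => `|f x|) by exact: integrable_norm.
have ip : rint mu (fun x => Num.max (f x) 0).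
  apply: rint_leR ni _; first exact: measurable_maxr.
  by move=> x /=; have [_|] := lerP (f x) 0; rewrite ?normr0.
have im : rint mu (fun x => Num.max (- f x) 0).
  apply: rint_leR ni _.
    by apply: measurable_maxr => //; exact: measurableT_comp.
  by move=> x /=; have [_|] := lerP (- f x) 0; rewrite ?normr0// normrN.
rewrite EFinM !EFin_Rintegral//; last exact: rint_affine.
rewrite [LHS]integral_posneg [in RHS]integral_posneg.
rewrite (ge0_integral_affine b (f := fun x => (Num.max (f x) 0)%:E) a0)//; last 2 first.
- exact: measurable_max0.
- by move=> x; rewrite lee_fin le_max lexx orbT.
rewrite (ge0_integral_affine b (f := fun x => (Num.max (- f x) 0)%:E) a0)//; last 2 first.
- by apply: measurable_max0; exact: measurableT_comp.
- by move=> x; rewrite lee_fin le_max lexx orbT.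
by rewrite -!EFin_Rintegral// -!EFinM -!EFinB mulrBr.
Qed.

Lemma gsin0 t : \int[mu]_x (gauss_fun x * sin (t * x)) = 0.
Proof.
have a0 : -1 != 0 :> R by rewrite oppr_eq0 oner_neq0.
have := Rintegral_affine 0 a0 (rint_gauss_sin t); rewrite normrN1 invr1 mul1r.
rewrite (@eq_Rintegral _ _ _ mu setT (fun x => -1 * (gauss_fun x * sin (t * x)))); last first.
  by move=> x _; rewrite !addr0 /gauss_fun !mulN1r sqrrN mulrN sinN mulrN.
rewrite RintegralZl//; last exact: rint_gauss_sin.
lra.
Qed.

(** The phase beta is there for the induction on the dimension, where it absorbs the contribution of
    the other coordinates. *)
Lemma fourier_gauss1 (xi beta : R) :
  \int[mu]_x (expR (- (pi * x ^+ 2)) * cos (2 * pi * (x * xi) + beta)) =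
  expR (- (pi * xi ^+ 2)) * cos beta.
Proof.
have p0 : 0 <= pi :> R by exact: pi_ge0.
pose a : R := Num.sqrt pi; have a2 : a ^+ 2 = pi by rewrite sqr_sqrtr.
have a0 : 0 < a by rewrite sqrtr_gt0 pi_gt0.
pose t := 2 * a * xi.
pose f x := gauss_fun x * cos (t * x + beta).
have fE x : f x = cos beta * (gauss_fun x * cos (t * x)) - sin beta * (gauss_fun x * sin (t * x)).
  by rewrite /f cosD; ring.
have fi : rint mu f.
  rewrite (_ : f = fun x => cos beta * (gauss_fun x * cos (t * x)) -
      sin beta * (gauss_fun x * sin (t * x))); last exact/funext.
  by apply: rintB; apply: rintZ; [exact: rint_gauss_cos|exact: rint_gauss_sin].
rewrite (@eq_Rintegral _ _ _ mu setT (fun x => f (a * x + 0))); last first.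
  move=> x _; rewrite addr0 /f /gauss_fun exprMn a2 /t; congr (_ * cos (_ + _)).
  by rewrite -a2; ring.
rewrite Rintegral_affine ?gt_eqF//.
rewrite (@eq_Rintegral _ _ _ mu setT (fun x => cos beta * (gauss_fun x * cos (t * x)) -
      sin beta * (gauss_fun x * sin (t * x)))); last by move=> x _; exact: fE.
rewrite RintegralB//; last 2 first.
- by apply: rintZ; exact: rint_gauss_cos.
- by apply: rintZ; exact: rint_gauss_sin.
rewrite !RintegralZl//; [|exact: rint_gauss_sin|exact: rint_gauss_cos].
rewrite gsin0 mulr0 subr0 -/(cos_gauss t) cos_gaussE gtr0_norm//.
have -> : t ^+ 2 / 4 = pi * xi ^+ 2 by rewrite /t -a2; field.
by rewrite -/a; field; rewrite gt_eqF.
Qed.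

End gaussian1.

Section gaussian_n.
Context {R : realType}.
Local Notation RM := (measurableTypeR R).
Local Notation mu := (@lebesgue_measure R).

Lemma dominated_integral_rV1 n (f : 'rV[R]_(1 + n) -> R) (a : R -> R) (b : 'rV[R]_n -> R) :
  measurable_Rn f -> rint mu a -> rint (leb R n) (fun t => b (rvec t)) ->
  (forall x v, `|f (row_mx (x%:M : 'M[R]_1) v)| <= a x * b v) ->
  rint (leb R (1 + n)) (fun t => f (rvec t)) /\
  integral_Rn f = \int[mu]_x integral_Rn (fun v => f (row_mx (x%:M : 'M[R]_1) v)).
Proof.
move=> mf ia ib fab.
pose h (p : RM * n.-tuple RM) := f (rvec (tcons p) : 'rV_(1 + n)).
have mh : measurable_fun setT h.
  exact: (measurableT_comp mf (@measurable_tcons R n)).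
have hab x y : `|h (x, y)| <= a x * b (rvec y) by rewrite /h rvec_tcons.
have ih := dominated_rint_prod mh ia ib hab.
have mfE : measurable_fun setT (EFin \o (fun t : n.+1.-tuple RM => f (rvec t))).
  exact/measurable_EFinP.
split.
  exact: (integrable_pushforward (@measurable_tcons R n) mfE ih measurableT).
rewrite {1}/integral_Rn /Rintegral.
rewrite [X in fine X](integral_pushforward (@measurable_tcons R n) mfE ih measurableT).
rewrite preimage_setT -(integral12_prod_meas1 ih); congr fine.
apply: eq_integral => x _; rewrite /fubini_F /=.
rewrite /integral_Rn EFin_Rintegral; last first.
  apply: (@rint_le _ _ _ _ _ (fun t => a x * b (rvec t))).
  - apply: (measurable_comp_rvec mf); apply: measurable_row_mx1 => //.
    exact: measurable_rvec_coord.
  - exact: rintZ.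
  - by move=> t; exact: fab.
by apply: eq_integral => t _; rewrite /h rvec_tcons.
Qed.

(** The factor pi makes this Gaussian its own Fourier transform under the convention exp (- 2 i pi
    x.xi), with total mass 1. *)
Definition gaussn n (z : 'rV[R]_n) : R := expR (- (pi * dotv z z)).

Lemma gaussn_ge0 n (z : 'rV[R]_n) : 0 <= gaussn z.
Proof. exact: expR_ge0. Qed.

Lemma gaussn_gt0 n (z : 'rV[R]_n) : 0 < gaussn z.
Proof. exact: expR_gt0. Qed.

Lemma gaussnN n (z : 'rV[R]_n) : gaussn (- z) = gaussn z.
Proof. by rewrite /gaussn dotvNl dotvNr opprK. Qed.

Lemma measurable_gaussn n : measurable_Rn (@gaussn n).
Proof.
apply: (measurableT_comp (@measurable_expR R)).
apply: measurableT_comp => //; apply: measurable_funM => //.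
by apply: measurable_dotv => i; exact: measurable_rvec_coord.
Qed.

Lemma measurable_phase n (xi : 'rV[R]_n) (beta : R) :
  measurable_Rn (fun z => 2 * pi * dotv z xi + beta).
Proof.
apply: measurable_funD => //; apply: measurable_funM => //.
by apply: measurable_dotv => i //; exact: measurable_rvec_coord.
Qed.

Lemma measurable_cos_phase n (xi : 'rV[R]_n) (beta : R) :
  measurable_Rn (fun z => cos (2 * pi * dotv z xi + beta)).
Proof. exact: (measurableT_comp measurable_cos (measurable_phase xi beta)). Qed.

Lemma dotv_row_mx n (x y : R) (v w : 'rV[R]_n) :
  dotv (row_mx (x%:M : 'M[R]_1) v) (row_mx (y%:M : 'M[R]_1) w) = x * y + dotv v w.
Proof.
rewrite /dotv (@big_split_ord _ _ _ 1%N n)/= big_ord1 !row_mxEl !mxE eqxx.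
by congr (_ + _); apply: eq_bigr => i _; rewrite !row_mxEr.
Qed.

Lemma rint_gauss1 : rint mu (fun x => expR (- (pi * x ^+ 2))).
Proof.
have a0 : Num.sqrt pi != 0 :> R by rewrite gt_eqF// sqrtr_gt0 pi_gt0.
apply: rint_leR (rint_gauss_scaled a0) _.
  by apply: (measurableT_comp (@measurable_expR R)); apply: measurableT_comp => //;
    apply: measurable_funM => //; exact: measurable_funX.
move=> x; rewrite /gauss_fun exprMn sqr_sqrtr ?pi_ge0// ger0_norm ?expR_ge0//.
Qed.

Lemma gaussn_row_mx n x (v : 'rV[R]_n) :
  gaussn (row_mx (x%:M : 'M[R]_1) v) = expR (- (pi * x ^+ 2)) * gaussn v.
Proof. by rewrite /gaussn dotv_row_mx mulrDr opprD expRD expr2. Qed.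

(** Integrability and the formula share one induction, since splitting off a coordinate requires the
    integrability of the remaining Gaussian. *)
Lemma fourier_gaussn_rint n : rint (leb R n) (fun t => gaussn (rvec t)) /\
  forall (xi : 'rV[R]_n) (beta : R),
  integral_Rn (fun z => gaussn z * cos (2 * pi * dotv z xi + beta)) =
  gaussn xi * cos beta.
Proof.
elim: n => [|n [IHi IH]].
  have dot0 (x y : 'rV[R]_0) : dotv x y = 0 by rewrite /dotv big_ord0.
  split.
    apply: rintP; first exact: measurable_gaussn.
    by rewrite integral_leb0 ltry.
  move=> xi beta; rewrite /integral_Rn /Rintegral integral_leb0/=.
  by rewrite /gaussn !dot0 !mulr0 add0r.
have gab x (v : 'rV[R]_n) : `|gaussn (row_mx (x%:M : 'M[R]_1) v)| <=
    expR (- (pi * x ^+ 2)) * gaussn v.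
  by rewrite ger0_norm ?gaussn_ge0// gaussn_row_mx.
have [gi _] := dominated_integral_rV1 (@measurable_gaussn (1 + n)) rint_gauss1 IHi gab.
split=> // xi beta.
have mg : measurable_Rn (fun z : 'rV[R]_(1 + n) => gaussn z * cos (2 * pi * dotv z xi + beta)).
  apply: measurable_funM; first exact: measurable_gaussn.
  exact: measurable_cos_phase.
have [|_ ->] := dominated_integral_rV1 mg rint_gauss1 IHi.
  move=> x v; rewrite normrM; apply: le_trans (gab x v).
  by rewrite ler_piMr// norm_cos_le1.
rewrite (rV_split xi); set xi0 := xi ord0 ord0; set xi' := rsubmx _.
rewrite gaussn_row_mx.
have inner x : integral_Rn (fun v : 'rV[R]_n => gaussn (row_mx (x%:M : 'M[R]_1) v) *
      cos (2 * pi * dotv (row_mx (x%:M : 'M[R]_1) v) (row_mx (xi0%:M : 'M[R]_1) xi') + beta)) =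
    gaussn xi' * (expR (- (pi * x ^+ 2)) * cos (2 * pi * (x * xi0) + beta)).
  pose beta' := 2 * pi * (x * xi0) + beta.
  transitivity (integral_Rn (fun v : 'rV[R]_n => expR (- (pi * x ^+ 2)) *
      (gaussn v * cos (2 * pi * dotv v xi' + beta')))).
    apply: eq_integral_Rn => v; rewrite gaussn_row_mx dotv_row_mx mulrA.
    by congr (_ * cos _); rewrite /beta'; ring.
  rewrite integral_RnZ; first by rewrite IH; ring.
  apply: rint_le IHi _; last first.
    move=> t; rewrite normrM ger0_norm ?gaussn_ge0//.
    by rewrite ler_piMr ?gaussn_ge0// norm_cos_le1.
  apply: measurable_funM; first exact: measurable_gaussn.
  exact: measurable_cos_phase.
transitivity (\int[mu]_x (gaussn xi' * (expR (- (pi * x ^+ 2)) *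
    cos (2 * pi * (x * xi0) + beta)))).
  by apply: eq_Rintegral => x _; exact: inner.
rewrite RintegralZl//.
  by rewrite fourier_gauss1; ring.
apply: rint_leR rint_gauss1 _.
  apply: measurable_funM; first exact: rint_measurable rint_gauss1.
  apply: (measurableT_comp measurable_cos); apply: measurable_funD => //.
  by apply: measurable_funM => //; exact: measurable_funM.
move=> x; rewrite normrM ger0_norm ?expR_ge0//.
by rewrite ler_piMr ?expR_ge0// norm_cos_le1.
Qed.

Lemma rint_gaussn n : rint (leb R n) (fun t => gaussn (rvec t)).
Proof. by have [] := fourier_gaussn_rint n. Qed.

Lemma fourier_gaussn n (xi : 'rV[R]_n) (beta : R) :
  integral_Rn (fun z => gaussn z * cos (2 * pi * dotv z xi + beta)) =
  gaussn xi * cos beta.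
Proof. by have [_] := fourier_gaussn_rint n. Qed.

Lemma integral_gaussn n : integral_Rn (@gaussn n) = 1.
Proof.
have := fourier_gaussn (0 : 'rV[R]_n) 0; rewrite /gaussn dotv0l mulr0 oppr0 expR0 cos0 mulr1.
move=> <-; apply: eq_integral_Rn => z.
by rewrite dotvC dotv0l mulr0 addr0 cos0 mulr1.
Qed.

Lemma measurable_sin_phase n (xi : 'rV[R]_n) :
  measurable_Rn (fun z => sin (2 * pi * dotv z xi)).
Proof.
apply: (measurableT_comp measurable_sin); apply: eq_measurable_fun (measurable_phase xi 0) => t _.
by rewrite addr0.
Qed.

(** * Plancherel's inequality for bounded integrable functions *)

Section bessel.
Variables (n : nat) (f : 'rV[R]_n -> R) (B : R).
Hypotheses (mf : measurable_Rn f) (fB : forall z, `|f z| <= B)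
  (fi : rint (leb R n) (fun t => f (rvec t))).

Definition fcos xi := integral_Rn (fun z => f z * cos (2 * pi * dotv z xi)).
Definition fsin xi := integral_Rn (fun z => f z * sin (2 * pi * dotv z xi)).

Lemma rint_norm : rint (leb R n) (fun t => `|f (rvec t)|).
Proof. exact: integrable_norm fi. Qed.

Let cosphase0 xi (z : 'rV[R]_n) : cos (2 * pi * dotv z xi) = cos (2 * pi * dotv z xi + 0).
Proof. by rewrite addr0. Qed.

Lemma measurable_cos_phase0 (xi : 'rV[R]_n) : measurable_Rn (fun z => cos (2 * pi * dotv z xi)).
Proof. by under eq_fun do rewrite cosphase0; exact: measurable_cos_phase. Qed.

Lemma rint_fcos xi : rint (leb R n) (fun t => f (rvec t) * cos (2 * pi * dotv (rvec t) xi)).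
Proof.
apply: rint_le rint_norm _; first by apply: measurable_funM => //; exact: measurable_cos_phase0.
by move=> t; rewrite normrM ler_piMr// norm_cos_le1.
Qed.

Lemma rint_fsin xi : rint (leb R n) (fun t => f (rvec t) * sin (2 * pi * dotv (rvec t) xi)).
Proof.
apply: rint_le rint_norm _; first by apply: measurable_funM => //; exact: measurable_sin_phase.
by move=> t; rewrite normrM ler_piMr// norm_sin_le1.
Qed.

Lemma fcos_sqrD_fsin_sqr xi : fcos xi ^+ 2 + fsin xi ^+ 2 =
  integral_Rn (fun z => f z * integral_Rn (fun w => f w * cos (2 * pi * dotv (z - w) xi))).
Proof.
have E z : f z * integral_Rn (fun w => f w * cos (2 * pi * dotv (z - w) xi)) =
    fcos xi * (f z * cos (2 * pi * dotv z xi)) + fsin xi * (f z * sin (2 * pi * dotv z xi)).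
  rewrite (@eq_integral_Rn _ _ _ (fun w =>
    cos (2 * pi * dotv z xi) * (f w * cos (2 * pi * dotv w xi)) +
    sin (2 * pi * dotv z xi) * (f w * sin (2 * pi * dotv w xi)))); last first.
    by move=> w; rewrite dotvBl mulrBr cosB; ring.
  rewrite integral_RnD; [|by apply: rintZ; exact: rint_fcos|by apply: rintZ; exact: rint_fsin].
  rewrite integral_RnZ; last exact: rint_fcos.
  rewrite integral_RnZ; last exact: rint_fsin.
  by rewrite /fcos /fsin; ring.
rewrite (eq_integral_Rn E) integral_RnD; last 2 first.
- by apply: rintZ; exact: rint_fcos.
- by apply: rintZ; exact: rint_fsin.
rewrite integral_RnZ; last exact: rint_fcos.
by rewrite integral_RnZ; [|exact: rint_fsin].
Qed.

Lemma measurable_phase2 d (T : measurableType d) (p s : T -> 'rV[R]_n) :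
  (forall i, measurable_fun setT (fun x => p x 0 i)) ->
  (forall i, measurable_fun setT (fun x => s x 0 i)) ->
  measurable_fun setT (fun x => 2 * pi * dotv (p x) (s x)).
Proof. by move=> mp ms; apply: measurable_funM => //; exact: measurable_dotv. Qed.

Lemma measurable_fst_coord m (i : 'I_m) : measurable_fun setT
  (fun p : m.-tuple RM * n.-tuple RM => rvec p.1 0 i).
Proof. exact: (measurableT_comp (measurable_rvec_coord i)). Qed.

Lemma measurable_snd_coord m (i : 'I_m) : measurable_fun setT
  (fun p : n.-tuple RM * m.-tuple RM => rvec p.2 0 i).
Proof. exact: (measurableT_comp (measurable_rvec_coord i)). Qed.

Let mgf (c : R -> R) : measurable_fun setT c -> measurable_fun setT
  (fun p : n.-tuple RM * n.-tuple RM =>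
     gaussn (rvec p.1) * (f (rvec p.2) * c (2 * pi * dotv (rvec p.2) (rvec p.1)))).
Proof.
move=> mc; apply: measurable_funM.
  by apply: (measurable_comp_rvec (@measurable_gaussn n)); exact: measurable_fst_coord.
apply: measurable_funM.
  by apply: (measurable_comp_rvec mf); exact: measurable_snd_coord.
apply: (measurableT_comp mc); apply: measurable_phase2.
  exact: measurable_snd_coord.
exact: measurable_fst_coord.
Qed.

(** Measurability in xi is obtained from Fubini, which needs a majorant integrable in xi as well:
    the transform is multiplied by a Gaussian, and the Gaussian is divided out afterwards. *)
Let measurable_ftrig (c : R -> R) : measurable_fun setT c -> (forall x, `|c x| <= 1) ->
  measurable_Rn (fun xi => integral_Rn (fun z => f z * c (2 * pi * dotv z xi))).
Proof.
move=> mc c1.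
have H x y : `|gaussn (rvec x) * (f (rvec y) * c (2 * pi * dotv (rvec y) (rvec x)))| <=
    gaussn (rvec x) * `|f (rvec y)| :> R.
  by rewrite normrM ger0_norm ?gaussn_ge0// ler_wpM2l ?gaussn_ge0// normrM ler_piMr.
have /rint_measurable := dominated_rint_fst (mgf mc) (rint_gaussn n) rint_norm H.
move=> mg.
have mi : measurable_Rn (fun xi : 'rV[R]_n => (gaussn xi)^-1).
  apply: (eq_measurable_fun (fun t : n.-tuple RM => expR (pi * dotv (rvec t) (rvec t)))).
    by move=> t _; rewrite /gaussn expRN invrK.
  apply: (measurableT_comp (@measurable_expR R)); apply: measurable_funM => //.
  by apply: measurable_dotv => i; exact: measurable_rvec_coord.
apply: eq_measurable_fun (measurable_funM mi mg) => t _ /=.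
rewrite RintegralZl//; first by rewrite mulKf// gt_eqF// gaussn_gt0.
apply: rint_le rint_norm _.
  apply: measurable_funM => //; apply: (measurableT_comp mc).
  by apply: measurable_phase2 => i //; exact: measurable_rvec_coord.
by move=> u; rewrite normrM ler_piMr.
Qed.

Lemma measurable_fcos : measurable_Rn fcos.
Proof. by apply: measurable_ftrig; [exact: measurable_cos|exact: norm_cos_le1]. Qed.

Lemma measurable_fsin : measurable_Rn fsin.
Proof. by apply: measurable_ftrig; [exact: measurable_sin|exact: norm_sin_le1]. Qed.

Let A := integral_Rn (fun z => `|f z|).
Let h z xi := integral_Rn (fun w => f w * cos (2 * pi * dotv (z - w) xi)).

Let hE z xi : h z xi =
  fcos xi * cos (2 * pi * dotv z xi) + fsin xi * sin (2 * pi * dotv z xi).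
Proof.
rewrite /h (@eq_integral_Rn _ _ _ (fun w =>
    cos (2 * pi * dotv z xi) * (f w * cos (2 * pi * dotv w xi)) +
    sin (2 * pi * dotv z xi) * (f w * sin (2 * pi * dotv w xi)))); last first.
  by move=> w; rewrite dotvBl mulrBr cosB; ring.
rewrite integral_RnD; [|by apply: rintZ; exact: rint_fcos|by apply: rintZ; exact: rint_fsin].
rewrite integral_RnZ; last exact: rint_fcos.
rewrite integral_RnZ; last exact: rint_fsin.
by rewrite /fcos /fsin; ring.
Qed.

Let measurable_diff_coord (z : 'rV[R]_n) i :
  measurable_fun setT (fun t : n.-tuple RM => (z - rvec t) 0 i).
Proof.
rewrite (_ : (fun _ => _) = fun t => z 0 i - rvec t 0 i); last first.
  by apply/funext => t; rewrite !mxE.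
by apply: measurable_funB => //; exact: measurable_rvec_coord.
Qed.

Let rint_h z xi :
  rint (leb R n) (fun t => f (rvec t) * cos (2 * pi * dotv (z - rvec t) xi)).
Proof.
apply: rint_le rint_norm _.
  apply: measurable_funM => //; apply: (measurableT_comp measurable_cos).
  exact: measurable_phase2.
by move=> t; rewrite normrM ler_piMr// norm_cos_le1.
Qed.

Let hbound z xi : `|h z xi| <= A.
Proof.
apply: le_trans (le_normr_Rintegral _ (rint_h z xi)) _ => //.
apply: le_Rintegral => //; [exact: integrable_norm (rint_h z xi)|exact: rint_norm|].
by move=> t _ /=; rewrite normrM ler_piMr// norm_cos_le1.
Qed.

Let measurable_gfh : measurable_fun setT (fun p : n.-tuple RM * n.-tuple RM =>
  gaussn (rvec p.1) * (f (rvec p.2) * h (rvec p.2) (rvec p.1))).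
Proof.
have m1 g0 : measurable_Rn g0 ->
    measurable_fun setT (fun p : n.-tuple RM * n.-tuple RM => g0 (rvec p.1)).
  by move=> mg; apply: (measurable_comp_rvec mg); exact: measurable_fst_coord.
have mp : measurable_fun setT (fun p : n.-tuple RM * n.-tuple RM =>
    2 * pi * dotv (rvec p.2) (rvec p.1)).
  by apply: measurable_phase2; [exact: measurable_snd_coord|exact: measurable_fst_coord].
apply: measurable_funM; first exact: m1 (@measurable_gaussn n).
apply: measurable_funM.
  by apply: (measurable_comp_rvec mf); exact: measurable_snd_coord.
under eq_fun do rewrite hE.
apply: measurable_funD; apply: measurable_funM.
- exact: m1 measurable_fcos.
- exact: (measurableT_comp measurable_cos).
- exact: m1 measurable_fsin.
- exact: (measurableT_comp measurable_sin).
Qed.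

(** Exchanging the integrals, the Gaussian average in xi of the phase of z - w is the Gaussian at z
    - w, by self-duality. *)
Let convolve z : integral_Rn (fun xi => gaussn xi * h z xi) =
  integral_Rn (fun v => gaussn v * f (z + v)).
Proof.
transitivity (integral_Rn (fun xi => integral_Rn (fun w =>
    gaussn xi * (f w * cos (2 * pi * dotv (z - w) xi))))).
  by apply: eq_integral_Rn => xi; rewrite integral_RnZ//; exact: rint_h.
rewrite /integral_Rn (@dominated_Rfubini _ _ _ _ _ (leb R n) (leb R n)
  (fun p => gaussn (rvec p.1) * (f (rvec p.2) * cos (2 * pi * dotv (z - rvec p.2) (rvec p.1))))
  (fun t => gaussn (rvec t)) (fun t => `|f (rvec t)|)).
- transitivity (integral_Rn (fun w => f w * gaussn (z - w))).
    apply: eq_Rintegral => w _ /=.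
    rewrite (@eq_Rintegral _ _ _ _ setT (fun x => f (rvec w) * (gaussn (rvec x) *
        cos (2 * pi * dotv (rvec x) (z - rvec w) + 0)))); last first.
      by move=> x _; rewrite addr0 [in LHS]dotvC; ring.
    rewrite RintegralZl//; first by rewrite [X in _ * X]fourier_gaussn cos0 mulr1.
    apply: rint_le (rint_gaussn n) _.
      by apply: measurable_funM; [exact: measurable_gaussn|exact: measurable_cos_phase].
    by move=> t; rewrite normrM ger0_norm ?gaussn_ge0// ler_piMr ?gaussn_ge0// norm_cos_le1.
  rewrite -(integral_Rn_translate z).
    by apply: eq_Rintegral => v _; rewrite (addrC _ z) opprD addrA subrr sub0r gaussnN mulrC.
  apply: measurable_funM => //.
  by apply: (measurable_comp_rvec (@measurable_gaussn n)); exact: measurable_diff_coord.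
- apply: measurable_funM.
    by apply: (measurable_comp_rvec (@measurable_gaussn n)); exact: measurable_fst_coord.
  apply: measurable_funM.
    by apply: (measurable_comp_rvec mf); exact: measurable_snd_coord.
  apply: (measurableT_comp measurable_cos); apply: measurable_phase2.
    by move=> i; exact: (measurableT_comp (measurable_diff_coord z i)).
  exact: measurable_fst_coord.
- exact: rint_gaussn.
- exact: rint_norm.
- move=> x y /=; rewrite normrM ger0_norm ?gaussn_ge0// ler_wpM2l ?gaussn_ge0//.
  by rewrite normrM ler_piMr// norm_cos_le1.
Qed.

Let rint_sqr : rint (leb R n) (fun t => f (rvec t) ^+ 2).
Proof. by apply: rintMbd fi mf _ => t; exact: fB. Qed.

Let rint_f2 v : rint (leb R n) (fun t => f (rvec t) * f (rvec t + v)).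
Proof. by apply: rintMbd (rint_translate v fi) mf _ => t; exact: fB. Qed.

Let autocorr v : integral_Rn (fun z => f z * f (z + v)) <= integral_Rn (fun z => f z ^+ 2).
Proof.
have m2 : measurable_Rn (fun z => f z ^+ 2) by exact: measurable_funX.
have i2 := @rint_translate _ _ (fun z => f z ^+ 2) v rint_sqr.
apply: (@le_trans _ _ (integral_Rn (fun z => 2^-1 * (f z ^+ 2 + f (z + v) ^+ 2)))).
  apply: le_integral_Rn; first exact: rint_f2.
    by apply: rintZ; apply: rintD.
  by move=> z; have := sqr_ge0 (f z - f (z + v)); lra.
rewrite integral_RnZ; last exact: rintD.
rewrite integral_RnD// (@integral_Rn_translate _ _ (fun z => f z ^+ 2))//.
lra.
Qed.

(* Plancherel's inequality, regularised by a Gaussian. *)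
Lemma gaussian_bessel :
  integral_Rn (fun xi => gaussn xi * (fcos xi ^+ 2 + fsin xi ^+ 2)) <=
  integral_Rn (fun z => f z ^+ 2).
Proof.
have ifh xi : rint (leb R n) (fun t => f (rvec t) * h (rvec t) xi).
  have := rintMbd fi _ (fun t => hbound (rvec t) xi).
  under [X in _ -> rint _ X]eq_fun do rewrite mulrC.
  apply; under eq_fun do rewrite hE.
  apply: measurable_funD; apply: measurable_funM => //.
    exact: measurable_cos_phase0.
  exact: measurable_sin_phase.
(* The left side becomes a Gaussian average of the autocorrelations of f. Each of them is at most
   the L^2 norm squared by [autocorr], and the Gaussian has mass 1. *)
have -> : integral_Rn (fun xi => gaussn xi * (fcos xi ^+ 2 + fsin xi ^+ 2)) =
    integral_Rn (fun z => integral_Rn (fun v => gaussn v * (f z * f (z + v)))).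
  transitivity (integral_Rn (fun xi => integral_Rn (fun z => gaussn xi * (f z * h z xi)))).
    by apply: eq_integral_Rn => xi; rewrite integral_RnZ// fcos_sqrD_fsin_sqr.
  rewrite /integral_Rn (@dominated_Rfubini _ _ _ _ _ (leb R n) (leb R n)
    (fun p => gaussn (rvec p.1) * (f (rvec p.2) * h (rvec p.2) (rvec p.1)))
    (fun t => gaussn (rvec t)) (fun t => A * `|f (rvec t)|)).
  - apply: eq_Rintegral => z _ /=.
    transitivity (f (rvec z) * integral_Rn (fun xi => gaussn xi * h (rvec z) xi)).
      rewrite -integral_RnZ; first by apply: eq_Rintegral => xi _; rewrite mulrCA.
      have mh : measurable_Rn (fun xi => h (rvec z) xi).
        under eq_fun do rewrite hE.
        apply: measurable_funD; apply: measurable_funM.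
        + exact: measurable_fcos.
        + apply: (measurableT_comp measurable_cos); apply: measurable_phase2 => // i.
          exact: measurable_rvec_coord.
        + exact: measurable_fsin.
        + apply: (measurableT_comp measurable_sin); apply: measurable_phase2 => // i.
          exact: measurable_rvec_coord.
      have := rintMbd (rint_gaussn n) mh (fun t => hbound (rvec z) (rvec t)).
      by under [X in rint _ X -> _]eq_fun do rewrite mulrC.
    rewrite convolve -integral_RnZ; first by apply: eq_Rintegral => v _; rewrite mulrCA.
    have := rintMbd (rint_gaussn n) (measurable_Rn_translate (rvec z) mf) (fun t => fB _).
    by under [X in rint _ X -> _]eq_fun do rewrite mulrC addrC.
  - exact: measurable_gfh.
  - exact: rint_gaussn.
  - by apply: rintZ; exact: rint_norm.
  - move=> x y /=; rewrite normrM ger0_norm ?gaussn_ge0// ler_wpM2l ?gaussn_ge0//.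
    by rewrite normrM mulrC ler_wpM2r.
have mff (P Q : n.-tuple RM * n.-tuple RM -> 'rV[R]_n) :
    (forall i, measurable_fun setT (fun p => P p 0 i)) ->
    (forall i, measurable_fun setT (fun p => Q p 0 i)) ->
    measurable_fun setT (fun p => gaussn (Q p) * (f (P p) * f (P p + Q p))).
  move=> mP mQ; apply: measurable_funM.
    exact: (measurable_comp_rvec (@measurable_gaussn n)).
  apply: measurable_funM; first exact: (measurable_comp_rvec mf).
  apply: (measurable_comp_rvec mf) => i.
  rewrite (_ : (fun _ => _) = fun p => P p 0 i + Q p 0 i).
    exact: measurable_funD.
  by apply/funext => p; rewrite mxE.
have dom x y : `|gaussn (rvec y) * (f (rvec x) * f (rvec x + rvec y))| <=
    (B * `|f (rvec x)|) * gaussn (rvec y) :> R.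
  rewrite normrM ger0_norm ?gaussn_ge0// mulrC ler_wpM2r ?gaussn_ge0//.
  by rewrite normrM mulrC ler_wpM2r.
rewrite /integral_Rn (@dominated_Rfubini _ _ _ _ _ (leb R n) (leb R n) _ _ _
  (mff _ _ (@measurable_fst_coord n) (@measurable_snd_coord n)) (rintZ B rint_norm) (rint_gaussn n) dom)/=.
set I := \int[leb R n]_t f (rvec t) ^+ 2.
have -> : I = \int[leb R n]_t (I * gaussn (rvec t)).
  by rewrite RintegralZl//; [rewrite [X in _ * X]integral_gaussn mulr1|exact: rint_gaussn].
apply: le_Rintegral => //.
- apply: (@dominated_rint_fst _ _ _ _ _ (leb R n) (leb R n)
    (fun p => gaussn (rvec p.1) * (f (rvec p.2) * f (rvec p.2 + rvec p.1)))
    (fun t => gaussn (rvec t)) (fun t => B * `|f (rvec t)|)).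
  + exact: (mff _ _ (@measurable_snd_coord n) (@measurable_fst_coord n)).
  + exact: rint_gaussn.
  + by apply: rintZ; exact: rint_norm.
  + by move=> x y; rewrite [leRHS]mulrC; exact: dom.
- by apply: rintZ; exact: rint_gaussn.
move=> v _; rewrite RintegralZl//; last exact: rint_f2.
by rewrite mulrC ler_wpM2r ?gaussn_ge0// autocorr.
Qed.

Lemma fcos_le xi : `|fcos xi| <= A.
Proof.
apply: le_trans (le_normr_Rintegral _ (rint_fcos xi)) _ => //.
apply: le_Rintegral => //; [exact: integrable_norm (rint_fcos xi)|exact: rint_norm|].
by move=> t _ /=; rewrite normrM ler_piMr// norm_cos_le1.
Qed.

Lemma fsin_le xi : `|fsin xi| <= A.
Proof.
apply: le_trans (le_normr_Rintegral _ (rint_fsin xi)) _ => //.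
apply: le_Rintegral => //; [exact: integrable_norm (rint_fsin xi)|exact: rint_norm|].
by move=> t _ /=; rewrite normrM ler_piMr// norm_sin_le1.
Qed.

Lemma rint_gaussian_bessel : rint (leb R n)
  (fun t => gaussn (rvec t) * (fcos (rvec t) ^+ 2 + fsin (rvec t) ^+ 2)).
Proof.
have sq x : `|x| <= A -> x ^+ 2 <= A ^+ 2.
  by move=> xA; rewrite -real_normK ?num_real// ler_sqr ?nnegrE ?(le_trans _ xA).
apply: rint_le (rintZ (A ^+ 2 + A ^+ 2) (rint_gaussn n)) _.
  apply: measurable_funM; first exact: measurable_gaussn.
  apply: measurable_funD; apply: measurable_funX.
    exact: measurable_fcos.
  exact: measurable_fsin.
move=> t; rewrite ger0_norm; last by rewrite mulr_ge0 ?gaussn_ge0// addr_ge0 ?sqr_ge0.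
rewrite mulrC ler_wpM2r ?gaussn_ge0// lerD//; apply: sq.
  exact: fcos_le.
exact: fsin_le.
Qed.

End bessel.

End gaussian_n.

(** * Fourier transform of a system of charges *)

Section charges.
Context {R : realType}.
Local Notation RM := (measurableTypeR R).
Variable n : nat.
Local Notation V := (integral_Rn (@chi R n (1/2))).

Let V0 : 0 < V. Proof. by apply: integral_chi_gt0; lra. Qed.

(** The Fourier transform of the indicator of the ball of radius 1/2; it is real because the ball is
    symmetric, see [integral_sin_chi]. *)
Definition chihat (xi : 'rV[R]_n) : R :=
  integral_Rn (fun z => cos (2 * pi * dotv z xi) * chi (1/2) z).

Let rint_trig_chi (f : 'rV[R]_n -> R) : measurable_Rn f -> (forall z, `|f z| <= 1) ->
  rint (leb R n) (fun t => f (rvec t) * chi (1/2) (rvec t)).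
Proof. by move=> mf f1; exact: rintMbd (rint_chi n (1/2)) mf (fun t => f1 (rvec t)). Qed.

Lemma integral_sin_chi (xi : 'rV[R]_n) :
  integral_Rn (fun z => sin (2 * pi * dotv z xi) * chi (1/2) z) = 0.
Proof.
pose f (z : 'rV[R]_n) := sin (2 * pi * dotv z xi) * chi (1/2) z.
have fi : rint (leb R n) (fun t => f (rvec t)).
  apply: (rint_trig_chi (f := fun z => sin (2 * pi * dotv z xi))) => [|z].
    exact: measurable_sin_phase.
  exact: norm_sin_le1.
have uN : (- 1%:M : 'M[R]_n) \in unitmx.
  by rewrite -scaleN1r unitmxZ ?unitmx1// unitrN1.
have := integral_Rn_orthogonal uN _ (rint_measurable fi).
move=> /(_ _)/wrap[]; first by move=> u; rewrite mulmxN mulmx1 enormN.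
rewrite (@eq_integral_Rn _ _ _ (fun z => -1 * f z)); last first.
  by move=> z; rewrite /f mulmxN mulmx1 dotvNl mulrN sinN /chi enormN mulN1r mulNr.
by rewrite integral_RnZ// -/(integral_Rn f); lra.
Qed.

(** The radius 1/pi is chosen so that the phase 2 pi z.xi stays in [-1, 1] for |z| < 1/2. *)
Lemma chihat_ge (xi : 'rV[R]_n) : enorm xi <= pi^-1 -> cos 1 * V <= chihat xi.
Proof.
move=> xipi; rewrite /chihat -integral_RnZ; last exact: rint_chi.
apply: le_integral_Rn.
- by apply: rintZ; exact: rint_chi.
- apply: (rint_trig_chi (f := fun z => cos (2 * pi * dotv z xi))) => [|z].
    exact: measurable_cos_phase0.
  exact: norm_cos_le1.
move=> z; rewrite /chi; case: ltP => z2; last by rewrite !mulr0.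
rewrite !mulr1.
have p0 : 0 < pi :> R := pi_gt0 R.
have z1 : `|2 * pi * dotv z xi| <= 1.
  rewrite normrM gtr0_norm ?mulr_gt0// -[leRHS](@mulfV _ pi) ?gt_eqF// (mulrC 2) -mulrA ler_pM2l//.
  have := ler_dotv_enorm z xi; have := enorm_ge0 z; have := enorm_ge0 xi.
  have : 0 < pi^-1 :> R by rewrite invr_gt0.
  nra.
rewrite -[leRHS]cos_norm; move: z1; rewrite le_eqVlt => /predU1P[->//|z1].
have pi1 : 1 <= pi :> R by have := @pi_ge2 R; lra.
apply/ltW; rewrite ltr_cos// in_itv/= ?normr_ge0 ?ler01//=.
by rewrite (le_trans (ltW z1)).
Qed.

Variables (N : nat) (q : 'I_N -> R) (y : 'I_N -> 'rV[R]_n).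

(** [ccos] and [csin] are the real and imaginary parts of S, and [cpow] is |S|^2. *)
Definition ccos xi := \sum_j q j * cos (2 * pi * dotv (y j) xi).
Definition csin xi := \sum_j q j * sin (2 * pi * dotv (y j) xi).
Definition cpow xi := ccos xi ^+ 2 + csin xi ^+ 2.

Lemma cpow_ge0 xi : 0 <= cpow xi.
Proof. by rewrite addr_ge0 ?sqr_ge0. Qed.

Lemma measurable_ccos : measurable_Rn ccos.
Proof.
apply: measurable_sum => j; apply: measurable_funM => //.
apply: (measurableT_comp measurable_cos); apply: measurable_phase2 => // i.
exact: measurable_rvec_coord.
Qed.

Lemma measurable_csin : measurable_Rn csin.
Proof.
apply: measurable_sum => j; apply: measurable_funM => //.
apply: (measurableT_comp measurable_sin); apply: measurable_phase2 => // i.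
exact: measurable_rvec_coord.
Qed.

Lemma measurable_cpow : measurable_Rn cpow.
Proof.
by apply: measurable_funD; apply: measurable_funX; [exact: measurable_ccos|exact: measurable_csin].
Qed.

Lemma cpow_le xi : cpow xi <= 2 * (\sum_j `|q j|) ^+ 2.
Proof.
have sq x : `|x| <= \sum_j `|q j| -> x ^+ 2 <= (\sum_j `|q j|) ^+ 2.
  by move=> xA; rewrite -real_normK ?num_real// ler_sqr ?nnegrE ?(le_trans _ xA).
rewrite mulr_natl mulr2n lerD//; apply: sq; apply: le_trans (ler_norm_sum _ _ _) _;
  apply: ler_sum => j _; rewrite normrM ler_piMr//.
  exact: norm_cos_le1.
exact: norm_sin_le1.
Qed.

Let F := smear q y.

(** The smeared charge is the convolution of point charges with a ball. As [chihat] is real, it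
    multiplies the cosine and sine parts separately. *)
Lemma fcos_smear xi : fcos F xi = chihat xi * ccos xi.
Proof.
rewrite /fcos (@eq_integral_Rn _ _ _ (fun z => cos (2 * pi * dotv z xi) * F z)); last first.
  by move=> z; rewrite mulrC.
rewrite (@integral_smearM _ _ _ _ _ (fun z => cos (2 * pi * dotv z xi)) 1); last 2 first.
- exact: measurable_cos_phase0.
- by move=> z; exact: norm_cos_le1.
rewrite mulr_sumr; apply: eq_bigr => j _; rewrite mulrCA; congr (_ * _).
rewrite (@eq_integral_Rn _ _ _ (fun z =>
  cos (2 * pi * dotv (y j) xi) * (cos (2 * pi * dotv z xi) * chi (1/2) z) -
  sin (2 * pi * dotv (y j) xi) * (sin (2 * pi * dotv z xi) * chi (1/2) z))); last first.
  by move=> z; rewrite dotvDl mulrDr cosD; ring.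
have ic : rint (leb R n) (fun t => cos (2 * pi * dotv (rvec t) xi) * chi (1 / 2) (rvec t)).
  apply: (rint_trig_chi (f := fun z => cos (2 * pi * dotv z xi))) => [|z].
    exact: measurable_cos_phase0.
  exact: norm_cos_le1.
have isn : rint (leb R n) (fun t => sin (2 * pi * dotv (rvec t) xi) * chi (1 / 2) (rvec t)).
  apply: (rint_trig_chi (f := fun z => sin (2 * pi * dotv z xi))) => [|z].
    exact: measurable_sin_phase.
  exact: norm_sin_le1.
rewrite integral_RnB; [|exact: rintZ|exact: rintZ].
by rewrite !integral_RnZ// integral_sin_chi mulr0 subr0 mulrC.
Qed.

Lemma fsin_smear xi : fsin F xi = chihat xi * csin xi.
Proof.
rewrite /fsin (@eq_integral_Rn _ _ _ (fun z => sin (2 * pi * dotv z xi) * F z)); last first.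
  by move=> z; rewrite mulrC.
rewrite (@integral_smearM _ _ _ _ _ (fun z => sin (2 * pi * dotv z xi)) 1); last 2 first.
- exact: measurable_sin_phase.
- by move=> z; exact: norm_sin_le1.
rewrite mulr_sumr; apply: eq_bigr => j _; rewrite mulrCA; congr (_ * _).
rewrite (@eq_integral_Rn _ _ _ (fun z =>
  sin (2 * pi * dotv (y j) xi) * (cos (2 * pi * dotv z xi) * chi (1/2) z) +
  cos (2 * pi * dotv (y j) xi) * (sin (2 * pi * dotv z xi) * chi (1/2) z))); last first.
  by move=> z; rewrite dotvDl mulrDr sinD; ring.
have ic : rint (leb R n) (fun t => cos (2 * pi * dotv (rvec t) xi) * chi (1 / 2) (rvec t)).
  apply: (rint_trig_chi (f := fun z => cos (2 * pi * dotv z xi))) => [|z].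
    exact: measurable_cos_phase0.
  exact: norm_cos_le1.
have isn : rint (leb R n) (fun t => sin (2 * pi * dotv (rvec t) xi) * chi (1 / 2) (rvec t)).
  apply: (rint_trig_chi (f := fun z => sin (2 * pi * dotv z xi))) => [|z].
    exact: measurable_sin_phase.
  exact: norm_sin_le1.
rewrite integral_RnD; [|exact: rintZ|exact: rintZ].
by rewrite !integral_RnZ// integral_sin_chi mulr0 addr0 mulrC.
Qed.

(** The form D for points that are already rescaled. Taken as a normalised L^2 norm it is visibly
    nonnegative; [kformE] gives the double sum over kappa. *)
Definition kform := V^-1 * integral_Rn (fun z => F z ^+ 2).

Lemma kform_ge0 : 0 <= kform.
Proof.
apply: mulr_ge0; first by rewrite invr_ge0 ltW.
by apply: integral_Rn_ge0 => z; exact: sqr_ge0.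
Qed.

Lemma chihat_sqr_ge xi : enorm xi <= pi^-1 -> (cos 1 * V) ^+ 2 <= chihat xi ^+ 2.
Proof.
move=> /chihat_ge H; have := cos1_gt0 R => c1.
by rewrite ler_sqr ?nnegrE// ?(le_trans _ H)// ltW// mulr_gt0.
Qed.

(* As cos (2 pi z.xi) >= cos 1 on the ball of radius 1/2, the Fourier transform of
  the charges is that of the smeared ones, up to a factor bounded below. *)
Lemma cpow_le_kform xi : enorm xi <= pi^-1 -> (forall j, enorm (y j) <= 1) ->
  cpow xi <= 2 * 3 ^+ n / cos 1 ^+ 2 * kform.
Proof.
move=> xipi y1.
(* Points in the unit ball are smeared into the ball of radius 3/2, of volume 3^n V; the factor 2 of
   the statement adds the cosine and the sine part. *)
have H f : measurable_Rn f -> (forall z, `|f z| <= 1) ->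
    (integral_Rn (fun z => F z * f z)) ^+ 2 <= 3 ^+ n * V ^+ 2 * kform.
  move=> mf f1; have := @integral_smearM_sqr_le _ _ _ q y f 1 mf f1 y1.
  have -> : 1/2 + 1 = 3 * (1/2) :> R by lra.
  rewrite integral_chi_scale//.
  rewrite (@eq_integral_Rn _ _ (fun z => f z * _) (fun z => F z * f z)); last first.
    by move=> z; rewrite mulrC.
  move=> /le_trans; apply; rewrite le_eqVlt; apply/orP; left; apply/eqP.
  rewrite /kform -/F; field; exact: lt0r_neq0.
have /= Hc := H _ (measurable_cos_phase0 xi) (fun z => norm_cos_le1 _).
have /= Hs := H _ (measurable_sin_phase xi) (fun z => norm_sin_le1 _).
have c1 := cos1_gt0 R.
have V2 : 0 < cos 1 ^+ 2 * V ^+ 2 by rewrite mulr_gt0 ?exprn_gt0.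
rewrite -(ler_pM2l V2).
apply: (@le_trans _ _ (chihat xi ^+ 2 * cpow xi)).
  by rewrite ler_wpM2r ?cpow_ge0// -exprMn; exact: chihat_sqr_ge.
rewrite /cpow mulrDr -!exprMn -fcos_smear -fsin_smear.
apply: le_trans (lerD Hc Hs) _.
rewrite le_eqVlt; apply/orP; left; apply/eqP; field; exact: lt0r_neq0.
Qed.

(** The regularised Plancherel inequality for the smeared charge, restricted to |xi| < 1/pi: there
    the Gaussian is at least exp (- 1/pi) and [chihat] at least V cos 1. The position of the points
    is unrestricted. *)
Lemma integral_cpow_le : integral_Rn (fun xi => chi pi^-1 xi * cpow xi) <=
  expR pi^-1 / (cos 1 ^+ 2 * V) * kform.
Proof.
have c1 := cos1_gt0 R; have p0 := pi_gt0 R.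
pose K : R := expR pi^-1 / (cos 1 * V) ^+ 2.
have K0 : 0 < K by rewrite divr_gt0 ?expR_gt0// exprn_gt0// mulr_gt0.
have mF : measurable_Rn F := measurable_smear q y.
have fi : rint (leb R n) (fun t => F (rvec t)) := rint_smear q y.
have FB := smear_le q y.
have := gaussian_bessel mF FB fi.
rewrite -(ler_pM2l K0) => H; apply: (@le_trans _ _ (K * integral_Rn (fun z => F z ^+ 2))); last first.
  rewrite le_eqVlt; apply/orP; left; apply/eqP; rewrite /K /kform; field.
  by rewrite !gt_eqF.
apply: le_trans H; rewrite -integral_RnZ; last exact: rint_gaussian_bessel.
apply: le_integral_Rn.
- have cb t : `|cpow (rvec t)| <= 2 * (\sum_j `|q j|) ^+ 2.
    by rewrite ger0_norm ?cpow_ge0// cpow_le.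
  have := rintMbd (rint_chi n pi^-1) measurable_cpow cb.
  by under eq_fun do rewrite mulrC.
- by apply: rintZ; exact: rint_gaussian_bessel.
move=> xi; rewrite /chi; case: ltP => xipi; last first.
  rewrite /= mul0r; apply: mulr_ge0; first exact: ltW.
  by apply: mulr_ge0; [exact: gaussn_ge0|rewrite addr_ge0 ?sqr_ge0].
rewrite /= mul1r fcos_smear fsin_smear !exprMn -mulrDr -/(cpow xi).
rewrite (mulrA (gaussn xi)) (mulrA K) ler_peMl ?cpow_ge0//.
have := chihat_sqr_ge (ltW xipi) => ch.
have g1 : expR (- pi^-1) <= gaussn xi.
  rewrite /gaussn ler_expR lerN2 -sqr_enorm.
  rewrite -ler_pdivlMl// -invfM -expr2 -exprVn ler_sqr ?nnegrE ?enorm_ge0 ?invr_ge0 ?(ltW p0)//.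
  exact: ltW.
apply: (@le_trans _ _ (K * expR (- pi^-1) * (cos 1 * V) ^+ 2)).
  rewrite /K expRN le_eqVlt; apply/orP; left; apply/eqP; field.
  by rewrite !gt_eqF ?expR_gt0.
by rewrite -mulrA ler_pM2l// ler_pM ?expR_ge0 ?sqr_ge0.
Qed.

End charges.

(** * The logarithm as a superposition of ball kernels *)

Section log_scale.
Context {R : realType}.
Local Notation RM := (measurableTypeR R).
Local Notation mu := (@lebesgue_measure R).

Lemma integral_itv (a b : R) : a <= b ->
  (\int[mu]_x ((a <= x < b)%R%:R)%:E = (b - a)%:E)%E.
Proof.
move=> ab.
transitivity (\int[mu]_x (\1_(`[a, b[%classic) x)%:E)%E.
  apply: eq_integral => x _; rewrite indicE; congr ((_%:R)%:E).
  by rewrite mem_setE in_itv.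
rewrite integral_indic// setIT [LHS]lebesgue_measure_itv/= lte_fin.
by move: ab; rewrite le_eqVlt => /predU1P[->|->]; rewrite ?ltxx ?subrr// -EFinB.
Qed.

Lemma rint_itv (a b : R) : a <= b -> rint mu (fun x => (a <= x < b)%R%:R).
Proof.
move=> ab; apply: rintP.
  apply: measurable_natr_bool.
  by apply: measurable_and; [exact: measurable_fun_ler|exact: measurable_fun_ltr].
under eq_integral do rewrite normr_nat.
by rewrite integral_itv// ltry.
Qed.

Lemma Rintegral_itv (a b : R) : a <= b -> \int[mu]_x (a <= x < b)%R%:R = b - a :> R.
Proof. by move=> ab; rewrite /Rintegral integral_itv. Qed.

(** Turns the volume factor (1 + 2 rho)^n of [charge_sqr_le] into a loss linear in rho. *)
Lemma bernoulli_le (n : nat) (t : R) : 0 <= t -> (1 + t) ^+ n * (1 - n%:R * t) <= 1.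
Proof.
move=> t0; elim: n => [|n IH]; first by rewrite expr0 mul0r subr0 mulr1.
apply: le_trans IH; rewrite exprSr -mulrA ler_wpM2l//.
  by rewrite exprn_ge0// addr_ge0.
rewrite -natr1; have : 0 <= n%:R * (t * t) + t * t :> R by rewrite addr_ge0// ?mulr_ge0.
lra.
Qed.

End log_scale.

(** The kernel kappa, locked so that the integrals in it are not unfolded by conversion. *)
HB.lock Definition kap (R : realType) n (x : 'rV[R]_n) : R :=
  (integral_Rn (@chi R n (1 / 2)))^-1 * corr x.

(** * The kernel kappa and its quadratic form *)

Section kappa.
Context {R : realType}.
Local Notation RM := (measurableTypeR R).
Local Notation mu := (@lebesgue_measure R).
Variable n : nat.
Local Notation V := (integral_Rn (@chi R n (1/2))).

Let V0 : 0 < V. Proof. by apply: integral_chi_gt0; lra. Qed.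

Local Notation kap := (@kap R n).

Lemma kap_ge0 x : 0 <= kap x.
Proof. by rewrite kap.unlock mulr_ge0 ?corr_ge0// invr_ge0 ltW. Qed.

Lemma kap_le1 x : kap x <= 1.
Proof. by rewrite kap.unlock -ler_pdivlMl ?invr_gt0// invrK mulr1 corr_le. Qed.

Lemma kap0 : kap 0 = 1.
Proof. by rewrite kap.unlock corr0 mulVf// gt_eqF. Qed.

Lemma kap_far x : 1 <= enorm x -> kap x = 0.
Proof. by move=> x1; rewrite kap.unlock corr_far// mulr0. Qed.

Lemma kap_radial x y : enorm x = enorm y -> kap x = kap y.
Proof. by move=> xy; rewrite kap.unlock (corr_radial xy). Qed.

Lemma kapN x : kap (- x) = kap x.
Proof. by rewrite kap.unlock (corr_radial (y := x))// enormN. Qed.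

Lemma kformE N (q : 'I_N -> R) (y : 'I_N -> 'rV[R]_n) :
  kform q y = \sum_j \sum_k q j * q k * kap (y j - y k).
Proof.
rewrite /kform integral_smear_sqr mulr_sumr; apply: eq_bigr => j _.
by rewrite mulr_sumr; apply: eq_bigr => k _; rewrite kap.unlock mulrCA.
Qed.

(** At scales where all points are close together, D almost dominates the square of the total
    charge; this handles systems that are not neutral. *)
Lemma kform_sqr_ge N (q : 'I_N -> R) (y : 'I_N -> 'rV[R]_n) (rho : R) : 0 <= rho ->
  (forall j, enorm (y j) <= rho) ->
  (1 - 2 * n%:R * rho) * (\sum_j q j) ^+ 2 <= kform q y.
Proof.
move=> rho0 yrho; have := charge_sqr_le q V0 rho0 yrho; rewrite -/(kform q y) => H.
have r2 : 0 <= 2 * rho by rewrite mulr_ge0.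
have := bernoulli_le n r2; rewrite (_ : n%:R * (2 * rho) = 2 * n%:R * rho); last by ring.
have [c0 _|c0] := leP (1 - 2 * n%:R * rho) 0.
  by apply: le_trans (kform_ge0 q y); rewrite mulr_le0_ge0// sqr_ge0.
move=> B; apply: le_trans (_ : (1 - 2 * n%:R * rho) * ((1 + 2 * rho) ^+ n * kform q y) <= _).
  by rewrite ler_pM2l.
by rewrite mulrCA mulrA ler_piMl ?kform_ge0// .
Qed.

Let two_point_aux (a e k : R) :
  (1 - 2 * a * (1 / 2 * e)) * (1 + 1) ^+ 2 <= 1 + k + (k + 1) -> 1 - 2 * a * e <= k.
Proof.
by rewrite (_ : _ * _ = 4 * (1 - a * e)); [lra|rewrite expr2; field].
Qed.

(** Positive definiteness gives the modulus of continuity at 0: two unit charges at x / 2 and - x /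
    2 have form 2 + 2 kappa(x), which [kform_sqr_ge] bounds below by 4 (1 - n |x|). *)
Lemma kap_ge x : 1 - 2 * n%:R * enorm x <= kap x.
Proof.
pose y (j : 'I_2) : 'rV[R]_n := if j == ord0 then (1/2) *: x else - ((1/2) *: x).
have := @kform_sqr_ge 2 (fun=> 1) y (1/2 * enorm x).
have yx j : enorm (y j) <= 1/2 * enorm x.
  by rewrite /y; case: ifP => _; rewrite ?enormN enormZ ger0_norm.
move=> /(_ _ yx)/wrap[]; first by rewrite mulr_ge0 ?enorm_ge0.
have y0 : y ord0 = (1/2) *: x by [].
have y1 : y (lift ord0 ord0) = - ((1/2) *: x) by [].
clearbody y; have yy : (1/2) *: x + (1/2) *: x = x.
  by rewrite -scalerDl (_ : 1/2 + 1/2 = 1 :> R) ?scale1r//; lra.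
have S2 (F : 'I_2 -> R) : \sum_j F j = F ord0 + F (lift ord0 ord0).
  by rewrite !big_ord_recl big_ord0 addr0.
have k01 : kap (y ord0 - y (lift ord0 ord0)) = kap x by rewrite y0 y1 opprK yy.
have k10 : kap (y (lift ord0 ord0) - y ord0) = kap x by rewrite -kapN opprB k01.
have k00 j : kap (y j - y j) = 1 by rewrite subrr kap0.
have S22 (F : 'I_2 -> 'I_2 -> R) : \sum_j \sum_k F j k =
    F ord0 ord0 + F ord0 (lift ord0 ord0) + (F (lift ord0 ord0) ord0 + F (lift ord0 ord0) (lift ord0 ord0)).
  by rewrite S2; congr (_ + _); exact: S2.
have -> : kform (fun=> 1) y = 1 + kap x + (kap x + 1).
  apply: etrans (kformE _ _) _.
  apply: etrans (S22 (fun j k => 1 * 1 * kap (y j - y k))) _.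
  by rewrite !k00 k01 k10 mulr1 !mul1r.
by rewrite S2; exact: two_point_aux.
Qed.

(** As for the Fourier transforms above, a Gaussian in tau makes Fubini applicable and is divided
    out at the end. *)
Lemma measurable_kap_ray (x : 'rV[R]_n) :
  measurable_fun setT (fun tau : RM => kap (expR tau *: x)).
Proof.
pose G (t : R) : R := expR (- (pi * t ^+ 2)).
pose F (p : RM * n.-tuple RM) : R := G p.1 * (chi (1/2) (rvec p.2) *
  chi (1/2) (rvec p.2 - expR p.1 *: x)).
have mF : measurable_fun setT F.
  apply: measurable_funM.
    apply: (measurableT_comp (@measurable_expR R)); apply: measurableT_comp => //.
    by apply: measurable_funM => //; exact: measurable_funX.
  apply: measurable_funM.
    apply: (measurable_comp_rvec (@measurable_chi R n (1/2))) => i.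
    by apply: (measurableT_comp (measurable_rvec_coord i) measurable_snd).
  apply: (measurable_comp_rvec (@measurable_chi R n (1/2))) => i.
  apply: (eq_measurable_fun (fun p : RM * n.-tuple RM => rvec p.2 0 i - expR p.1 * x 0 i)).
    by move=> p _; rewrite !mxE.
  apply: measurable_funB; first exact: (measurableT_comp (measurable_rvec_coord i) measurable_snd).
  by apply: measurable_funM => //; apply: (measurableT_comp (@measurable_expR R)).
have FB t z : `|F (t, z)| <= G t * chi (1/2) (rvec z).
  rewrite /F /= normrM ger0_norm ?expR_ge0// ler_wpM2l ?expR_ge0// normrM.
  by rewrite [`|chi _ (rvec z)|]ger0_norm ?chi_ge0// ler_piMr ?chi_ge0// chi_norm.
have /rint_measurable mg := dominated_rint_fst mF rint_gauss1 (rint_chi n (1/2)) FB.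
apply: (eq_measurable_fun (fun t : RM => expR (pi * t ^+ 2) * V^-1 * \int[leb R n]_z F (t, z))).
  move=> t _; rewrite /F /= RintegralZl//; last first.
    have := rint_chi2 0 (expR t *: x : 'rV[R]_n).
    by under eq_fun do rewrite subr0.
  rewrite mulrACA /G -expRD subrr expR0 [LHS]mul1r kap.unlock.
  by [].

apply: measurable_funM => //; apply: measurable_funM => //.
apply: (measurableT_comp (@measurable_expR R)).
by apply: measurable_funM => //; exact: measurable_funX.
Qed.

End kappa.

(** * Integration over scales *)

Section log_integral.
Context {R : realType}.
Local Notation RM := (measurableTypeR R).
Local Notation mu := (@lebesgue_measure R).
Variable n : nat.
Implicit Types x : 'rV[R]_n.

(* The indicator makes the superposition converge at small scales; the constant
  it costs does not depend on x, by translation in tau and radiality of kap. *)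
Definition phik x (tau : R) : R := kap (expR tau *: x) - (tau < 0)%R%:R.

Lemma measurable_phik x : measurable_fun setT (phik x : RM -> R).
Proof.
apply: measurable_funB; first exact: measurable_kap_ray.
by apply: measurable_natr_bool; exact: measurable_fun_ltr.
Qed.

Let expR_neg_le (x : R) : expR x * (x < 0)%R%:R <= exponential_pdf 1 (- x).
Proof.
case: ltP => x0 /=; last by rewrite mulr0 exponential_pdf_ge0.
rewrite mulr1 exponential_pdfE ?oppr_ge0; last exact: ltW.
by rewrite /= mul1r mulN1r opprK.
Qed.

Lemma rint_expR_neg : rint mu (fun tau => expR tau * (tau < 0)%R%:R).
Proof.
have h : rint mu (exponential_pdf (1 : R)) by apply: integrable_exponential_pdf.
have := rint_affine 0 (_ : -1 != 0) h => /(_ _)/wrap[]; first by rewrite oppr_eq0 oner_eq0.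
move=> H; apply: rint_leR H _.
  apply: measurable_funM; first exact: measurable_expR.
  by apply: measurable_natr_bool; exact: measurable_fun_ltr.
move=> x; rewrite ger0_norm; last by rewrite mulr_ge0 ?expR_ge0.
by rewrite addr0 mulN1r expR_neg_le.
Qed.

Lemma Rintegral_expR_neg : \int[mu]_tau (expR tau * (tau < 0)%R%:R) <= 1 :> R.
Proof.
have h : rint mu (exponential_pdf (1 : R)) by apply: integrable_exponential_pdf.
have n1 : -1 != 0 :> R by rewrite oppr_eq0 oner_eq0.
have E : \int[mu]_x exponential_pdf (1 : R) (-1 * x + 0) = 1.
  by rewrite (Rintegral_affine _ n1 h) normrN1 invr1 mul1r /Rintegral integral_exponential_pdf.
rewrite -[leRHS]E; apply: le_Rintegral => //; [exact: rint_expR_neg|exact: (rint_affine 0 n1 h)|].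
by move=> x _; rewrite addr0 mulN1r expR_neg_le.
Qed.

(** For a unit vector the function vanishes when tau >= 0, and [kap_ge] bounds it by 2 n e^tau when
    tau < 0. *)
Lemma rint_phik x : enorm x = 1 -> rint mu (phik x).
Proof.
move=> x1; apply: (@rint_leR R _ (fun tau => 2 * n%:R * (expR tau * (tau < 0)%R%:R))).
- exact: measurable_phik.
- by apply: rintZ; exact: rint_expR_neg.
move=> tau; rewrite /phik; case: ltP => tau0 /=.
  rewrite mulr1 ler0_norm; last by rewrite subr_le0 kap_le1.
  have := kap_ge (expR tau *: x).
  by rewrite enormZ x1 mulr1 ger0_norm ?expR_ge0//; lra.
rewrite kap_far ?subr0 ?normr0 ?mulr0//.
by rewrite enormZ x1 mulr1 ger0_norm ?expR_ge0// -expR0 ler_expR.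
Qed.

Lemma Rintegral_phik_le0 x : enorm x = 1 -> \int[mu]_tau phik x tau <= 0.
Proof.
move=> x1; rewrite -oppr_ge0 -mulN1r -RintegralZl//; last exact: rint_phik.
apply: Rintegral_ge0 => tau _; rewrite mulN1r /phik opprB subr_ge0.
case: ltP => t0; first exact: kap_le1.
by rewrite kap_far// enormZ x1 mulr1 ger0_norm ?expR_ge0// -expR0 ler_expR.
Qed.

(** Rescaling x translates tau, but the indicator does not follow: the discrepancy is an interval of
    length - a, and this is where the logarithm comes from. *)
Lemma phik_scale x (a : R) (tau : R) : a <= 0 ->
  phik (expR a *: x) tau = phik x (1 * tau + a) + (0 <= tau < - a)%R%:R.
Proof.
move=> a0; rewrite /phik scalerA -expRD mul1r.
have -> : (tau + a < 0) = (tau < - a) by apply/idP/idP; lra.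
have [t0|t0] := ltP tau 0 => /=; first by rewrite (_ : (tau < - a) = true)/=; lra.
by rewrite subr0 subrK.
Qed.

Lemma rint_phik_scale x (a : R) : enorm x = 1 -> a <= 0 -> rint mu (phik (expR a *: x)).
Proof.
move=> x1 a0; apply: eq_integrable (rintD (rint_affine a (oner_neq0 R) (rint_phik x1)) (rint_itv (_ : 0 <= - a))) => //.
- by move=> tau _ /=; rewrite phik_scale.
- by rewrite oppr_ge0.
Qed.

Lemma Rintegral_phik_scale x (a : R) : enorm x = 1 -> a <= 0 ->
  \int[mu]_tau phik (expR a *: x) tau = \int[mu]_tau phik x tau - a.
Proof.
move=> x1 a0; have a0' : 0 <= - a by rewrite oppr_ge0.
transitivity (\int[mu]_tau (phik x (1 * tau + a) + (0 <= tau < - a)%R%:R)).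
  by apply: eq_Rintegral => tau _; rewrite phik_scale.
rewrite RintegralD//; [|exact: (rint_affine a (oner_neq0 R) (rint_phik x1))|exact: rint_itv].
by rewrite Rintegral_itv// (Rintegral_affine a (oner_neq0 R) (rint_phik x1)) normr1 invr1 mul1r subr0.
Qed.

End log_integral.

(** * Lower bound for the logarithmic energy *)

Section log_energy.
Context {R : realType}.
Local Notation RM := (measurableTypeR R).
Local Notation mu := (@lebesgue_measure R).
Variables (n : nat) (e : 'rV[R]_n).
Hypothesis e1 : enorm e = 1.

(** The constant c in log (1/|x|) = \int [phik x] + c, read off at the unit vector e. *)
Definition logc : R := - \int[mu]_tau phik e tau.

Lemma logc_ge0 : 0 <= logc.
Proof. by rewrite oppr_ge0 Rintegral_phik_le0. Qed.

Lemma phik_radial (x : 'rV[R]_n) : 0 < enorm x -> phik x =1 phik (expR (ln (enorm x)) *: e).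
Proof.
move=> x0 tau; rewrite /phik; congr (_ - _); apply: kap_radial.
by rewrite !enormZ e1 mulr1 lnK// [`|enorm x|]ger0_norm ?enorm_ge0.
Qed.

Lemma rint_phik_ball (x : 'rV[R]_n) : 0 < enorm x <= 1 -> rint mu (phik x).
Proof.
move=> /andP[x0 x1].
have a0 : ln (enorm x) <= 0 by rewrite ln_le0.
have := rint_phik_scale e1 a0.
by rewrite (_ : phik _ = phik x)//; apply/esym/funext; exact: phik_radial.
Qed.

Lemma Rintegral_phik_ball (x : 'rV[R]_n) : 0 < enorm x <= 1 ->
  \int[mu]_tau phik x tau = - logc - ln (enorm x).
Proof.
move=> /andP[x0 x1].
have a0 : ln (enorm x) <= 0 by rewrite ln_le0.
rewrite /logc opprK -(Rintegral_phik_scale e1 a0).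
by apply: eq_Rintegral => tau _; exact: phik_radial.
Qed.

(** A charge out of the range of kappa from all others contributes exactly 1. Deleting all such
    charges leaves the form of the remaining ones, which is nonnegative. *)
Lemma kform_ge_isolated N (q : 'I_N -> R) (y : 'I_N -> 'rV[R]_n) (J : pred 'I_N) :
  (forall j, q j ^+ 2 = 1) ->
  (forall j k, ~~ J j -> k != j -> kap (y j - y k) = 0) ->
  \sum_j (~~ J j)%:R <= kform q y.
Proof.
move=> q1 JK; pose q' j := q j * (J j)%:R.
rewrite -subr_ge0 (_ : _ - _ = kform q' y) ?kform_ge0//.
rewrite !kformE -sumrB; apply: eq_bigr => j _.
have [Jj|Jj] := boolP (J j).
  rewrite subr0; apply: eq_bigr => k _; rewrite /q' Jj mulr1.
  have [|Jk] := boolP (J k); first by rewrite mulr1.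
  rewrite -kapN opprB JK ?mulr0//.
  by apply: contraNneq Jk => <-.
rewrite /q' (negbTE Jj) mulr0 [RHS]big1; last by move=> k _; rewrite !mul0r.
rewrite (bigD1 j)//= subrr kap0 mulr1 -expr2 q1 big1 ?addr0 ?subrr// => k kj.
by rewrite JK ?mulr0.
Qed.

Section points.
Variables (N : nat) (q : 'I_N -> R) (x : 'I_N -> 'rV[R]_n) (r : 'I_N -> R).
Hypothesis q1 : forall j, q j ^+ 2 = 1.
Hypothesis r0 : forall j, 0 < r j <= 1.
Hypothesis rx : forall j k, k != j -> 2 * r j <= enorm (x j - x k).
Variable eps : R.
Hypothesis xeps : forall j, enorm (x j) <= eps.
Hypothesis eps0 : 0 <= eps.
Hypothesis eps_half : eps <= 1 / 2.
(** Ensures 1 - 2 n eps e^tau >= 1/2 for tau <= 1, so that D is at least half of the squared total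
    charge there. *)
Hypothesis eps_dim : 4 * n%:R * (eps * expR 1) <= 1.

(** The function D(tau) of the overview. *)
Definition kscale (tau : R) : R := kform q (fun j => expR tau *: x j).

Let Q2 := (\sum_j q j) ^+ 2.

Let x01 j k : k != j -> 0 < enorm (x j - x k) <= 1.
Proof.
move=> kj; have /andP[rj _] := r0 j; rewrite (lt_le_trans _ (rx kj)) ?mulr_gt0//=.
apply: le_trans (ler_enormB _ 0 _) _; rewrite subr0 sub0r enormN.
by rewrite (le_trans (lerD (xeps j) (xeps k)))//; move: eps_half; lra.
Qed.

Lemma kscaleE tau : kscale tau = \sum_j \sum_k q j * q k * kap (expR tau *: (x j - x k)).
Proof.
rewrite /kscale kformE; apply: eq_bigr => j _; apply: eq_bigr => k _.
by rewrite scalerBr.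
Qed.

Lemma measurable_kscale : measurable_fun setT (kscale : RM -> R).
Proof.
apply: (eq_measurable_fun (fun tau : RM => \sum_j \sum_k q j * q k * kap (expR tau *: (x j - x k)))).
  by move=> tau _; rewrite kscaleE.
apply: measurable_sum => j; apply: measurable_sum => k; apply: measurable_funM => //.
exact: measurable_kap_ray.
Qed.

Lemma kscale_ge0 tau : 0 <= kscale tau.
Proof. exact: kform_ge0. Qed.

Lemma kscale_le tau : kscale tau <= N%:R * N%:R.
Proof.
have qn j : `|q j| = 1.
  by apply/eqP; rewrite -(eqrXn2 (n := 2))// real_normK ?num_real// q1 expr1n.
rewrite kscaleE; apply: (@le_trans _ _ (\sum_(j < N) \sum_(k < N) 1)).
  apply: ler_sum => j _; apply: ler_sum => k _.
  apply: le_trans (ler_norm _) _; rewrite !normrM !qn mulr1 mul1r.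
  by rewrite ger0_norm; [exact: kap_le1|exact: kap_ge0].
by rewrite !sumr_const !card_ord mulr_natr.
Qed.

Lemma rint_kscaleM (rho : R -> R) : rint mu rho -> rint mu (fun tau => kscale tau * rho tau).
Proof.
move=> hr; apply: (rintMbd hr (a := N%:R * N%:R)); first exact: measurable_kscale.
by move=> tau; rewrite ger0_norm ?kscale_ge0// kscale_le.
Qed.

(** The integrand over scales of the off-diagonal energy; [IE] expresses it through D, N and the
    total charge by restoring the diagonal. *)
Let I (tau : R) : R := \sum_j \sum_(k | k != j) q j * q k * phik (x j - x k) tau.

Let rint_I : rint mu I.
Proof.
apply: rint_sum => j _; apply: rint_sum => k kj; apply: rintZ.
by apply: rint_phik_ball; exact: x01.
Qed.

Let offdiag : \sum_j \sum_(k | k != j) q j * q k = Q2 - N%:R.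
Proof.
rewrite /Q2 expr2 mulr_suml.
rewrite (_ : N%:R = \sum_(j < N) q j * q j :> R); last first.
  rewrite (eq_bigr (fun=> 1)) ?sumr_const ?card_ord// => j _.
  by rewrite -expr2 q1.
rewrite -sumrB; apply: eq_bigr => j _.
by rewrite mulr_sumr [in RHS](bigD1 j)//= addrAC subrr add0r.
Qed.

Let Rintegral_I : \int[mu]_tau I tau =
  \sum_j \sum_(k | k != j) q j * q k * - ln (enorm (x j - x k)) - logc * (Q2 - N%:R).
Proof.
rewrite Rintegral_sum; last first.
  move=> j _; apply: rint_sum => k kj; apply: rintZ.
  by apply: rint_phik_ball; exact: x01.
rewrite -offdiag mulr_sumr -sumrB; apply: eq_bigr => j _.
rewrite Rintegral_sum; last first.
  by move=> k kj; apply: rintZ; apply: rint_phik_ball; exact: x01.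
rewrite mulr_sumr -sumrB; apply: eq_bigr => k kj.
rewrite RintegralZl//; last by apply: rint_phik_ball; exact: x01.
rewrite Rintegral_phik_ball; last exact: x01.
ring.
Qed.

Let IE tau : I tau = kscale tau - N%:R - (tau < 0)%R%:R * (Q2 - N%:R).
Proof.
rewrite -offdiag mulr_sumr.
rewrite (_ : N%:R = \sum_(j < N) q j * q j * kap (expR tau *: (x j - x j)) :> R); last first.
  rewrite (eq_bigr (fun=> 1)) ?sumr_const ?card_ord// => j _.
  by rewrite subrr scaler0 kap0 mulr1 -expr2 q1.
rewrite kscaleE -!sumrB; apply: eq_bigr => j _.
rewrite [in RHS](bigD1 j)//= [X in X - _ - _]addrC addrK mulr_sumr -sumrB.
by apply: eq_bigr => k _; rewrite /phik; ring.
Qed.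

Let l j := - ln (r j).

Let l_ge0 j : 0 <= l j.
Proof. by rewrite oppr_ge0 ln_le0//; have /andP[] := r0 j. Qed.

(** Once tau >= l_j, the factor e^tau r_j is at least 1, so after rescaling the other points are at
    distance at least 2 from x_j, out of the range of kappa. *)
Let kscale_ge tau : 0 <= tau -> N%:R - \sum_j (0 <= tau < l j)%R%:R <= kscale tau.
Proof.
move=> t0; rewrite (_ : _ - _ = \sum_j (~~ (tau < l j))%:R).
  apply: kform_ge_isolated q1 _ => j k; rewrite -leNgt => lt kj.
  rewrite -scalerBr kap_far// enormZ ger0_norm ?expR_ge0//.
  have /andP[rj _] := r0 j.
  have h1 : (r j)^-1 <= expR tau.
    by rewrite -[(r j)^-1]lnK ?posrE ?invr_gt0// ler_expR lnV.
  have h2 : 1 <= expR tau * r j by rewrite -ler_pdivrMr// mul1r.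
  have h3 : expR tau * (2 * r j) <= expR tau * enorm (x j - x k).
    by rewrite ler_wpM2l ?expR_ge0// rx.
  by apply: le_trans h3; lra.
rewrite (_ : N%:R = \sum_(j < N) 1); last by rewrite sumr_const card_ord.
rewrite -sumrB; apply: eq_bigr => j _; rewrite t0 /=.
by case: (tau < l j); rewrite ?subrr ?subr0.
Qed.

Let kscale_sqr_ge tau : (1 - 2 * n%:R * (eps * expR tau)) * Q2 <= kscale tau.
Proof.
apply: kform_sqr_ge => [|j]; first by rewrite mulr_ge0 ?expR_ge0.
by rewrite enormZ ger0_norm ?expR_ge0// mulrC ler_wpM2r ?expR_ge0.
Qed.

Variables (tau0 : R) (rho : R -> R).
Hypothesis tau0_ge1 : 1 <= tau0.
Hypothesis rint_rho : rint mu rho.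
Hypothesis rho01 : forall tau, 0 <= rho tau <= 1.
Hypothesis rho_tau0 : forall tau, tau < tau0 -> rho tau = 0.

(** A minorant of [I] assembled from regimes. For tau < 0 the terms N cancel and [kscale_sqr_ge]
    leaves an error 2 n eps e^tau Q2; on [0, 1) D is at least Q2 / 2; on [1, tau0) only D >= 0 is
    used; beyond tau0 the share rho of D is kept. *)
Let G (tau : R) : R :=
  - (2 * n%:R * eps * Q2) * (expR tau * (tau < 0)%R%:R) +
  1 / 2 * Q2 * (0 <= tau < 1)%R%:R - N%:R * (0 <= tau < tau0)%R%:R +
  (kscale tau * rho tau - N%:R * rho tau) - \sum_j (0 <= tau < l j)%R%:R.

Let rint_G : rint mu G.
Proof.
apply: rintB; last by apply: rint_sum => j _; exact: rint_itv.
apply: rintD; last by apply: rintB; [exact: rint_kscaleM|exact: rintZ].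
apply: rintB; last by apply: rintZ; apply: rint_itv; exact: le_trans tau0_ge1.
apply: rintD; apply: rintZ; [exact: rint_expR_neg|exact: rint_itv].
Qed.

Let Q2_ge0 : 0 <= Q2. Proof. exact: sqr_ge0. Qed.

Let expR1_ge1 : 1 <= expR 1 :> R.
Proof. by rewrite -[leLHS]expR0 ler_expR. Qed.

Let G_le_I tau : G tau <= I tau.
Proof.
rewrite /G IE; have [t0|t0] /= := ltP tau 0.
  rewrite rho_tau0; last by apply: lt_le_trans t0 _; exact: le_trans tau0_ge1.
  rewrite big1 ?mulr1 ?mulr0 ?mul1r//.
  have := kscale_sqr_ge tau; move: (kscale tau) (expR tau) Q2 => k E Q H; lra.
have [t1|t1] /= := ltP tau 1.
  rewrite rho_tau0; last exact: lt_le_trans tau0_ge1.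
  have S0 : 0 <= \sum_j (tau < l j)%R%:R :> R by apply: sumr_ge0.
  have H : 4 * n%:R * (eps * expR tau) * Q2 <= 1 * Q2.
    rewrite ler_wpM2r//; apply: le_trans eps_dim.
    by rewrite ler_wpM2l ?mulr_ge0// ler_wpM2l// ler_expR ltW.
  have := kscale_sqr_ge tau; move: S0 H.
  rewrite (_ : tau < tau0 = true) /=; last exact: lt_le_trans tau0_ge1.
  by move: (\sum_j _) (kscale tau) (expR tau) Q2 => S k E Q; lra.
have K := kscale_ge t0.
have S0 : 0 <= \sum_j (0 <= tau < l j)%R%:R :> R by apply: sumr_ge0.
have [t2|t2] /= := ltP tau tau0.
  rewrite rho_tau0//; have := kscale_ge0 tau.
  by rewrite !(mulr0, mul0r, mulr1, subr0, addr0, add0r); move: S0; rewrite t0 /=; lra.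
have /andP[a0 a1] := rho01 tau.
(* Only the share 1 - rho of D is traded for its lower bound by the number of isolated charges. *)
have : 0 <= (1 - rho tau) * (kscale tau - (N%:R - \sum_j (0 <= tau < l j)%R%:R)).
  by rewrite mulr_ge0 ?subr_ge0.
have : 0 <= rho tau * \sum_j (0 <= tau < l j)%R%:R by rewrite mulr_ge0.
move: K; rewrite t0 /=; move: (\sum_j (tau < l j)%R%:R) (kscale tau) => S k; lra.
Qed.

(** Integrate [G_le_I]. The gain Q2 / 2 from [0, 1) covers the error 2 n eps Q2 from tau < 0, the
    term [logc] Q2 is discarded as it is nonnegative, and the intervals [0, l_j) integrate to - ln
    r_j. *)
Lemma log_energy_ge :
  \sum_j ln (r j) - N%:R * (tau0 + \int[mu]_tau rho tau + logc) +
    \int[mu]_tau (kscale tau * rho tau) <=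
  \sum_j \sum_(k | k != j) q j * q k * - ln (enorm (x j - x k)).
Proof.
have tau00 : 0 <= tau0 by apply: le_trans tau0_ge1.
have : \int[mu]_tau G tau <= \int[mu]_tau I tau.
  by apply: le_Rintegral => // tau _; exact: G_le_I.
rewrite Rintegral_I /G RintegralB//; last 2 first.
- apply: rintD; last by apply: rintB; [exact: rint_kscaleM|exact: rintZ].
  apply: rintB; last by apply: rintZ; exact: rint_itv.
  apply: rintD; apply: rintZ; [exact: rint_expR_neg|exact: rint_itv].
- by apply: rint_sum => j _; exact: rint_itv.
rewrite RintegralD//; last 2 first.
- apply: rintB; last by apply: rintZ; exact: rint_itv.
  apply: rintD; apply: rintZ; [exact: rint_expR_neg|exact: rint_itv].
- by apply: rintB; [exact: rint_kscaleM|exact: rintZ].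
rewrite !RintegralB//; [|exact: rint_kscaleM|exact: rintZ| |]; last 2 first.
- apply: rintD; apply: rintZ; [exact: rint_expR_neg|exact: rint_itv].
- by apply: rintZ; exact: rint_itv.
rewrite RintegralD//; [|by apply: rintZ; exact: rint_expR_neg|by apply: rintZ; exact: rint_itv].
rewrite !RintegralZl//; [|exact: rint_itv|exact: rint_itv|exact: rint_expR_neg].
rewrite Rintegral_sum; last by move=> j _; exact: rint_itv.
rewrite !Rintegral_itv//.
under eq_bigr do rewrite Rintegral_itv// subr0 /l.
rewrite sumrN.
have h0 : 0 <= 2 * n%:R * eps by rewrite !mulr_ge0.
have h1 : 2 * n%:R * eps <= 1 / 2.
  have : 2 * n%:R * eps <= 2 * n%:R * eps * expR 1 by rewrite ler_peMr.
  move: eps_dim; rewrite mulrA; move: (expR 1) => E; lra.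
have h2 : 2 * n%:R * eps * Q2 * \int[mu]_tau (expR tau * (tau < 0)%R%:R) <= 1 / 2 * Q2.
  apply: (@le_trans _ _ (2 * n%:R * eps * Q2)); last by rewrite ler_wpM2r.
  by apply: ler_piMr; [rewrite mulr_ge0|exact: Rintegral_expR_neg].
have h3 : 0 <= logc * Q2 by rewrite mulr_ge0 ?logc_ge0.
move: h2 h3; move: (\int[mu]_tau _) (\int[mu]_tau _) (\int[mu]_tau _) (\sum_j ln _) (\sum_j _) Q2 => A B C D E Q.
lra.
Qed.

End points.
End log_energy.

(** * The spectral weight *)

Section spectral_weight.
Context {R : realType}.
Local Notation RM := (measurableTypeR R).
Local Notation mu := (@lebesgue_measure R).
Variables (n : nat) (s : R).
Hypothesis ns : n%:R < s.

Let s0 : 0 < s. Proof. exact: le_lt_trans ns. Qed.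
Let sn0 : 0 < s - n%:R. Proof. by rewrite subr_gt0. Qed.

(* Balls of radius e^tau / pi with exponentially distributed tau, so that the
  weight splits over the same scales as the logarithm. *)
Definition wker (tau : R) (xi : 'rV[R]_n) : R :=
  exponential_pdf s tau * chi (expR tau / pi) xi.

Definition swt (xi : 'rV[R]_n) : R := \int[mu]_tau wker tau xi.

Lemma wker_ge0 tau xi : 0 <= wker tau xi.
Proof. by rewrite mulr_ge0 ?chi_ge0// exponential_pdf_ge0// ltW. Qed.

Lemma wker_le tau xi : wker tau xi <= exponential_pdf s tau.
Proof. by rewrite /wker ler_piMr ?chi_le1// exponential_pdf_ge0// ltW. Qed.

Lemma measurable_chi_exp : measurable_fun setT
  (fun p : RM * n.-tuple RM => chi (expR p.1 / pi) (rvec p.2)).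
Proof.
apply: measurable_natr_bool; apply: measurable_fun_ltr.
  apply: measurable_enorm => i.
  exact: (measurableT_comp (measurable_rvec_coord i) measurable_snd).
apply: measurable_funM => //.
exact: (measurableT_comp (@measurable_expR R) measurable_fst).
Qed.

Lemma measurable_wker : measurable_fun setT
  (fun p : RM * n.-tuple RM => wker p.1 (rvec p.2)).
Proof.
apply: measurable_funM; last exact: measurable_chi_exp.
exact: (measurableT_comp (measurable_exponential_pdf s) measurable_fst).
Qed.

Lemma rint_wker xi : rint mu (wker ^~ xi).
Proof.
apply: (rint_leR (g := exponential_pdf s)).
- apply: measurable_funM; first exact: measurable_exponential_pdf.
  apply: measurable_natr_bool; apply: measurable_fun_ltr => //.
  by apply: measurable_funM => //; exact: measurable_expR.
- exact: integrable_exponential_pdf.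
- by move=> tau; rewrite ger0_norm ?wker_ge0// wker_le.
Qed.

Lemma swt_ge0 xi : 0 <= swt xi.
Proof. by apply: Rintegral_ge0 => tau _; exact: wker_ge0. Qed.

Lemma Rintegral_exponential_pdf (r : R) : 0 < r ->
  \int[mu]_x exponential_pdf r x = 1.
Proof. by move=> r0; rewrite /Rintegral integral_exponential_pdf. Qed.

(** The number a satisfies e^a / pi = 2 sqrt (1 + |xi|^2) > |xi|, so xi lies in all the balls with
    tau >= a, and the exponential law has mass e^(- s a) beyond a. *)
Lemma swt_ge xi : (2 * pi) `^ (- s) * (1 + enorm xi ^+ 2) `^ (- (s / 2)) <= swt xi.
Proof.
have p0 := pi_gt0 R.
have q0 : 0 < 1 + enorm xi ^+ 2 by rewrite ltr_wpDr ?sqr_ge0.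
pose a := ln (2 * pi) + ln (1 + enorm xi ^+ 2) / 2.
have a0 : 0 <= a.
  rewrite addr_ge0//; last by rewrite mulr_ge0// ln_ge0// lerDl sqr_ge0.
  by rewrite ln_ge0//; have := pi_ge2 R; lra.
have ea : enorm xi < expR a / pi.
  have h : expR (ln (1 + enorm xi ^+ 2) / 2) ^+ 2 = 1 + enorm xi ^+ 2.
    by rewrite expr2 -expRD -splitr lnK.
  rewrite expRD lnK ?posrE ?mulr_gt0// mulrAC mulfK ?gt_eqF//.
  rewrite -(ltr_pXn2r (n := 2))// ?nnegrE ?enorm_ge0// ?mulr_ge0 ?expR_ge0//.
  by rewrite exprMn h; have := sqr_ge0 (enorm xi); lra.
have -> : (2 * pi) `^ (- s) * (1 + enorm xi ^+ 2) `^ (- (s / 2)) = expR (- s * a).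
  rewrite /powR !gt_eqF// ?mulr_gt0// -expRD; congr expR; rewrite /a; by field.
have h : rint mu (exponential_pdf s) by apply: integrable_exponential_pdf.
(* Memorylessness: beyond a, the density is e^(- s a) times its translate by a. *)
have <- : \int[mu]_tau (expR (- s * a) * exponential_pdf s (1 * tau + - a)) = expR (- s * a).
  rewrite RintegralZl//; last by apply: (rint_affine _ (oner_neq0 R) h).
  rewrite (Rintegral_affine _ (oner_neq0 R) h) normr1 invr1 mul1r.
  by rewrite Rintegral_exponential_pdf// mulr1.
apply: le_Rintegral => //; [|exact: rint_wker|].
  by apply: rintZ; apply: (rint_affine _ (oner_neq0 R) h).
move=> tau _; rewrite mul1r; have [ta|ta] := ltP tau a.
  by rewrite lt0_exponential_pdf ?subr_lt0// mulr0 wker_ge0.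
rewrite exponential_pdfE ?subr_ge0//.
rewrite /wker exponential_pdfE ?(le_trans a0)// /chi (lt_le_trans ea) /=; last first.
  by rewrite ler_wpM2r ?invr_ge0 ?(ltW p0)// ler_expR.
rewrite mulr1 mulrCA -expRD (_ : - s * a + - s * (tau - a) = - s * tau)//; ring.
Qed.

Lemma measurable_swt : measurable_Rn swt.
Proof.
apply/measurable_EFinP.
apply: (eq_measurable_fun (fun t : n.-tuple RM => \int[mu]_tau (wker tau (rvec t))%:E)%E).
  by move=> t _; rewrite /= EFin_Rintegral//; exact: rint_wker.
apply: (@measurable_fun_fubini_tonelli_G _ _ RM (n.-tuple RM) R mu
  (fun p => (wker p.1 (rvec p.2))%:E)).
  by apply/measurable_EFinP; exact: measurable_wker.
by move=> p; rewrite lee_fin wker_ge0.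
Qed.

Lemma swt_tonelli (h : 'rV[R]_n -> R) : measurable_Rn h -> (forall xi, 0 <= h xi) ->
  (\int[leb R n]_t (h (rvec t) * swt (rvec t))%:E =
   \int[mu]_tau ((exponential_pdf s tau)%:E *
     \int[leb R n]_t (chi (expR tau / pi) (rvec t) * h (rvec t))%:E))%E.
Proof.
move=> mh h0.
transitivity (\int[leb R n]_t \int[mu]_tau (wker tau (rvec t) * h (rvec t))%:E)%E.
  apply: eq_integral => t _.
  rewrite mulrC /swt -RintegralZr//; last exact: rint_wker.
  by rewrite EFin_Rintegral//; apply: eq_integrable (rintZ (h (rvec t)) (rint_wker (rvec t))) => // tau _ /=; rewrite mulrC.
rewrite -(fubini_tonelli (fun p : RM * n.-tuple RM => (wker p.1 (rvec p.2) * h (rvec p.2))%:E)); last 2 first.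
- apply/measurable_EFinP; apply: measurable_funM; first exact: measurable_wker.
  exact: (measurableT_comp mh measurable_snd).
- by move=> p; rewrite lee_fin mulr_ge0// wker_ge0.
apply: eq_integral => tau _ /=.
rewrite -ge0_integralZl//.
- by apply: eq_integral => t _; rewrite -EFinM /wker mulrA.
- by apply/measurable_EFinP; apply: measurable_funM => //; exact: measurable_chi.
- by move=> t _; rewrite lee_fin mulr_ge0 ?chi_ge0.
- by rewrite lee_fin exponential_pdf_ge0// ltW.
Qed.

Local Notation B := (integral_Rn (@chi R n pi^-1)).

Let B_ge0 : 0 <= B.
Proof. by apply: integral_Rn_ge0 => z; exact: chi_ge0. Qed.

(** [C1] is the constant of the mean bound [integral_cpow_le], [C2] that of the pointwise bound
    [cpow_le_kform] times the volume of the frequency ball, and [K] the ratio of rates in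
    [exponential_pdf_tilt]. *)
Local Notation C1 := (expR pi^-1 / (cos 1 ^+ 2 * integral_Rn (@chi R n (1 / 2)))).
Local Notation C2 := (B * (2 * 3 ^+ n / cos 1 ^+ 2)).
Local Notation K := (s / (s - n%:R)).

Let C1_ge0 : 0 <= C1.
Proof.
rewrite divr_ge0 ?expR_ge0// mulr_ge0 ?sqr_ge0//.
by apply: integral_Rn_ge0 => z; exact: chi_ge0.
Qed.

Let C2_ge0 : 0 <= C2.
Proof.
apply: mulr_ge0 => //; apply: divr_ge0; last exact: sqr_ge0.
by apply: mulr_ge0 => //; exact: exprn_ge0.
Qed.

(** The volume growth e^(n tau) of the frequency balls lowers the exponential rate from s to s - n,
    still positive: here s > n is used. *)
Lemma exponential_pdf_tilt tau :
  exponential_pdf s tau * expR tau ^+ n = K * exponential_pdf (s - n%:R) tau.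
Proof.
have [t0|t0] := ltP tau 0; first by rewrite !lt0_exponential_pdf// mul0r mulr0.
rewrite !exponential_pdfE// mulrA divfK ?gt_eqF// -mulrA; congr (_ * _).
by rewrite -expRM_natl -expRD; congr expR; ring.
Qed.

Let rho1 tau0 tau := exponential_pdf (s - n%:R) tau * (tau0 <= tau)%R%:R.

Let rint_rho1 tau0 : rint mu (rho1 tau0).
Proof.
apply: (rint_leR (g := exponential_pdf (s - n%:R))).
- apply: measurable_funM; first exact: measurable_exponential_pdf.
  by apply: measurable_natr_bool; exact: measurable_fun_ler.
- exact: integrable_exponential_pdf.
move=> tau; have h := @exponential_pdf_ge0 R _ (ltW sn0) tau.
by rewrite ger0_norm ?mulr_ge0// /rho1; case: (_ <= tau); rewrite ?mulr1 ?mulr0.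
Qed.

Definition ballpow N (q : 'I_N -> R) (x : 'I_N -> 'rV[R]_n) (tau : R) : \bar R :=
  (\int[leb R n]_t (chi (expR tau / pi) (rvec t) * cpow q x (rvec t))%:E)%E.

Lemma cpow_dilate N (q : 'I_N -> R) (x : 'I_N -> 'rV[R]_n) c xi : cpow q x (c *: xi) = cpow q (fun j => c *: x j) xi.
Proof.
by rewrite /cpow /ccos /csin; congr (_ ^+ 2 + _ ^+ 2); apply: eq_bigr => j _;
  rewrite dotvZl dotvZr.
Qed.

Section points.
Variables (N : nat) (q : 'I_N -> R) (x : 'I_N -> 'rV[R]_n).
Hypothesis q1 : forall j, q j ^+ 2 = 1.

(** Frequencies up to e^tau / pi seen by the points x_j are frequencies up to 1 / pi seen by the
    points e^tau x_j. *)
Lemma ballpow_dilate tau : ballpow q x tau = ((expR tau ^+ n)%:E *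
  \int[leb R n]_t (chi pi^-1 (rvec t) * cpow q (fun j => expR tau *: x j) (rvec t))%:E)%E.
Proof.
have et := expR_gt0 tau.
have := @ge0_integral_dilate R n (fun z => (chi (expR tau / pi) z * cpow q x z)%:E) _ (lt0r_neq0 et).
move=> /(_ _ _)/wrap[].
- apply/measurable_EFinP; apply: measurable_funM; first exact: measurable_chi.
  exact: measurable_cpow.
- by move=> z; rewrite lee_fin mulr_ge0 ?chi_ge0 ?cpow_ge0.
rewrite (gtr0_norm et) => H.
rewrite (_ : \int[leb R n]_t (chi pi^-1 (rvec t) * cpow q (fun j => expR tau *: x j) (rvec t))%:E =
  \int[leb R n]_t (chi (expR tau / pi) (expR tau *: rvec t) * cpow q x (expR tau *: rvec t))%:E)%E.
  by rewrite H muleA -EFinM divff ?mul1e// expf_neq0// gt_eqF.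
by apply: eq_integral => t _; rewrite cpow_dilate /chi enormZ gtr0_norm// ltr_pM2l.
Qed.

Let rint_chi_cpow (y : 'I_N -> 'rV[R]_n) : rint (leb R n) (fun t => chi pi^-1 (rvec t) * cpow q y (rvec t)).
Proof.
apply: eq_integrable (rintMbd (rint_chi n pi^-1) (measurable_cpow q y) _) => //.
- by move=> t _ /=; rewrite mulrC.
- by move=> t; rewrite ger0_norm ?cpow_ge0//; exact: cpow_le.
Qed.

Lemma ballpow_le_kscale tau :
  (ballpow q x tau <= (expR tau ^+ n * (expR pi^-1 / (cos 1 ^+ 2 * integral_Rn (@chi R n (1 / 2)))) * kscale q x tau)%:E)%E.
Proof.
rewrite ballpow_dilate -EFin_Rintegral// -EFinM lee_fin -mulrA ler_wpM2l ?exprn_ge0 ?expR_ge0//.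
exact: integral_cpow_le.
Qed.

(** If the points rescaled by e^sigma still lie in the unit ball, the pointwise bound applies to
    them at the smaller frequencies e^(tau - sigma) z. Low frequencies can thus be charged to any
    such later scale sigma. *)
Lemma ballpow_le_kscale_later tau sigma : tau <= sigma ->
  (forall j, enorm (x j) * expR sigma <= 1) ->
  (ballpow q x tau <= (expR tau ^+ n * (B * (2 * 3 ^+ n / cos 1 ^+ 2)) * kscale q x sigma)%:E)%E.
Proof.
move=> ts xs.
rewrite ballpow_dilate -EFin_Rintegral// -EFinM lee_fin -!mulrA ler_wpM2l ?exprn_ge0 ?expR_ge0//.
set K := 2 * (3 ^+ n * (cos 1 ^- 2 * kscale q x sigma)).
rewrite [leRHS]mulrC -integral_RnZ; last exact: rint_chi.
apply: (@le_integral_Rn R n (fun z => chi pi^-1 z * cpow q (fun j => expR tau *: x j) z)) => //.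
  by apply: rintZ; exact: rint_chi.
move=> z; rewrite mulrC /chi; case: ltP => [zp|]; rewrite ?mulr1 ?mulr0//.
have e1 : expR (tau - sigma) <= 1 by rewrite -[leRHS]expR0 ler_expR subr_le0.
have := @cpow_le_kform R n N q (fun j => expR sigma *: x j) (expR (tau - sigma) *: z).
rewrite cpow_dilate (_ : cpow q _ z = cpow q (fun j => expR tau *: x j) z).
  rewrite /K !mulrA; apply.
    rewrite enormZ ger0_norm ?expR_ge0//; apply: le_trans (ltW zp).
    by rewrite ler_piMl ?enorm_ge0.
  by move=> j; rewrite enormZ ger0_norm ?expR_ge0// mulrC.
by congr (cpow q _ z); apply/funext => j; rewrite scalerA -expRD subrK.
Qed.

Section range.
Variables (tau0 L : R).
Hypothesis tau00 : 0 <= tau0.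
Hypothesis L0 : 0 < L.
Hypothesis xL : forall j, enorm (x j) * expR (tau0 + L) <= 1.

Let D := kscale q x.

(** Scales before tau0 are charged to the single scale sigma through [C2], later ones each to itself
    through [C1]. *)
Let bound (sigma tau : R) : R := K * (exponential_pdf (s - n%:R) tau *
  (C2 * D sigma)) + C1 * K * (D tau * (exponential_pdf (s - n%:R) tau * (tau0 <= tau)%R%:R)).

Let rint_bound sigma : rint mu (bound sigma).
Proof.
apply: rintD.
  apply: rintZ; apply: eq_integrable (rintZ (C2 * D sigma) (integrable_exponential_pdf sn0)) => // tau _ /=.
  by rewrite mulrC.
by apply: rintZ; apply: rint_kscaleM => //; exact: rint_rho1.
Qed.

Let assoc (a b c d : R) : a * (b * c * d) = a * b * (c * d).
Proof. by rewrite -!mulrA. Qed.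

Let ballpow_bound sigma tau : tau0 <= sigma <= tau0 + L ->
  ((exponential_pdf s tau)%:E * ballpow q x tau <= (bound sigma tau)%:E)%E.
Proof.
move=> /andP[s1 s2].
have p0 := @exponential_pdf_ge0 R _ (ltW s0) tau.
have p1 := @exponential_pdf_ge0 R _ (ltW sn0) tau.
have K0 : 0 <= K by rewrite divr_ge0// ltW.
have [tt|tt] := leP tau0 tau.
  apply: le_trans (lee_wpmul2l _ (ballpow_le_kscale tau)) _; first by rewrite lee_fin.
  rewrite -EFinM lee_fin /bound tt mulr1 (assoc _ _ C1) exponential_pdf_tilt.
  rewrite ler_wpDl//.
    by apply: mulr_ge0 => //; apply: mulr_ge0 => //; apply: mulr_ge0 => //; exact: kscale_ge0.
  by rewrite le_eqVlt; apply/orP; left; apply/eqP; rewrite /D; ring.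
apply: le_trans (lee_wpmul2l _ (@ballpow_le_kscale_later tau sigma _ _)) _.
- by rewrite lee_fin.
- exact: le_trans (ltW tt) s1.
- by move=> j; apply: le_trans (xL j); rewrite ler_wpM2l ?enorm_ge0// ler_expR.
have tf : (tau0 <= tau) = false by rewrite leNgt tt.
rewrite -EFinM lee_fin /bound tf /= !mulr0 addr0 (assoc _ _ C2) exponential_pdf_tilt.
by rewrite le_eqVlt; apply/orP; left; apply/eqP; rewrite /D; ring.
Qed.

Let ballpow_ge0 tau : (0 <= ballpow q x tau)%E.
Proof. by apply: integral_ge0 => t _; rewrite lee_fin mulr_ge0 ?chi_ge0 ?cpow_ge0. Qed.

Let swt_cpow_bound sigma : tau0 <= sigma <= tau0 + L ->
  (\int[leb R n]_t (cpow q x (rvec t) * swt (rvec t))%:E <=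
   (\int[mu]_tau bound sigma tau)%:E)%E.
Proof.
move=> hs; rewrite swt_tonelli; [|exact: measurable_cpow|exact: cpow_ge0].
rewrite EFin_Rintegral//; apply: ge0_le_integral => //.
- by move=> tau _; rewrite mule_ge0//; [rewrite lee_fin exponential_pdf_ge0// ltW|exact: ballpow_ge0].
- apply: emeasurable_funM.
    by apply/measurable_EFinP; exact: measurable_exponential_pdf.
  apply: (measurable_fun_fubini_tonelli_F (fun p : RM * n.-tuple RM =>
    (chi (expR p.1 / pi) (rvec p.2) * cpow q x (rvec p.2))%:E)).
    apply/measurable_EFinP; apply: measurable_funM; first exact: measurable_chi_exp.
    exact: (measurableT_comp (measurable_cpow q x) measurable_snd).
  by move=> p; rewrite lee_fin mulr_ge0 ?chi_ge0 ?cpow_ge0.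
- by apply/measurable_EFinP; exact: rint_measurable (rint_bound sigma).
- by move=> tau _; exact: ballpow_bound.
Qed.

Lemma rint_swt_cpow : rint (leb R n) (fun t => cpow q x (rvec t) * swt (rvec t)).
Proof.
apply: rintP.
  by apply: measurable_funM; [exact: measurable_cpow|exact: measurable_swt].
under eq_integral do rewrite ger0_norm ?mulr_ge0 ?cpow_ge0 ?swt_ge0//.
apply: le_lt_trans (@swt_cpow_bound tau0 _) (ltry _).
by rewrite lexx lerDl ltW.
Qed.

Let rho0 tau : R :=
  K * C2 / L * (tau0 <= tau < tau0 + L)%R%:R + C1 * K * rho1 tau0 tau.

(** The bound is valid for every sigma in [tau0, tau0 + L]. Averaging over sigma replaces the point
    value D(sigma) by an integral with density K C2 / L, which is small when L is large. *)
Lemma integral_swt_cpow_le :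
  integral_Rn (fun xi => cpow q x xi * swt xi) <= \int[mu]_tau (D tau * rho0 tau).
Proof.
set I := integral_Rn _; pose E := C1 * K * \int[mu]_tau (D tau * rho1 tau0 tau).
have LL : tau0 <= tau0 + L by rewrite lerDl ltW.
have IE sigma : tau0 <= sigma <= tau0 + L -> I <= K * C2 * D sigma + E.
  move=> hs; rewrite -lee_fin /I /integral_Rn EFin_Rintegral; last exact: rint_swt_cpow.
  apply: le_trans (swt_cpow_bound hs) _; rewrite lee_fin /bound.
  have hp : rint mu (fun tau => exponential_pdf (s - n%:R) tau * (C2 * D sigma)).
    apply: eq_integrable (rintZ (C2 * D sigma) (integrable_exponential_pdf sn0)) => // tau _ /=.
    by rewrite mulrC.
  rewrite RintegralD//; [|exact: rintZ|by apply: rintZ; apply: rint_kscaleM => //; exact: rint_rho1].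
  rewrite !RintegralZl//; [|apply: rint_kscaleM => //; exact: rint_rho1].
  rewrite RintegralZr//; last exact: integrable_exponential_pdf.
  by rewrite Rintegral_exponential_pdf// mul1r mulrA.
have hi := rint_itv LL.
have H : \int[mu]_sigma (I * (tau0 <= sigma < tau0 + L)%R%:R) <=
    \int[mu]_sigma (K * C2 * (D sigma * (tau0 <= sigma < tau0 + L)%R%:R) +
      E * (tau0 <= sigma < tau0 + L)%R%:R).
  apply: le_Rintegral => //; first exact: rintZ.
    by apply: rintD; apply: rintZ => //; exact: rint_kscaleM.
  move=> sigma _; rewrite mulrA -mulrDl; case: (boolP (tau0 <= sigma < _)) => [/andP[h1 h2]|_].
    by rewrite !mulr1 IE// h1 ltW.
  by rewrite !mulr0.
have hk : rint mu (fun tau => D tau * (tau0 <= tau < tau0 + L)%R%:R) by exact: rint_kscaleM.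
move: H; rewrite RintegralD//; [|exact: rintZ|exact: rintZ].
rewrite !RintegralZl// Rintegral_itv// addrAC subrr add0r => H.
rewrite (_ : \int[mu]_tau (D tau * rho0 tau) =
  K * C2 / L * \int[mu]_tau (D tau * (tau0 <= tau < tau0 + L)%R%:R) + E).
  rewrite -(ler_pM2r L0); apply: le_trans H _.
  have Ln : L != 0 by rewrite gt_eqF.
  move: (\int[mu]_x0 _) (K * C2) => M kc; rewrite mulrDl lerD2r mulrAC.
  by rewrite divfK.
rewrite /E /rho0; move: C1 (K * C2 / L) K => c1 c2 k.
rewrite -!RintegralZl//; last exact: rint_kscaleM.
rewrite -RintegralD//; [|exact: rintZ|by apply: rintZ; apply: rint_kscaleM => //; exact: rint_rho1].
by apply: eq_Rintegral => tau _; ring.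
Qed.

End range.

End points.

Let half_aux (A k c L : R) (b : bool) : 0 < L -> 0 <= A * k * c -> 2 * (A * k * c) < L ->
  A * (k * c / L * b%:R) <= 1 / 2.
Proof.
move=> L0 h0 h1; rewrite (_ : A * _ = A * k * c / L * b%:R); last by ring.
apply: (@le_trans _ _ (A * k * c / L)).
  by apply: ler_piMr; [rewrite divr_ge0// ltW|rewrite lern1 leq_b1].
rewrite ler_pdivrMr//; move: (A * k * c) h1 => z; lra.
Qed.

(** Both parts of A [rho0] are made at most 1/2, the first by a large L and the second by a large
    tau0. The choice depends on A, n and s only, not on the points. *)
Lemma swt_cpow_le_kscale (A : R) : 0 <= A ->
  exists tau0 L : R, exists rho : R -> R,
  [/\ 1 <= tau0, 0 < L,
     rint mu rho /\ (forall tau, 0 <= rho tau <= 1),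
     (forall tau, tau < tau0 -> rho tau = 0) &
     forall N (q : 'I_N -> R) (x : 'I_N -> 'rV[R]_n),
       (forall j, q j ^+ 2 = 1) ->
       (forall j, enorm (x j) * expR (tau0 + L) <= 1) ->
       A * integral_Rn (fun xi => cpow q x xi * swt xi) <=
         \int[mu]_tau (kscale q x tau * rho tau)].
Proof.
move=> A0.
pose c1 := C1; pose c2 := C2; pose k := K; pose m := s - n%:R.
have c10 : 0 <= c1 by exact: C1_ge0.
have c20 : 0 <= c2 by exact: C2_ge0.
have k0 : 0 <= k by rewrite divr_ge0// ltW.
(* Gives A k c2 / L <= 1/2; the added 1 keeps L positive. *)
pose L : R := 2 * (A * k * c2) + 1.
have L1 : 2 * (A * k * c2) < L by rewrite ltrDl.
have L0 : 0 < L by rewrite ltr_wpDl// mulr_ge0// mulr_ge0// mulr_ge0.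
pose b : R := 2 * (A * (c1 * k) * m) + 1.
have m0 : 0 <= m by exact: ltW.
have b0 : 0 < b by rewrite ltr_wpDl// mulr_ge0// mulr_ge0// mulr_ge0// mulr_ge0.
(* For tau >= tau0 one has e^(- m tau) <= 1 / b, so the tail part of [rho] is at most A c1 k m / b
   <= 1/2. *)
pose tau0 : R := 1 + `|ln b| / m.
have tau01 : 1 <= tau0 by rewrite lerDl divr_ge0// ltW.
have tau00 : 0 <= tau0 by exact: le_trans tau01.
pose rho tau : R := A * (k * c2 / L * (tau0 <= tau < tau0 + L)%R%:R +
  c1 * k * (exponential_pdf m tau * (tau0 <= tau)%R%:R)).
have rho_small tau : rho tau <= 1.
  have h1 : A * (k * c2 / L * (tau0 <= tau < tau0 + L)%R%:R) <= 1 / 2.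
    apply: half_aux => //; by rewrite mulr_ge0// mulr_ge0.
  have h2 : A * (c1 * k * (exponential_pdf m tau * (tau0 <= tau)%R%:R)) <= 1 / 2.
    have [tt|tt] := leP tau0 tau; last by rewrite !mulr0; lra.
    rewrite mulr1 exponential_pdfE ?(le_trans tau00)// mulrA [_ * (m * _)]mulrA.
    have h3 : expR (- m * tau) <= b^-1.
      rewrite -[b^-1]lnK ?posrE ?invr_gt0// ler_expR lnV ?posrE// mulNr lerN2.
      apply: (@le_trans _ _ (m * tau0)); last by rewrite ler_wpM2l.
      rewrite mulrDr mulr1 mulrCA divff ?gt_eqF// mulr1.
      by rewrite (le_trans (ler_norm _))// lerDr.
    apply: (@le_trans _ _ (A * (c1 * k) * m / b)).
      by rewrite ler_wpM2l// mulr_ge0// mulr_ge0// mulr_ge0.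
    rewrite ler_pdivrMr// /b; move: (A * _ * m) => z; lra.
  by rewrite /rho mulrDr (le_trans (lerD h1 h2))//; lra.
exists tau0, L, rho; split => //.
- split; last first.
    move=> tau; rewrite rho_small andbT.
    have p0 := @exponential_pdf_ge0 R _ (ltW sn0) tau.
    have L0' : 0 <= L^-1 by rewrite invr_ge0 ltW.
    apply: mulr_ge0 => //; apply: addr_ge0; apply: mulr_ge0 => //; apply: mulr_ge0 => //.
    exact: mulr_ge0.
  apply: rintZ; apply: rintD; apply: rintZ; first by apply: rint_itv; rewrite lerDl ltW.
  exact: rint_rho1.
- move=> tau tt; have tf : (tau0 <= tau) = false by rewrite leNgt tt.
  by rewrite /rho tf /= !mulr0 addr0 mulr0.
move=> N q x q1 xL.
have H := integral_swt_cpow_le q1 L0 xL.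
apply: le_trans (ler_wpM2l A0 H) _.
rewrite -RintegralZl//.
  by rewrite le_eqVlt; apply/orP; left; apply/eqP; apply: eq_Rintegral => tau _; rewrite mulrCA.
apply: rint_kscaleM => //; apply: rintD; apply: rintZ; last exact: rint_rho1.
by apply: rint_itv; rewrite lerDl ltW.
Qed.

End spectral_weight.

(** * Test functions *)

Section smooth_functions.
Context {R : realType}.

(** Reduces directional derivatives to derivatives in one variable, where the chain rule is
    applied. *)
Lemma is_derive_lineP n (f : 'rV[R]_n -> R) x v (a : R) :
  is_derive x v f a <-> is_derive (0 : R) (1 : R) (fun h : R => f (h *: v + x)) a.
Proof.
have E : 'D_v f x = 'D_(1 : R) (fun h : R => f (h *: v + x)) (0 : R).
  rewrite /derive; set F := (X in lim (X @ _)); set G := (X in _ = lim (X @ _)).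
  suff -> : F = G by []; apply/funext => h; rewrite /F /G /=.
  by rewrite addr0 scale0r add0r [_%:A]mulr1.
split=> -[d <-]; constructor.
- exact: (derivable1P _ _ _).1.
- by rewrite E.
- exact: (derivable1P _ _ _).2.
- by rewrite E.
Qed.

Lemma is_derive_comp1 n (h : R -> R) (l : 'rV[R]_n -> R) x v (dl dh : R) :
  is_derive x v l dl -> is_derive (l x) (1 : R) h dh ->
  is_derive x v (fun z => h (l z)) (dh * dl).
Proof.
move=> /is_derive_lineP ld hd; apply/is_derive_lineP.
apply: (@is_derive1_comp _ h (fun t : R => l (t *: v + x)) 0 dh dl _ ld).
by rewrite scale0r add0r.
Qed.

Lemma is_derive_coord n (i : 'I_n) (x v : 'rV[R]_n) :
  is_derive x v (fun z : 'rV[R]_n => z 0 i) (v 0 i).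
Proof.
apply/is_derive_lineP; have := is_derive_affine (v 0 i) (x 0 i) (0 : R).
congr is_derive; apply/funext => h; by rewrite !mxE mulrC.
Qed.

(** The class C^k with the partial derivatives as witnesses, which lets closure under algebraic
    operations go by induction on k; [smooth] speaks of iterated partial derivatives instead. *)
Fixpoint smoothk n (k : nat) (f : 'rV[R]_n -> R) : Prop :=
  if k is k'.+1 then continuous f /\ forall i, exists df,
    (forall x, is_derive x (basis_vec i) f (df x)) /\ smoothk k' df
  else continuous f.

Lemma smoothk_continuous n k (f : 'rV[R]_n -> R) : smoothk k f -> continuous f.
Proof. by case: k => [|k] // []. Qed.

Lemma smoothkW n k (f : 'rV[R]_n -> R) : smoothk k.+1 f -> smoothk k f.
Proof.
elim: k f => [|k IH] f; first by case.
move=> [cf df]; split => // i; have [g [fg sg]] := df i.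
by exists g; split => //; exact: IH.
Qed.

Lemma smoothk_smooth n (f : 'rV[R]_n -> R) : (forall k, smoothk k f) -> smooth f.
Proof.
move=> sf.
have H L : forall k, smoothk k (iter_partial L f).
  elim: L => [|i L IH] //= k; have [_ /(_ i)[df [dfE sdf]]] := IH k.+1.
  rewrite (_ : (fun x => _) = df)//; apply/funext => x.
  by have [] := dfE x.
move=> L; split; first exact: smoothk_continuous (H L 0%N).
by move=> i x; have [_ /(_ i)[df [/(_ x)[]]]] := H L 1%N.
Qed.

Lemma smoothk_cst n k (c : R) : smoothk k (fun _ : 'rV[R]_n => c).
Proof.
elim: k c => [|k IH] c; first exact: cst_continuous.
split; first exact: cst_continuous.
by move=> i; exists (fun=> 0); split => // x; exact: is_derive_cst.
Qed.

Lemma smoothk_coord n k (i : 'I_n) : smoothk k (fun z : 'rV[R]_n => z 0 i).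
Proof.
have c : continuous (fun z : 'rV[R]_n => z 0 i) by exact: coord_continuous.
case: k => [|k] //; split => // j; exists (fun=> basis_vec j 0 i); split.
  by move=> x; exact: is_derive_coord.
exact: smoothk_cst.
Qed.

Lemma smoothkD n k (f g : 'rV[R]_n -> R) : smoothk k f -> smoothk k g ->
  smoothk k (fun z => f z + g z).
Proof.
elim: k f g => [|k IH] f g sf sg; first by move=> x; apply: continuousD; [exact: sf|exact: sg].
split.
  by move=> x; apply: continuousD; [exact: (smoothk_continuous sf)|exact: (smoothk_continuous sg)].
move=> i; have [_ /(_ i)[df [dfE sdf]]] := sf; have [_ /(_ i)[dg [dgE sdg]]] := sg.
exists (fun z => df z + dg z); split; last exact: IH.
by move=> x; exact: is_deriveD.
Qed.

Lemma smoothkM n k (f g : 'rV[R]_n -> R) : smoothk k f -> smoothk k g ->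
  smoothk k (fun z => f z * g z).
Proof.
elim: k f g => [|k IH] f g sf sg; first by move=> x; apply: continuousM; [exact: sf|exact: sg].
split.
  by move=> x; apply: continuousM; [exact: (smoothk_continuous sf)|exact: (smoothk_continuous sg)].
move=> i; have [_ /(_ i)[df [dfE sdf]]] := sf; have [_ /(_ i)[dg [dgE sdg]]] := sg.
exists (fun z => f z * dg z + g z * df z); split.
  by move=> x; exact: is_deriveM.
by apply: smoothkD; apply: IH => //; exact: smoothkW.
Qed.

Lemma smoothkV n k (f : 'rV[R]_n -> R) : (forall z, f z != 0) -> smoothk k f ->
  smoothk k (fun z => (f z)^-1).
Proof.
move=> f0; elim: k => [|k IH] sf; first by move=> x; apply: continuousV; [exact: f0|exact: sf].
split.
  by move=> x; apply: continuousV; [exact: f0|exact: (smoothk_continuous sf)].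
move=> i; have [_ /(_ i)[df [dfE sdf]]] := sf.
exists (fun z => -1 * ((f z)^-1 * (f z)^-1) * df z); split.
  move=> x; have h : is_derive (f x) (1 : R) (fun y : R => y^-1) (- (f x) ^- 2 *: 1).
    exact: (@is_deriveV _ id _ _ _ (f0 x) (is_derive_id _ _)).
  have := is_derive_comp1 (dfE x) h.
  by move=> /is_derive_eq; apply; rewrite [_ *: _]mulr1 mulN1r expr2 invfM.
apply: smoothkM => //; apply: smoothkM; first exact: smoothk_cst.
by apply: smoothkM; apply: IH; exact: smoothkW.
Qed.

Lemma smoothk_sum n k I (r : seq I) (P : pred I) (f : I -> 'rV[R]_n -> R) :
  (forall i, smoothk k (f i)) -> smoothk k (fun z => \sum_(i <- r | P i) f i z).
Proof.
move=> sf; elim: r => [|i r IH].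
  rewrite (_ : (fun _ => _) = fun=> 0); first exact: smoothk_cst.
  by apply/funext => z; rewrite big_nil.
rewrite (_ : (fun _ => _) = fun z => (if P i then f i z else 0) + \sum_(i <- r | P i) f i z); last first.
  by apply/funext => z; rewrite big_cons; case: ifP; rewrite ?add0r.
by apply: smoothkD => //; case: (P i) => //; exact: smoothk_cst.
Qed.

Lemma smoothk_prod n k I (r : seq I) (f : I -> 'rV[R]_n -> R) :
  (forall i, smoothk k (f i)) -> smoothk k (fun z => \prod_(i <- r) f i z).
Proof.
move=> sf; elim: r => [|i r IH].
  rewrite (_ : (fun _ => _) = fun=> 1); first exact: smoothk_cst.
  by apply/funext => z; rewrite big_nil.
rewrite (_ : (fun _ => _) = fun z => f i z * \prod_(i <- r) f i z).
  by apply: smoothkM.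
by apply/funext => z; rewrite big_cons.
Qed.

(** Each factor 1 + r is absorbed by half of the exponent, as (1 + 2 / c) (1 + c r / 2) >= 1 + r. *)
Lemma exp_dominates (m : nat) (c : R) : 0 < c ->
  exists2 C, 0 <= C & forall r, 0 <= r -> (1 + r) ^+ m <= C * expR (c * r).
Proof.
elim: m c => [|m IH] c c0.
  exists 1 => // r r0; rewrite expr0 mul1r -expR0 ler_expR.
  by rewrite mulr_ge0// ltW.
have c2 : 0 < c / 2 by rewrite divr_gt0.
have [C C0 CP] := IH _ c2.
exists (C * (1 + 2 / c)); first by rewrite mulr_ge0// addr_ge0// divr_ge0// ltW.
move=> r r0; rewrite exprSr.
have -> : expR (c * r) = expR (c / 2 * r) * expR (c / 2 * r).
  by rewrite -expRD -mulrDl -splitr.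
rewrite mulrACA.
apply: ler_pM; [by rewrite exprn_ge0// addr_ge0|by rewrite addr_ge0|exact: CP|].
apply: (@le_trans _ _ ((1 + 2 / c) * (1 + c / 2 * r))); last first.
  by rewrite ler_wpM2l ?expR_ge1Dx// addr_ge0// divr_ge0// ltW.
have cn : c != 0 by rewrite gt_eqF.
rewrite (_ : (1 + 2 / c) * (1 + c / 2 * r) = 1 + r + (c / 2 * r + 2 / c)); last by field.
by rewrite lerDl addr_ge0//; [rewrite mulr_ge0// ltW|rewrite divr_ge0// ltW].
Qed.

Lemma horner_growth (p : {poly R}) :
  exists A : R, exists m : nat, 0 <= A /\ forall y : R, 0 <= y -> `|p.[y]| <= A * (1 + y) ^+ m.
Proof.
elim/poly_ind: p => [|p c [A [m [A0 IH]]]].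
  by exists 0, 0%N; split => // y y0; rewrite horner0 normr0 mul0r.
exists (A + `|c|), m.+1; split; first by rewrite addr_ge0.
move=> y y0; rewrite hornerMXaddC (le_trans (ler_normD _ _))// mulrDl lerD//.
  rewrite normrM exprSr mulrA ler_pM ?IH// ger0_norm//; lra.
by rewrite ler_peMr// exprn_ege1// lerDl.
Qed.

(* These functions have derivatives of the same form, whence the smoothness of
  exp (- 1 / x). *)
Definition hflat (p : {poly R}) (x : R) : R :=
  if 0 < x then p.[x^-1] * expR (- x^-1) else 0.

(** Quadratic decay at 0 is what gives difference quotients tending to 0 there, and so the
    derivative at the only delicate point. *)
Lemma hflat_sqr_le (p : {poly R}) : exists2 C, 0 <= C & forall x, `|hflat p x| <= C * x ^+ 2.
Proof.
have [A [m [A0 pA]]] := horner_growth p.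
(* The exponent is m for the growth of p plus 2 for the factor x^2 = y^(-2). *)
have [C C0 CP] := exp_dominates m.+2 (@ltr01 R).
exists (A * C); first exact: mulr_ge0.
move=> x; rewrite /hflat; case: ltP => x0; last by rewrite normr0 mulr_ge0 ?sqr_ge0 ?mulr_ge0.
have y0 : 0 < x^-1 by rewrite invr_gt0.
set y := x^-1; have -> : x = y^-1 by rewrite invrK.
rewrite normrM [`|expR _|]ger0_norm ?expR_ge0//.
apply: (@le_trans _ _ (A * (1 + y) ^+ m * expR (- y))).
  by rewrite ler_wpM2r ?expR_ge0// pA// ltW.
rewrite -!mulrA ler_wpM2l// exprVn ler_pdivlMr ?exprn_gt0//.
rewrite expRN mulrAC ler_pdivrMr ?expR_gt0//.
have := CP y (ltW y0); rewrite mul1r; apply: le_trans.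
rewrite (_ : (1 + y) ^+ m.+2 = (1 + y) ^+ m * (1 + y) ^+ 2); last by rewrite -exprD addn2.
rewrite ler_wpM2l ?exprn_ge0 ?addr_ge0 ?(ltW y0)//.
by rewrite ler_sqr ?nnegrE ?addr_ge0 ?(ltW y0)// lerDr.
Qed.

(** For x > 0 the chain rule gives x^(-2) (p - p')(1/x) exp (- 1/x), which is again of the form
    [hflat]; at 0 see [hflat_sqr_le]. *)
Lemma is_derive_hflat (p : {poly R}) (x : R) :
  is_derive x (1 : R) (hflat p) (hflat ('X^2 * (p - p^`())) x).
Proof.
have [x0|x0|x0] := ltgtP x 0.
- rewrite [X in is_derive _ _ _ X](_ : _ = 0); last by rewrite /hflat ltNge (ltW x0).
  apply: (@near_eq_is_derive _ _ _ (cst 0) (hflat p) x 1 0 _ (is_derive_cst _ _ _)).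
  near=> y; rewrite /hflat ltNge (_ : y <= 0)//=; apply: ltW.
  by near: y; exact: lt_nbhsl.
- rewrite [X in is_derive _ _ _ X](_ : _ =
    p.[x^-1] * (expR (- x^-1) * x ^- 2) + expR (- x^-1) * (p^`().[x^-1] * - x ^- 2)); last first.
    rewrite /hflat x0 hornerM hornerXn hornerD hornerN exprVn; ring.
  apply: (@near_eq_is_derive _ _ _ (fun y : R => p.[y^-1] * expR (- y^-1)) (hflat p) x 1).
    near=> y; rewrite /hflat (_ : 0 < y)//; near: y.
    exact: lt_nbhsr.
  have xn : x != 0 by rewrite gt_eqF.
  have iv : is_derive x (1 : R) (fun y : R => y^-1) (- x ^- 2).
    by have := @is_deriveV _ id x 1 1 xn (is_derive_id _ _); rewrite [_ *: _]mulr1.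
  apply: is_deriveM.
  have ivn : is_derive x (1 : R) (fun y : R => - y^-1) (x ^- 2).
    by have := is_deriveN iv; rewrite opprK.
  exact: (@is_derive1_comp _ (@expR R) (fun y : R => - y^-1) x _ _ _ ivn).
- rewrite x0 [X in is_derive _ _ _ X](_ : _ = 0); last by rewrite /hflat ltxx.
  have [C C0 CP] := hflat_sqr_le p.
  have H : (fun h : R => h^-1 *: (hflat p (h *: (1 : R) + 0) - hflat p 0)) @ (0 : R)^' --> (0 : R).
    apply/cvgrPdist_lt => e e0; near=> h.
    rewrite sub0r normrN addr0 [h *: 1]mulr1 [hflat p 0]/hflat ltxx subr0.
    have h0 : h != 0 by near: h; exact: nbhs_dnbhs_neq.
    have hn : `|h| < e / (C + 1).
      by near: h; apply: dnbhs0_lt; rewrite divr_gt0// ltr_wpDl.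
    apply: (@le_lt_trans _ _ (C * `|h|)).
      rewrite normrZ normfV ler_pdivrMl ?normr_gt0//.
      by apply: le_trans (CP h) _; rewrite -[h ^+ 2]real_normK ?num_real// expr2 mulrCA.
    apply: (@le_lt_trans _ _ ((C + 1) * `|h|)); first by rewrite ler_wpM2r// lerDl.
    by rewrite mulrC -ltr_pdivlMr// ltr_wpDl.
  split; first by apply/cvg_ex; exists 0.
  exact: cvg_lim H.
Unshelve. all: by end_near. Qed.

Lemma smoothk_hflat n k (p : {poly R}) (l : 'rV[R]_n -> R) : smoothk k l ->
  smoothk k (fun z => hflat p (l z)).
Proof.
have ch q : continuous (hflat q).
  move=> x; apply/differentiable_continuous; apply/derivable1_diffP.
  by have [] := is_derive_hflat q x.
elim: k p l => [|k IH] p l sl.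
  by move=> x; apply: continuous_comp; [exact: sl|exact: ch].
split.
  by move=> x; apply: continuous_comp; [exact: (smoothk_continuous sl)|exact: ch].
move=> i; have [_ /(_ i)[dl [dlE sdl]]] := sl.
exists (fun z => hflat ('X^2 * (p - p^`())) (l z) * dl z); split.
  by move=> x; apply: is_derive_comp1 => //; exact: is_derive_hflat.
by apply: smoothkM => //; apply: IH; exact: smoothkW.
Qed.

(* Used at the squares of coordinates. *)
Definition hbump (dl : R) (u : R) : R :=
  hflat 1 (4 * dl ^+ 2 - u) / (hflat 1 (4 * dl ^+ 2 - u) + hflat 1 (u - dl ^+ 2)).

Lemma hflat1_ge0 (x : R) : 0 <= hflat 1 x.
Proof. by rewrite /hflat; case: ifP => // _; rewrite hornerE mul1r expR_ge0. Qed.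

Lemma hflat1_gt0 (x : R) : 0 < x -> 0 < hflat 1 x.
Proof. by rewrite /hflat => ->; rewrite hornerE mul1r expR_gt0. Qed.

Lemma hflat_le0 p (x : R) : x <= 0 -> hflat p x = 0.
Proof. by rewrite /hflat ltNge => ->. Qed.

Lemma hbump_denom (dl u : R) : 0 < dl ->
  0 < hflat 1 (4 * dl ^+ 2 - u) + hflat 1 (u - dl ^+ 2).
Proof.
move=> d0; have d2 : 0 < dl ^+ 2 by rewrite exprn_gt0.
have [ud|ud] := ltP u (4 * dl ^+ 2).
  by rewrite ltr_wpDr ?hflat1_ge0// hflat1_gt0// subr_gt0.
by rewrite ltr_wpDl ?hflat1_ge0// hflat1_gt0//; lra.
Qed.

Lemma hbump_ge0 (dl u : R) : 0 < dl -> 0 <= hbump dl u.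
Proof. by move=> d0; rewrite divr_ge0 ?hflat1_ge0// ltW// hbump_denom. Qed.

Lemma hbump1 (dl u : R) : 0 < dl -> u <= dl ^+ 2 -> hbump dl u = 1.
Proof.
move=> d0 ud; have d2 : 0 < dl ^+ 2 by rewrite exprn_gt0.
rewrite /hbump (@hflat_le0 _ (u - _)) ?subr_le0// addr0 divff// gt_eqF// hflat1_gt0//; lra.
Qed.

Lemma hbump0 (dl u : R) : 4 * dl ^+ 2 <= u -> hbump dl u = 0.
Proof. by move=> ud; rewrite /hbump hflat_le0 ?mul0r// subr_le0. Qed.

Section cbump.
Variables (n : nat) (a : 'rV[R]_n) (dl : R).
Hypothesis dl0 : 0 < dl.

(** Being a product over coordinates, it is 1 on the box of half-width dl, vanishes off that of
    half-width 2 dl, and factors over R^(n + m), see [bump_row_mx]. *)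
Definition cbump (z : 'rV[R]_n) : R := \prod_(i < n) hbump dl ((z 0 i - a 0 i) ^+ 2).

Lemma bump_smooth : smooth cbump.
Proof.
apply: smoothk_smooth => k; apply: smoothk_prod => i.
have s1 : smoothk k (fun z : 'rV[R]_n => (z 0 i - a 0 i) ^+ 2).
  have s0 : smoothk k (fun z : 'rV[R]_n => z 0 i - a 0 i).
    by apply: smoothkD; [exact: smoothk_coord|exact: smoothk_cst].
  exact: (smoothkM s0 s0).
have s2 : smoothk k (fun z : 'rV[R]_n => 4 * dl ^+ 2 - (z 0 i - a 0 i) ^+ 2).
  apply: smoothkD; first exact: smoothk_cst.
  rewrite (_ : (fun _ => _) = fun z : 'rV[R]_n => -1 * (z 0 i - a 0 i) ^+ 2); last first.
    by apply/funext => z; rewrite mulN1r.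
  by apply: smoothkM => //; exact: smoothk_cst.
have s3 : smoothk k (fun z : 'rV[R]_n => (z 0 i - a 0 i) ^+ 2 - dl ^+ 2).
  by apply: smoothkD => //; exact: smoothk_cst.
rewrite /hbump; apply: smoothkM; first exact: smoothk_hflat.
apply: smoothkV; first by move=> z; rewrite gt_eqF// hbump_denom.
by apply: smoothkD; exact: smoothk_hflat.
Qed.

Lemma bump_ge0 z : 0 <= cbump z.
Proof. by apply: prodr_ge0 => i _; exact: hbump_ge0. Qed.

Lemma bump_eq1 (z : 'rV[R]_n) : (forall i, `|z 0 i - a 0 i| <= dl) -> cbump z = 1.
Proof.
move=> zd; rewrite /cbump big1// => i _; apply: hbump1 => //.
by rewrite -[_ ^+ 2]real_normK ?num_real// ler_sqr ?nnegrE// ltW.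
Qed.

Lemma bump_neq0 (z : 'rV[R]_n) i : cbump z != 0 -> `|z 0 i - a 0 i| <= 2 * dl.
Proof.
apply: contraNT; rewrite -ltNge => zd; rewrite /cbump (bigD1 i)//= hbump0 ?mul0r//.
rewrite -[leRHS]real_normK ?num_real// (_ : 4 * dl ^+ 2 = (2 * dl) ^+ 2); last by ring.
by rewrite ler_sqr ?nnegrE ?mulr_ge0// ltW.
Qed.

Definition box (r : R) : set 'rV[R]_n := [set z | forall i, `|z 0 i - a 0 i| <= r].

Lemma compact_box r : compact (box r).
Proof.
have -> : box r = [set v : 'rV[R]_n | forall i, `[a 0 i - r, a 0 i + r]%classic (v ord0 i)].
  apply/seteqP; split => z zr i; have := zr i; rewrite /= in_itv /= ler_distl.
    by [].
  by [].
by apply: (@rV_compact R n (fun i => `[a 0 i - r, a 0 i + r]%classic)) => i; exact: segment_compact.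
Qed.

Lemma closed_box r : closed (box r).
Proof. by apply: compact_closed; [exact: norm_hausdorff|exact: compact_box]. Qed.

Lemma supp_bump : supp cbump `<=` box (2 * dl).
Proof.
have cb : box (2 * dl) = closure (box (2 * dl)) by apply/closure_id; exact: closed_box.
rewrite /supp cb.
by apply: closure_subset => z /= zb i; exact: bump_neq0.
Qed.

Lemma bump_test_fun (V : set 'rV[R]_n) : box (2 * dl) `<=` V -> test_fun V cbump.
Proof.
move=> bV; split; first exact: bump_smooth.
  have cs : closed (supp cbump) by exact: closed_closure.
  exact: (subclosed_compact cs (@compact_box (2 * dl)) supp_bump).
by apply: subset_trans supp_bump bV.
Qed.

Lemma bump_continuous : continuous cbump.
Proof. by have [] := bump_smooth [::]. Qed.

End cbump.

End smooth_functions.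

(** * Gaussian wave packets as Schwartz functions *)

Section gaussian_test_functions.
Context {R : realType}.
Local Notation RM := (measurableTypeR R).

Lemma dotv_basis n (x : 'rV[R]_n) i : dotv x (basis_vec i) = x 0 i.
Proof.
rewrite /dotv (bigD1 i)//= big1 ?addr0; first by rewrite /basis_vec mxE !eqxx mulr1.
by move=> j ji; rewrite /basis_vec mxE eqxx (negbTE ji) mulr0.
Qed.

(** A class that contains the wave packets used for inversion and is stable under partial
    derivatives, so that all seminorms are bounded by induction. The free phase beta covers the sine
    and the derivatives of the cosine. *)
Inductive gauss_trig n (a : R) : ('rV[R]_n -> R) -> Prop :=
| gt_base z beta : gauss_trig a
    (fun zeta => gaussn (a *: zeta) * cos (2 * pi * dotv z zeta + beta))
| gt_add f g : gauss_trig a f -> gauss_trig a g -> gauss_trig a (fun zeta => f zeta + g zeta)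
| gt_scale c f : gauss_trig a f -> gauss_trig a (fun zeta => c * f zeta)
| gt_coord i f : gauss_trig a f -> gauss_trig a (fun zeta => zeta 0 i * f zeta).

Lemma is_derive_gaussn n (a : R) (x : 'rV[R]_n) i :
  is_derive x (basis_vec i) (fun zeta => gaussn (a *: zeta))
    (gaussn (a *: x) * (- (2 * pi * a ^+ 2) * x 0 i)).
Proof.
apply: (@is_derive_comp1 R n (@expR R) (fun zeta => - (pi * dotv (a *: zeta) (a *: zeta)))).
apply/is_derive_lineP.
pose B := - (pi * a ^+ 2) * (2 * x 0 i); pose A := - (pi * a ^+ 2) * basis_vec i 0 i.
pose C := - (pi * a ^+ 2) * dotv x x.
have h1 := is_derive_affine A B 0; have h2 := is_derive_affine 1 0 (0 : R).
have h3 := is_derive1_mul h1 h2.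
have h4 : is_derive (0 : R) (1 : R) (fun h : R => (A * h + B) * (1 * h + 0) + C) _ :=
  is_deriveD h3 (is_derive_cst C 0 (1 : R)).
rewrite (_ : (fun h => _) = (fun h : R => (A * h + B) * (1 * h + 0) + C)).
  by move: h4 => /is_derive_eq; apply; rewrite /B; ring.
apply/funext => h; rewrite !(dotvZl, dotvZr, dotvDl, dotvDr) (dotvC _ x) !dotv_basis /A /B /C.
ring.
Qed.

Lemma is_derive_cos_phase n (z x : 'rV[R]_n) beta i :
  is_derive x (basis_vec i) (fun zeta => cos (2 * pi * dotv z zeta + beta))
    (cos (2 * pi * dotv z x + (beta + pi / 2)) * (2 * pi * z 0 i)).
Proof.
rewrite addrA cosDpihalf.
apply: (@is_derive_comp1 R n (@cos R) (fun zeta => 2 * pi * dotv z zeta + beta)).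
apply/is_derive_lineP.
have := is_derive_affine (2 * pi * z 0 i) (2 * pi * dotv z x + beta) 0.
congr is_derive; apply/funext => h.
by rewrite dotvDr dotvZr dotv_basis; ring.
Qed.

Lemma gauss_trig_derive n (a : R) (f : 'rV[R]_n -> R) : gauss_trig a f -> forall i, exists df,
  (forall x, is_derive x (basis_vec i) f (df x)) /\ gauss_trig a df.
Proof.
move=> + i; elim=> [z beta|{}f g _ [df [dfE cdf]] _ [dg [dgE cdg]]|c {}f _ [df [dfE cdf]]|j {}f cf [df [dfE cdf]]].
- exists (fun x =>
    2 * pi * z 0 i * (gaussn (a *: x) * cos (2 * pi * dotv z x + (beta + pi / 2))) +
    - (2 * pi * a ^+ 2) * (x 0 i * (gaussn (a *: x) * cos (2 * pi * dotv z x + beta)))); split.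
    move=> x; have := is_deriveM (is_derive_gaussn a x i) (is_derive_cos_phase z x beta i).
    by move=> /is_derive_eq; apply; rewrite /GRing.scale/=; ring.
  apply: gt_add; apply: gt_scale; first exact: gt_base.
  by apply: gt_coord; exact: gt_base.
- exists (fun x => df x + dg x); split; last exact: gt_add.
  by move=> x; exact: is_deriveD.
- exists (fun x => c * df x); split; last exact: gt_scale.
  by move=> x; exact: is_deriveZ.
- exists (fun x : 'rV[R]_n => x 0 j * df x + basis_vec i 0 j * f x); split.
    move=> x; have := is_deriveM (is_derive_coord j x (basis_vec i)) (dfE x).
    by move=> /is_derive_eq; apply; rewrite /GRing.scale/= [f x * _]mulrC.
  by apply: gt_add; [exact: gt_coord|exact: gt_scale].
Qed.

Lemma continuous_dotv n (z : 'rV[R]_n) : continuous (dotv z).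
Proof.
apply: (@smoothk_continuous _ _ 0); apply: smoothk_sum => i.
by apply: smoothkM; [exact: smoothk_cst|exact: smoothk_coord].
Qed.

Lemma continuous_gaussn n (a : R) : continuous (fun z : 'rV[R]_n => gaussn (a *: z)).
Proof.
have c : continuous (fun z : 'rV[R]_n => - (pi * dotv (a *: z) (a *: z))).
  have -> : (fun z : 'rV[R]_n => - (pi * dotv (a *: z) (a *: z))) =
      (fun z => - (pi * a ^+ 2) * \sum_i z 0 i * z 0 i).
    by apply/funext => z; rewrite dotvZl dotvZr -/(dotv z z); ring.
  apply: (@smoothk_continuous _ _ 0); apply: smoothkM; first exact: smoothk_cst.
  by apply: smoothk_sum => i; apply: smoothkM; exact: smoothk_coord.
move=> z; apply: (@continuous_comp _ _ _ (fun z : 'rV[R]_n => - (pi * dotv (a *: z) (a *: z))) (@expR R)).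
  exact: c.
exact: continuous_expR.
Qed.

Lemma gauss_trig_continuous n (a : R) (f : 'rV[R]_n -> R) : gauss_trig a f -> continuous f.
Proof.
suff : gauss_trig a f -> smoothk 0 f by [].
elim=> [z beta|{}f g _ cf _ cg|c {}f _ cf|i {}f _ cf].
- apply: smoothkM; first exact: continuous_gaussn.
  move=> x; apply: (@continuous_comp _ _ _ (fun zeta => 2 * pi * dotv z zeta + beta) (@cos R)).
    suff : smoothk 0 (fun zeta : 'rV[R]_n => 2 * pi * dotv z zeta + beta) by exact.
    apply: smoothkD; last exact: smoothk_cst.
    by apply: smoothkM; [exact: smoothk_cst|exact: continuous_dotv].
  exact: continuous_cos.
- exact: smoothkD.
- by apply: smoothkM => //; exact: smoothk_cst.
- by apply: smoothkM => //; exact: smoothk_coord.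
Qed.

Lemma gauss_trig_decay n (a : R) (f : 'rV[R]_n -> R) : a != 0 -> gauss_trig a f ->
  forall k, exists C, forall x, (1 + enorm x ^+ 2) ^+ k * `|f x| <= C.
Proof.
move=> a0; elim=> [z beta k|{}f g _ IHf _ IHg k|c {}f _ IH k|i {}f _ IH k].
- have c0 : 0 < pi * a ^+ 2 by rewrite mulr_gt0 ?pi_gt0// exprn_even_gt0.
  have [C C0 CP] := exp_dominates k c0; exists C => x.
  apply: (@le_trans _ _ ((1 + enorm x ^+ 2) ^+ k * gaussn (a *: x))).
    rewrite ler_wpM2l ?exprn_ge0 ?addr_ge0 ?sqr_ge0// normrM ger0_norm ?gaussn_ge0//.
    by rewrite ler_piMr ?gaussn_ge0// norm_cos_le1.
  rewrite /gaussn expRN ler_pdivrMr ?expR_gt0//.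
  apply: le_trans (CP _ (sqr_ge0 _)) _.
  by rewrite dotvZl dotvZr sqr_enorm !mulrA.
- have [C CP] := IHf k; have [C' CP'] := IHg k; exists (C + C') => x.
  apply: le_trans (lerD (CP x) (CP' x)); rewrite -mulrDr ler_wpM2l ?ler_normD//.
  by rewrite exprn_ge0 ?addr_ge0 ?sqr_ge0.
- have [C CP] := IH k; exists (`|c| * C) => x.
  by rewrite normrM mulrCA ler_wpM2l.
- have [C CP] := IH k.+1; exists C => x; apply: le_trans (CP x).
  rewrite normrM (exprSr _ k) -[leRHS]mulrA ler_wpM2l ?exprn_ge0 ?addr_ge0 ?sqr_ge0//.
  rewrite ler_wpM2r//; apply: le_trans (ler_coord_enorm x i) _.
  have := sqr_ge0 (enorm x - 1); rewrite sqrrB1; have := enorm_ge0 x; lra.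
Qed.

Lemma gauss_trig_schwartz n (a : R) (f : 'rV[R]_n -> R) : a != 0 -> gauss_trig a f -> schwartz f.
Proof.
move=> a0 cf.
have H L : gauss_trig a (iter_partial L f).
  elim: L => [|i L IH] //=; have [df [dfE cdf]] := gauss_trig_derive IH i.
  rewrite (_ : (fun x => _) = df)//; apply/funext => x.
  by have [] := dfE x.
split.
  move=> L; split; first exact: gauss_trig_continuous (H L).
  by move=> i x; have [df [/(_ x)[]]] := gauss_trig_derive (H L) i.
by move=> k L; exact: gauss_trig_decay (H L) k.
Qed.

End gaussian_test_functions.

(** * Fourier inversion by mollification *)

Section dilation.
Context {R : realType}.
Local Notation RM := (measurableTypeR R).

Lemma rint_dilate n (f : 'rV[R]_n -> R) c : c != 0 ->
  rint (leb R n) (fun t => f (rvec t)) -> rint (leb R n) (fun t => f (c *: rvec t)).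
Proof.
move=> c0 fi; have mf := rint_measurable fi; apply: rintP.
  exact: measurable_Rn_dilate.
rewrite (ge0_integral_dilate (f := fun z => `|f z|%:E) c0)//.
  by rewrite lte_mul_pinfty// ?lee_fin ?invr_ge0 ?exprn_ge0//; exact: rint_lty.
by apply/measurable_EFinP; exact: measurableT_comp.
Qed.

Lemma integral_Rn_dilate n (f : 'rV[R]_n -> R) c : c != 0 ->
  rint (leb R n) (fun t => f (rvec t)) ->
  integral_Rn (fun z => f (c *: z)) = (`|c| ^+ n)^-1 * integral_Rn f.
Proof.
move=> c0 fi; have mf := rint_measurable fi.
apply: EFin_inj.
have ni : rint (leb R n) (fun t => `|f (rvec t)|) by exact: integrable_norm.
have ip : rint (leb R n) (fun t => Num.max (f (rvec t)) 0).
  apply: rint_le ni _; first exact: measurable_maxr.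
  by move=> x /=; have [_|] := lerP (f (rvec x)) 0; rewrite ?normr0.
have im : rint (leb R n) (fun t => Num.max (- f (rvec t)) 0).
  apply: rint_le ni _.
    by apply: measurable_maxr => //; exact: measurableT_comp.
  by move=> x /=; have [_|] := lerP (- f (rvec x)) 0; rewrite ?normr0// normrN.
rewrite EFinM !EFin_Rintegral//; last exact: rint_dilate.
rewrite [LHS]integral_posneg [in RHS]integral_posneg.
rewrite (ge0_integral_dilate (f := fun x => (Num.max (f x) 0)%:E) c0)//; last 2 first.
- exact: measurable_max0.
- by move=> x; rewrite lee_fin le_max lexx orbT.
rewrite (ge0_integral_dilate (f := fun x => (Num.max (- f x) 0)%:E) c0)//; last 2 first.
- by apply: measurable_max0; exact: measurableT_comp.
- by move=> x; rewrite lee_fin le_max lexx orbT.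
by rewrite -!EFin_Rintegral// -!EFinM -!EFinB mulrBr.
Qed.

Lemma rint_gaussn_cos n (xi : 'rV[R]_n) beta :
  rint (leb R n) (fun t => gaussn (rvec t) * cos (2 * pi * dotv (rvec t) xi + beta)).
Proof.
have := rintMbd (rint_gaussn n) (measurable_cos_phase xi beta) (fun=> norm_cos_le1 _).
by apply: eq_integrable => // t _ /=; rewrite mulrC.
Qed.

Lemma fourier_gaussn_scaled n (a : R) (xi : 'rV[R]_n) beta : a != 0 ->
  rint (leb R n) (fun t => gaussn (a *: rvec t) * cos (2 * pi * dotv (rvec t) xi + beta)) /\
  integral_Rn (fun zeta => gaussn (a *: zeta) * cos (2 * pi * dotv zeta xi + beta)) =
  (`|a| ^+ n)^-1 * (gaussn (a^-1 *: xi) * cos beta).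
Proof.
move=> a0; rewrite -fourier_gaussn -(integral_Rn_dilate a0); last exact: rint_gaussn_cos.
have E zeta : dotv (a *: zeta) (a^-1 *: xi) = dotv zeta xi.
  by rewrite dotvZl dotvZr mulrA divff// mul1r.
split; last by apply: eq_integral_Rn => zeta; rewrite E.
have := rint_dilate (f := fun w => gaussn w * cos (2 * pi * dotv w (a^-1 *: xi) + beta)) a0
  (rint_gaussn_cos (a^-1 *: xi) beta).
by apply: eq_integrable => // t _ /=; rewrite E.
Qed.

End dilation.

Section inversion.
Context {R : realType}.
Local Notation RM := (measurableTypeR R).
Variables (n : nat) (G : 'rV[R]_n -> R) (M : R).
Hypothesis mG : measurable_Rn G.
Hypothesis GM : forall z, `|G z| <= M.
Variables h1 h2 : 'rV[R]_n -> R.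
Hypothesis mh1 : measurable_Rn h1.
Hypothesis mh2 : measurable_Rn h2.
Hypothesis hF : has_fourier (fun_distribution G) h1 h2.

(** The phase 0 gives a cosine packet and - pi / 2 a sine packet. *)
Definition gcos (a : R) (z : 'rV[R]_n) (beta : R) (zeta : 'rV[R]_n) : R :=
  gaussn (a *: zeta) * cos (2 * pi * dotv z zeta + beta).

(** Convolution of G with the Gaussian of width a and mass 1, after rescaling the variable. *)
Definition mollify (a : R) (z : 'rV[R]_n) : R :=
  integral_Rn (fun u => G (z + a *: u) * gaussn u).

Section scale.
Variable a : R.
Hypothesis a0 : 0 < a.

Let an0 : a != 0. Proof. by rewrite gt_eqF. Qed.

Let c := (`|a| ^+ n)^-1.

Let phaseD (zeta x z : 'rV[R]_n) :
  2 * pi * dotv zeta (x + z) = 2 * pi * dotv zeta x + 2 * pi * dotv z zeta.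
Proof. by rewrite dotvDr (dotvC z) -mulrDr. Qed.

Let phaseB (zeta x z : 'rV[R]_n) :
  2 * pi * dotv zeta (x - z) = 2 * pi * dotv zeta x - 2 * pi * dotv z zeta.
Proof. by rewrite dotvBr (dotvC z) -mulrBr. Qed.

(** A real packet transforms into Gaussians around both z and - z. [fourier_re] of the cosine packet
    is half their sum and [fourier_im] of the sine packet half the one at - z minus the one at z, so
    subtracting isolates z. *)
Lemma fourier_re_gcos z x :
  fourier_re (gcos a z 0) x =
  1 / 2 * (c * (gaussn (a^-1 *: (x + z)) + gaussn (a^-1 *: (x - z)))).
Proof.
have [r1 e1] := fourier_gaussn_scaled (x + z) 0 an0.
have [r2 e2] := fourier_gaussn_scaled (x - z) 0 an0.
rewrite /fourier_re (@eq_integral_Rn _ _ _ (fun zeta => 1 / 2 *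
  (gaussn (a *: zeta) * cos (2 * pi * dotv zeta (x + z) + 0) +
   gaussn (a *: zeta) * cos (2 * pi * dotv zeta (x - z) + 0)))); last first.
  by move=> zeta; rewrite /gcos !addr0 phaseD phaseB cosD cosB; field.
rewrite integral_RnZ; last exact: rintD.
by rewrite integral_RnD// e1 e2 cos0 !mulr1 -mulrDr.
Qed.

Lemma fourier_im_gsin z x :
  fourier_im (gcos a z (- (pi / 2))) x =
  1 / 2 * (c * (gaussn (a^-1 *: (x + z)) - gaussn (a^-1 *: (x - z)))).
Proof.
have [r1 e1] := fourier_gaussn_scaled (x + z) 0 an0.
have [r2 e2] := fourier_gaussn_scaled (x - z) 0 an0.
rewrite /fourier_im (@eq_integral_Rn _ _ _ (fun zeta => - (1 / 2) *
  (gaussn (a *: zeta) * cos (2 * pi * dotv zeta (x + z) + 0) -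
   gaussn (a *: zeta) * cos (2 * pi * dotv zeta (x - z) + 0)))); last first.
  move=> zeta; rewrite /gcos !addr0 phaseD phaseB cosD cosB.
  by rewrite cosN sinN cos_pihalf sin_pihalf cosD; field.
rewrite integral_RnZ; last exact: rintB.
by rewrite integral_RnB// e1 e2 cos0 !mulr1 -mulrBr mulNr opprK.
Qed.

Let rint_Gg z : rint (leb R n) (fun t => G (rvec t) * gaussn (a^-1 *: (rvec t + z))).
Proof.
have ai : a^-1 != 0 by rewrite invr_neq0.
have h := rint_translate (f := fun w => gaussn (a^-1 *: w)) z
  (rint_dilate (f := @gaussn R n) ai (rint_gaussn n)).
exact: (rintMbd h mG (fun t => GM (rvec t))).
Qed.

(** Pairing G with the Gaussian around z is pairing it with the two transforms above, and
    [has_fourier] moves these pairings to h1 and h2. *)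
Lemma mollify_inversion z :
  mollify a z = integral_Rn (fun zeta => h1 zeta * gcos a z 0 zeta) -
                integral_Rn (fun zeta => h2 zeta * gcos a z (- (pi / 2)) zeta).
Proof.
have s1 : schwartz (gcos a z 0) by apply: (gauss_trig_schwartz an0); exact: gt_base.
have s2 : schwartz (gcos a z (- (pi / 2))) by apply: (gauss_trig_schwartz an0); exact: gt_base.
rewrite -(hF s1).1 -(hF s2).2 /fun_distribution.
have ri1 : rint (leb R n) (fun t => G (rvec t) * fourier_re (gcos a z 0) (rvec t)).
  have h := rintZ (1 / 2 * c) (rintD (rint_Gg z) (rint_Gg (- z))).
  apply: eq_integrable h => // t _ /=; rewrite fourier_re_gcos.
  by congr EFin; ring.
have ri2 : rint (leb R n) (fun t => G (rvec t) * fourier_im (gcos a z (- (pi / 2))) (rvec t)).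
  have h := rintZ (1 / 2 * c) (rintB (rint_Gg z) (rint_Gg (- z))).
  apply: eq_integrable h => // t _ /=; rewrite fourier_im_gsin.
  by congr EFin; ring.
rewrite -integral_RnB//.
transitivity (integral_Rn (fun x => c * (G x * gaussn (a^-1 *: (x - z))))); last first.
  by apply: eq_integral_Rn => x; rewrite fourier_re_gcos fourier_im_gsin; lra.
rewrite integral_RnZ; last exact: rint_Gg.
rewrite -(@integral_Rn_translate _ _ (fun x => G x * gaussn (a^-1 *: (x - z))) z); last first.
  exact: rint_measurable (rint_Gg (- z)).
have := @integral_Rn_dilate R n (fun u => G (z + u) * gaussn (a^-1 *: u)) a an0.
move=> /(_ _)/wrap[].
  have := rint_translate (f := fun w => G w * gaussn (a^-1 *: (w - z))) z (rint_Gg (- z)).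
  by apply: eq_integrable => // t _ /=; rewrite addrK addrC.
rewrite /c (_ : integral_Rn (fun x => G (x + z) * gaussn (a^-1 *: (x + z - z))) =
  integral_Rn (fun u => G (z + u) * gaussn (a^-1 *: u))); last first.
  by apply: eq_integral_Rn => x; rewrite addrK addrC.
move=> <-; apply: eq_integral_Rn => u.
by rewrite scalerA mulVf// scale1r.
Qed.

End scale.

(** Dominated convergence with majorant M times the Gaussian, along the widths 1 / (m + 1). *)
Lemma mollify_cvg z : {for z, continuous G} ->
  mollify m.+1%:R^-1 z @[m --> \oo] --> G z.
Proof.
move=> cG.
have mg : measurable_Rn (fun u : 'rV[R]_n => G z * gaussn u).
  by apply: measurable_funM => //; exact: measurable_gaussn.
have mgm m : measurable_Rn (fun u => G (z + m.+1%:R^-1 *: u) * gaussn u).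
  apply: measurable_funM; last exact: measurable_gaussn.
  apply: eq_measurable_fun (measurable_Rn_dilate m.+1%:R^-1 (measurable_Rn_translate z mG)) => t _.
  by rewrite addrC.
have ri : rint (leb R n) (fun t => M * gaussn (rvec t)).
  by apply: rintZ; exact: rint_gaussn.
have bd x u : `|G x * gaussn u| <= M * gaussn u.
  by rewrite normrM [`|gaussn u|]ger0_norm ?gaussn_ge0// ler_wpM2r ?gaussn_ge0.
have rim m : rint (leb R n) (fun t => G (z + m.+1%:R^-1 *: rvec t) * gaussn (rvec t)).
  by apply: rint_le (mgm m) ri _ => t; exact: bd.
have rig : rint (leb R n) (fun t => G z * gaussn (rvec t)).
  by apply: rintZ; exact: rint_gaussn.
have [] := @dominated_convergence _ _ R (leb R n) setT measurableT
  (fun m t => (G (z + m.+1%:R^-1 *: rvec t) * gaussn (rvec t))%:E)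
  (fun t => (G z * gaussn (rvec t))%:E)
  (fun t => (M * gaussn (rvec t))%:E).
- by move=> m; apply/measurable_EFinP; exact: mgm.
- by apply/measurable_EFinP; exact: mg.
- apply: aeW => t _; apply: cvg_EFin; first by apply: nearW.
  apply: cvgM; last exact: cvg_cst.
  apply: (continuous_cvg _ cG).
  rewrite -[X in _ --> X]addr0; apply: cvgD; first exact: cvg_cst.
  rewrite -[X in _ --> X](scale0r (rvec t)); apply: cvgZr_tmp.
  exact: cvg_harmonic.
- exact: ri.
- by apply: aeW => t m _; rewrite lee_fin; exact: bd.
move=> _ _ H.
have E : integral_Rn (fun u : 'rV[R]_n => G z * gaussn u) = G z.
  by rewrite integral_RnZ ?integral_gaussn ?mulr1//; exact: rint_gaussn.
have F : (\int[leb R n]_t (G z * gaussn (rvec t))%:E = (G z)%:E)%E.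
  by rewrite -EFin_Rintegral// -[in RHS]E.
by move: H; rewrite F => /fine_cvg.
Qed.

End inversion.

(** * The regular part of the energy *)

Section product_split.
Context {R : realType}.
Local Notation RM := (measurableTypeR R).
Local Notation mu := (@lebesgue_measure R).

Lemma lsubmx_row_mx1 n m (x : R) (v : 'rV[R]_(n + m)) :
  lsubmx (row_mx (x%:M : 'M[R]_1) v : 'rV[R]_(1 + n + m)) = row_mx (x%:M : 'M[R]_1) (lsubmx v).
Proof.
apply/rowP => i; rewrite !mxE; case: splitP => j /= ij; case: splitP => k /= ik.
- by rewrite !mxE !ord1.
- by have := ltn_ord j; rewrite -ij ik.
- by have := ltn_ord k; rewrite -ik ij.
- by rewrite mxE; congr (v _ _); apply: val_inj => /=; move: ij; rewrite ik => -[].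
Qed.

Lemma rsubmx_row_mx1 n m (x : R) (v : 'rV[R]_(n + m)) :
  rsubmx (row_mx (x%:M : 'M[R]_1) v : 'rV[R]_(1 + n + m)) = rsubmx v.
Proof.
apply/rowP => i; rewrite !mxE; case: splitP => j /= ij.
  by have := ltn_ord j; rewrite -ij.
by congr (v _ _); apply: val_inj => /=; move: ij => -[].
Qed.

Lemma measurable_Rn_lsubmx n m (f : 'rV[R]_n -> R) : measurable_Rn f ->
  measurable_Rn (fun z : 'rV[R]_(n + m) => f (lsubmx z)).
Proof.
move=> mf; apply: (measurable_comp_rvec mf) => i.
apply: (eq_measurable_fun (fun t : (n + m).-tuple RM => rvec t 0 (lshift m i))).
  by move=> t _; rewrite [RHS]mxE.
exact: measurable_rvec_coord.
Qed.

Lemma measurable_Rn_rsubmx n m (f : 'rV[R]_m -> R) : measurable_Rn f ->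
  measurable_Rn (fun z : 'rV[R]_(n + m) => f (rsubmx z)).
Proof.
move=> mf; apply: (measurable_comp_rvec mf) => i.
apply: (eq_measurable_fun (fun t : (n + m).-tuple RM => rvec t 0 (rshift n i))).
  by move=> t _; rewrite [RHS]mxE.
exact: measurable_rvec_coord.
Qed.

Lemma ge0_integral_split n m (f : 'rV[R]_n -> R) (g : 'rV[R]_m -> R) :
  measurable_Rn f -> measurable_Rn g -> (forall x, 0 <= f x) -> (forall x, 0 <= g x) ->
  (\int[leb R (n + m)]_t (f (lsubmx (rvec t)) * g (rsubmx (rvec t)))%:E =
   (\int[leb R n]_t (f (rvec t))%:E) * \int[leb R m]_t (g (rvec t))%:E)%E.
Proof.
move=> mf mg f0 g0; elim: n f mf f0 => [|n IH] f mf f0.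
  rewrite integral_leb0 -ge0_integralZl_EFin//.
  - apply: eq_integral => t _; rewrite -EFinM; congr (_ * _)%:E.
      by congr f; apply/rowP => -[].
    congr g; apply/rowP => i; rewrite mxE; congr (rvec t _ _); exact: val_inj.
  - by move=> x _; rewrite lee_fin.
  - exact/measurable_EFinP.
have mF : mRn (fun z : 'rV[R]_(1 + (n + m)) =>
    (f (lsubmx (z : 'rV_(1 + n + m))) * g (rsubmx (z : 'rV_(1 + n + m))))%:E).
  apply/measurable_EFinP; apply: measurable_funM.
    exact: (@measurable_Rn_lsubmx n.+1 m f mf).
  exact: (@measurable_Rn_rsubmx n.+1 m g mg).
have mfE : mRn (fun z : 'rV[R]_(1 + n) => (f z)%:E) by exact/measurable_EFinP.
transitivity (\int[mu]_x \int[leb R (n + m)]_t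
    (f (row_mx (x%:M : 'M[R]_1) (lsubmx (rvec t))) * g (rsubmx (rvec t)))%:E)%E.
  apply: etrans (ge0_integral_rV1 mF _) _.
    by move=> z; rewrite lee_fin mulr_ge0.
  apply: eq_integral => x _; apply: eq_integral => t _.
  by rewrite lsubmx_row_mx1 rsubmx_row_mx1.
transitivity (\int[mu]_x ((\int[leb R n]_t (f (row_mx (x%:M : 'M[R]_1) (rvec t)))%:E) *
    \int[leb R m]_t (g (rvec t))%:E))%E.
  apply: eq_integral => x _.
  rewrite (IH (fun v => f (row_mx (x%:M : 'M[R]_1) v)))//.
  by apply/measurable_EFinP; exact: (mRn_row1 x mfE).
rewrite ge0_integralZr//.
- by rewrite -(ge0_integral_rV1 mfE)// => z; rewrite lee_fin.
- by apply: (measurable_integral_rV1 mfE) => z; rewrite lee_fin.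
- by move=> x _; apply: integral_ge0 => t _; rewrite lee_fin.
- by apply: integral_ge0 => t _; rewrite lee_fin.
Qed.

Lemma rint_split n m (f : 'rV[R]_n -> R) (g : 'rV[R]_m -> R) :
  (forall x, 0 <= f x) -> (forall x, 0 <= g x) ->
  rint (leb R n) (fun t => f (rvec t)) -> rint (leb R m) (fun t => g (rvec t)) ->
  rint (leb R (n + m)) (fun t => f (lsubmx (rvec t)) * g (rsubmx (rvec t))) /\
  integral_Rn (fun z : 'rV[R]_(n + m) => f (lsubmx z) * g (rsubmx z)) =
    integral_Rn f * integral_Rn g.
Proof.
move=> f0 g0 fi gi; have mf := rint_measurable fi; have mg := rint_measurable gi.
have E := ge0_integral_split mf mg f0 g0.
have E' : (\int[leb R (n + m)]_t (f (lsubmx (rvec t)) * g (rsubmx (rvec t)))%:E =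
    (integral_Rn f * integral_Rn g)%:E)%E.
  by rewrite E EFinM !EFin_Rintegral.
split; last by rewrite /integral_Rn /Rintegral E'.
apply: rintP.
  by apply: measurable_funM; [exact: measurable_Rn_lsubmx|exact: measurable_Rn_rsubmx].
under eq_integral do rewrite ger0_norm ?mulr_ge0//.
by rewrite E' ltry.
Qed.

Lemma dotv_row_mx2 n m (x : 'rV[R]_n) (y : 'rV[R]_m) (z : 'rV[R]_(n + m)) :
  dotv (row_mx x y) z = dotv x (lsubmx z) + dotv y (rsubmx z).
Proof.
rewrite /dotv big_split_ord/=; congr (_ + _); apply: eq_bigr => i _.
  by rewrite row_mxEl mxE.
by rewrite row_mxEr mxE.
Qed.

Lemma sqr_enorm_split n m (z : 'rV[R]_(n + m)) :
  enorm z ^+ 2 = enorm (lsubmx z) ^+ 2 + enorm (rsubmx z) ^+ 2.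
Proof. by rewrite !sqr_enorm -[in LHS](hsubmxK z) dotv_row_mx2 hsubmxK. Qed.

End product_split.

(** * Energy of a kernel in a Sobolev space *)

Section kernel_energy.
Context {R : realType}.
Local Notation RM := (measurableTypeR R).
Variables (d : nat) (s : R) (G : 'rV[R]_(d + d) -> R) (M : R).
Hypothesis ds : d%:R < s.
Hypothesis mG : measurable_Rn G.
Hypothesis GM : forall z, `|G z| <= M.
Variables h1 h2 : 'rV[R]_(d + d) -> R.
Hypothesis mh1 : measurable_Rn h1.
Hypothesis mh2 : measurable_Rn h2.
Hypothesis hF : has_fourier (fun_distribution G) h1 h2.
Let hw (z : 'rV[R]_(d + d)) := (1 + enorm z ^+ 2) `^ s * (h1 z ^+ 2 + h2 z ^+ 2).
Hypothesis hi : rint (leb R (d + d)) (fun t => hw (rvec t)).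

Let s0 : 0 < s. Proof. by apply: le_lt_trans ds. Qed.

Let wt (z : 'rV[R]_(d + d)) := (1 + enorm z ^+ 2) `^ s.

Let base_ge1 k (z : 'rV[R]_k) : 1 <= 1 + enorm z ^+ 2.
Proof. by rewrite lerDl sqr_ge0. Qed.

Let wt_ge1 z : 1 <= wt z.
Proof. by rewrite -[leLHS](powRr0 (1 + enorm z ^+ 2)) ler_powR ?base_ge1// ltW. Qed.

(** Cancels the two factors (2 pi)^(- s) coming from [swt_ge]. *)
Local Notation K0 := ((2 * pi) `^ (2 * s)).

Let K0_gt0 : 0 < K0. Proof. by rewrite powR_gt0// mulr_gt0// pi_gt0. Qed.

Let swt2 (z : 'rV[R]_(d + d)) := swt s (lsubmx z) * swt s (rsubmx z).

Let weights_aux (p u v w r : R) : 0 < p -> 0 < u -> 0 < v -> 0 <= r -> u <= w -> v <= w ->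
  1 <= p `^ (2 * r) * w `^ r * (p `^ (- r) * u `^ (- (r / 2)) * (p `^ (- r) * v `^ (- (r / 2)))).
Proof.
move=> p0 u0 v0 r0 uw vw; have w0 : 0 < w by exact: lt_le_trans uw.
rewrite !powRN.
have -> : p `^ (2 * r) = p `^ r * p `^ r.
  rewrite -powRD; first by congr (_ `^ _); ring.
  by rewrite (gt_eqF p0) implybT.
have -> : w `^ r = w `^ (r / 2) * w `^ (r / 2).
  rewrite -powRD; first by congr (_ `^ _); field.
  by rewrite (gt_eqF w0) implybT.
have r2 : 0 <= r / 2 by rewrite divr_ge0.
have hu : u `^ (r / 2) <= w `^ (r / 2) by rewrite ge0_ler_powR// nnegrE ltW.
have hv : v `^ (r / 2) <= w `^ (r / 2) by rewrite ge0_ler_powR// nnegrE ltW.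
have := powR_gt0 r p0; have := powR_gt0 (r / 2) u0; have := powR_gt0 (r / 2) v0.
move: hu hv; move: (p `^ r) (u `^ _) (v `^ _) (w `^ _) => P A B W uW vW B0 A0 P0.
rewrite (_ : _ * _ * (_ * _) = (W / A) * (W / B)); last first.
  by field; rewrite !gt_eqF.
by rewrite -[leLHS]mulr1; apply: ler_pM; rewrite // ler_pdivlMr// mul1r.
Qed.

(** For z = (xi, eta), both 1 + |xi|^2 and 1 + |eta|^2 are at most 1 + |z|^2. Hence the Sobolev
    weight of order s on R^(2d) dominates 1 / (w(xi) w(eta)) up to [K0]. *)
Let weights z : 1 <= K0 * wt z * swt2 z.
Proof.
have b0 k (y : 'rV[R]_k) : 0 < 1 + enorm y ^+ 2 by exact: lt_le_trans (base_ge1 y).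
have p0 : 0 < 2 * pi :> R by rewrite mulr_gt0// pi_gt0.
pose A := (2 * pi) `^ (- s) * (1 + enorm (lsubmx z) ^+ 2) `^ (- (s / 2)).
pose B := (2 * pi) `^ (- s) * (1 + enorm (rsubmx z) ^+ 2) `^ (- (s / 2)).
have A0 : 0 <= A by rewrite mulr_ge0// powR_ge0.
have B0 : 0 <= B by rewrite mulr_ge0// powR_ge0.
apply: (@le_trans _ _ (K0 * wt z * (A * B))); last first.
  apply: ler_wpM2l; first by rewrite mulr_ge0 ?powR_ge0.
  by apply: ler_pM; [exact: A0|exact: B0|exact: swt_ge|exact: swt_ge].
apply: weights_aux => //; [exact: ltW| |]; rewrite lerD2l sqr_enorm_split.
  by rewrite lerDl sqr_ge0.
by rewrite lerDr sqr_ge0.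
Qed.

(** AM-GM with weight t p, followed by 1 / p <= w. It is applied with p the Sobolev weight and w the
    product of two spectral weights. *)
Let amgm (h c p w t : R) : 0 < t -> 0 < p -> 1 <= p * w ->
  `|h * c| <= 1 / 2 * (t * (p * h ^+ 2) + t^-1 * (w * c ^+ 2)).
Proof.
move=> t0 p0 pw.
have sq : 0 <= (t * p * `|h| - `|c|) ^+ 2 by exact: sqr_ge0.
have tp : 0 < t * p by rewrite mulr_gt0.
have h1' : 2 * `|h * c| <= (t * p) * h ^+ 2 + c ^+ 2 / (t * p).
  rewrite -(ler_pM2l tp) mulrDr [t * p * (c ^+ 2 / _)]mulrCA divff ?gt_eqF// mulr1.
  rewrite normrM -[h ^+ 2]real_normK ?num_real// -[c ^+ 2]real_normK ?num_real//.
  move: sq; move: (t * p) `|h| `|c| => a b e; rewrite sqrrB !expr2; lra.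
have h2' : c ^+ 2 / (t * p) <= t^-1 * (w * c ^+ 2).
  rewrite invfM mulrCA ler_wpM2l ?invr_ge0 ?(ltW t0)// mulrC ler_wpM2r ?sqr_ge0//.
  by rewrite -[p^-1]mul1r ler_pdivrMr// mulrC.
have : 2 * `|h * c| <= t * (p * h ^+ 2) + t^-1 * (w * c ^+ 2).
  by apply: le_trans h1' _; rewrite mulrA lerD2l.
lra.
Qed.

Section points.
Variables (N : nat) (q : 'I_N -> R) (x : 'I_N -> 'rV[R]_d).
Hypothesis cpi : rint (leb R d) (fun t => cpow q x (rvec t) * swt s (rvec t)).

Let I := integral_Rn (fun xi => cpow q x xi * swt s xi).
Let H := integral_Rn hw.

(** [Cz] and [Sz] are the real and imaginary parts of S(xi) S(eta), neither factor conjugated since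
    the pair (x_j, x_k) has phase x_j.xi + x_k.eta. The modulus squared factors, see [CS]. *)
Let Cz (z : 'rV[R]_(d + d)) :=
  ccos q x (lsubmx z) * ccos q x (rsubmx z) - csin q x (lsubmx z) * csin q x (rsubmx z).
Let Sz (z : 'rV[R]_(d + d)) :=
  csin q x (lsubmx z) * ccos q x (rsubmx z) + ccos q x (lsubmx z) * csin q x (rsubmx z).

Let CS z : Cz z ^+ 2 + Sz z ^+ 2 = cpow q x (lsubmx z) * cpow q x (rsubmx z).
Proof. by rewrite /Cz /Sz /cpow; ring. Qed.

Let zz j k : 'rV[R]_(d + d) := row_mx (x j) (x k).

Let sum_cos z : \sum_j \sum_k q j * q k * cos (2 * pi * dotv (zz j k) z) = Cz z.
Proof.
rewrite /Cz /ccos /csin !big_distrlr/= -sumrB; apply: eq_bigr => j _.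
rewrite -sumrB; apply: eq_bigr => k _.
by rewrite dotv_row_mx2 [2 * pi * (_ + _)]mulrDr cosD; ring.
Qed.

Let sum_sin z : \sum_j \sum_k q j * q k * sin (2 * pi * dotv (zz j k) z) = Sz z.
Proof.
rewrite /Sz /ccos /csin !big_distrlr/= -big_split; apply: eq_bigr => j _.
rewrite -big_split; apply: eq_bigr => k _.
by rewrite dotv_row_mx2 [2 * pi * (_ + _)]mulrDr sinD /=; ring.
Qed.

Let rint_h (h : 'rV[R]_(d + d) -> R) a z beta : a != 0 -> measurable_Rn h ->
  (forall z, h z ^+ 2 <= hw z) ->
  rint (leb R (d + d)) (fun t => h (rvec t) * gcos a z beta (rvec t)).
Proof.
move=> a0 mh hh.
apply: (rint_le (g := fun t => hw (rvec t) + gaussn (a *: rvec t))).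
- apply: measurable_funM => //; apply: measurable_funM.
    exact: (measurable_Rn_dilate a (@measurable_gaussn _ _)).
  apply: (measurableT_comp measurable_cos); apply: measurable_funD => //.
  by apply: measurable_phase2 => // i; exact: measurable_rvec_coord.
- apply: rintD => //; exact: (rint_dilate (f := @gaussn R _) a0 (rint_gaussn _)).
move=> t; set y := rvec t.
have g0 := gaussn_ge0 (a *: y).
have g1 : gaussn (a *: y) <= 1.
  by rewrite /gaussn -expR0 ler_expR oppr_le0 mulr_ge0 ?pi_ge0 ?dotv_ge0.
have := hh y; have c1 := norm_cos_le1 (2 * pi * dotv z y + beta).
rewrite /gcos !normrM [`|gaussn _|]ger0_norm// -[h y ^+ 2]real_normK ?num_real// => hy.
apply: (@le_trans _ _ (`|h y| * gaussn (a *: y))).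
  by rewrite ler_wpM2l// ler_piMr.
apply: (@le_trans _ _ (`|h y| ^+ 2 + gaussn (a *: y))); last by rewrite lerD2r.
move: (`|h y|) (gaussn _) g0 g1 (normr_ge0 (h y)) => u g g0 g1 u0.
have := sqr_ge0 (u - g); have : g * g <= g by rewrite ler_piMr.
have : 0 <= u * g by rewrite mulr_ge0.
rewrite sqrrB !expr2; lra.
Qed.

(** Inversion writes the mollified energy as the integral of h1 and h2 against S(xi) S(eta) and a
    Gaussian cutoff. The cutoff is at most 1, so pointwise AM-GM gives a bound uniform in a. *)
Lemma mollify_energy a t : 0 < a -> 0 < t ->
  - \sum_j \sum_k q j * q k * mollify G a (zz j k) <= 1 / 2 * (t * (K0 * H) + t^-1 * I ^+ 2).
Proof.
move=> a0 t0; have an0 : a != 0 by rewrite gt_eqF.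
have hh1 z : h1 z ^+ 2 <= hw z.
  apply: (@le_trans _ _ (1 * (h1 z ^+ 2 + h2 z ^+ 2))); first by rewrite mul1r lerDl sqr_ge0.
  by rewrite ler_wpM2r ?addr_ge0 ?sqr_ge0//; exact: wt_ge1.
have hh2 z : h2 z ^+ 2 <= hw z.
  apply: (@le_trans _ _ (1 * (h1 z ^+ 2 + h2 z ^+ 2))); first by rewrite mul1r lerDr sqr_ge0.
  by rewrite ler_wpM2r ?addr_ge0 ?sqr_ge0//; exact: wt_ge1.
have r1 z := @rint_h h1 a z 0 an0 mh1 hh1.
have r2 z := @rint_h h2 a z (- (pi / 2)) an0 mh2 hh2.
pose F (z : 'rV[R]_(d + d)) := \sum_j \sum_k (- (q j * q k)) *
  (h1 z * gcos a (zz j k) 0 z - h2 z * gcos a (zz j k) (- (pi / 2)) z).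
have rF : rint (leb R (d + d)) (fun t => F (rvec t)).
  by apply: rint_sum => j _; apply: rint_sum => k _; apply: rintZ; apply: rintB.
have -> : - (\sum_j \sum_k q j * q k * mollify G a (zz j k)) = integral_Rn F.
  rewrite integral_Rn_sum; last first.
    by move=> j _; apply: rint_sum => k _; apply: rintZ; apply: rintB.
  rewrite -sumrN; apply: eq_bigr => j _.
  rewrite integral_Rn_sum; last by move=> k _; apply: rintZ; apply: rintB.
  rewrite -sumrN; apply: eq_bigr => k _.
  rewrite integral_RnZ; last exact: rintB.
  by rewrite integral_RnB// (mollify_inversion mG GM hF a0) mulNr.
pose f (y : 'rV[R]_d) := cpow q x y * swt s y.
have f0 y : 0 <= f y by rewrite mulr_ge0 ?cpow_ge0// (swt_ge0 ds).
have [rp ip] := rint_split f0 f0 cpi cpi.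
pose B (z : 'rV[R]_(d + d)) := 1 / 2 * (t * (K0 * hw z) + t^-1 * (f (lsubmx z) * f (rsubmx z))).
have -> : 1 / 2 * (t * (K0 * H) + t^-1 * I ^+ 2) = integral_Rn B.
  rewrite /B integral_RnZ; last by apply: rintD; apply: rintZ => //; exact: rintZ.
  rewrite integral_RnD; [|by apply: rintZ; exact: rintZ|exact: rintZ].
  by rewrite !integral_RnZ ?ip//; exact: rintZ.
apply: le_integral_Rn => //.
  by apply: rintZ; apply: rintD; apply: rintZ => //; exact: rintZ.
move=> z.
have FE : F z = - gaussn (a *: z) * (h1 z * Cz z - h2 z * Sz z).
  rewrite -sum_cos -sum_sin /F !mulr_sumr -sumrB mulr_sumr; apply: eq_bigr => j _.
  rewrite !mulr_sumr -sumrB mulr_sumr; apply: eq_bigr => k _.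
  rewrite /gcos addr0 [cos (_ - _)]cosB cos_pihalf sin_pihalf; ring.
have g0 := gaussn_ge0 (a *: z).
have g1 : gaussn (a *: z) <= 1.
  by rewrite /gaussn -expR0 ler_expR oppr_le0 mulr_ge0 ?pi_ge0 ?dotv_ge0.
have p0 : 0 < K0 * wt z by rewrite mulr_gt0// (lt_le_trans _ (wt_ge1 z)).
have e1 := @amgm (h1 z) (Cz z) _ _ t t0 p0 (weights z).
have e2 := @amgm (h2 z) (Sz z) _ _ t t0 p0 (weights z).
apply: (@le_trans _ _ (`|h1 z * Cz z| + `|h2 z * Sz z|)).
  rewrite FE; apply: le_trans (ler_norm _) _; rewrite normrM normrN [`|gaussn _|]ger0_norm//.
  by apply: le_trans (ler_normB _ _); rewrite ler_piMl.
apply: le_trans (lerD e1 e2) _.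
rewrite /B /f (_ : cpow q x (lsubmx z) * _ * _ =
  (cpow q x (lsubmx z) * cpow q x (rsubmx z)) * swt2 z); last by rewrite /swt2; ring.
rewrite -CS /hw -/(wt z) le_eqVlt; apply/orP; left; apply/eqP.
by move: K0 (t^-1) (wt z) => k t' w; field.
Qed.

Let cvg_sumr k (u : 'I_k -> nat -> R) (l : 'I_k -> R) :
  (forall i, u i m @[m --> \oo] --> l i) ->
  \sum_i u i m @[m --> \oo] --> \sum_i l i.
Proof.
elim: k u l => [|k IH] u l ul.
  by rewrite big_ord0; under eq_fun do rewrite big_ord0; exact: cvg_cst.
rewrite big_ord_recl; under eq_fun do rewrite big_ord_recl.
by apply: cvgD; [exact: ul|apply: IH => i; exact: ul].
Qed.

(** The uniform bound passes to the limit of vanishing width, by continuity of G at the pairs of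
    points. *)
Lemma kernel_energy :
  (forall j k, {for zz j k, continuous G}) ->
  - \sum_j \sum_k q j * q k * G (zz j k) <= (K0 * H + 1) / 2 * I + K0 * H / 2.
Proof.
move=> cG.
have I0 : 0 <= I.
  by apply: integral_Rn_ge0 => y; rewrite mulr_ge0 ?cpow_ge0// (swt_ge0 ds).
have t0 : 0 < I + 1 by rewrite ltr_wpDl.
have L : - (\sum_j \sum_k q j * q k * mollify G m.+1%:R^-1 (zz j k)) @[m --> \oo] -->
    - \sum_j \sum_k q j * q k * G (zz j k).
  apply: cvgN; apply: cvg_sumr => j; apply: cvg_sumr => k.
  by apply: cvgM; [exact: cvg_cst|exact: (mollify_cvg mG GM)].
(* The parameter is t = I + 1: then I^2 / t <= I, so the bound is linear in I, and t > 0 even if I =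
   0. *)
apply: (@le_trans _ _ (1 / 2 * ((I + 1) * (K0 * H) + (I + 1)^-1 * I ^+ 2))).
  rewrite -(cvg_lim _ L)//; apply: limr_le; first by apply/cvg_ex; eexists; exact: L.
  by apply: nearW => m; apply: mollify_energy => //; rewrite invr_gt0.
have : (I + 1)^-1 * I ^+ 2 <= I.
  by rewrite mulrC ler_pdivrMr// expr2 ler_wpM2l// lerDl.
move: ((I + 1)^-1 * _) (K0 * H) => u v; lra.
Qed.

End points.

End kernel_energy.

(** * Symmetry of the covariance kernel *)

Section localization.
Context {R : realType}.
Local Notation RM := (measurableTypeR R).

Lemma near_box n (c : 'rV[R]_n) (P : set 'rV[R]_n) : nbhs c P ->
  exists2 dl : R, 0 < dl & box c (2 * dl) `<=` P.
Proof.
move=> /nbhs_ballP[e /= e0 eP]; exists (e / 4); first by rewrite divr_gt0.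
move=> z zb; apply: eP; split => // i j; rewrite -ball_normE /= ord1 distrC.
apply: le_lt_trans (zb j) _.
rewrite (_ : 2 * (e / 4) = e / 2); last by field.
by rewrite ltr_pdivrMr// ltr_pMr// ltr1n.
Qed.

Lemma box_sub n (c : 'rV[R]_n) (r r' : R) : r <= r' -> box c r `<=` box c r'.
Proof. by move=> rr z zb i; exact: le_trans (zb i) rr. Qed.

Section bump_properties.
Variables (n : nat) (c : 'rV[R]_n) (dl : R).
Hypothesis dl0 : 0 < dl.

Lemma bump_le1 z : cbump c dl z <= 1.
Proof.
suff : 0 <= cbump c dl z <= 1 by case/andP.
apply: (big_ind (fun x : R => 0 <= x <= 1)) => [|x y /andP[x0 x1] /andP[y0 y1]|i _].
- by rewrite ler01 lexx.
- by rewrite mulr_ge0// mulr_ile1.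
rewrite hbump_ge0//= /hbump ler_pdivrMr ?hbump_denom// mul1r.
by rewrite lerDl hflat1_ge0.
Qed.

Lemma bump_box z : cbump c dl z != 0 -> box c (2 * dl) z.
Proof. by move=> bz i; exact: bump_neq0 bz. Qed.

(** Off the closed box the product vanishes on an open set, so continuity of f is asked for on the
    box only. *)
Lemma bumpM_continuous (f : 'rV[R]_n -> R) :
  (forall z, box c (2 * dl) z -> {for z, continuous f}) ->
  continuous (fun z => cbump c dl z * f z).
Proof.
move=> cf z; have [zb|zb] := pselect (box c (2 * dl) z).
  by apply: continuousM; [exact: bump_continuous|exact: cf].
have op : open (~` box c (2 * dl)) by apply: closed_openC; exact: closed_box.
have H : \forall y \near z, cbump c dl y * f y = 0.
  have : nbhs z (~` box c (2 * dl)) by exact: open_nbhs_nbhs.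
  apply: filterS => y yb; have [->|/bump_box//] := eqVneq (cbump c dl y) 0.
  by rewrite mul0r.
have E : cbump c dl z * f z = 0 by exact: (nbhs_singleton H).
move=> W WF; apply: (@filterS _ (nbhs z) _ _ _ _ H) => y /= Hy; rewrite Hy -E.
exact: nbhs_singleton WF.
Qed.

Lemma measurable_bump : measurable_Rn (cbump c dl).
Proof. by apply: continuous_measurable_rvec; exact: bump_continuous. Qed.

Lemma rint_bump : rint (leb R n) (fun t => cbump c dl (rvec t)).
Proof.
apply: (@rint_bounded_ball R n (cbump c dl) c 1 (n%:R * (2 * dl)) measurable_bump) => z.
rewrite mul1r ger0_norm ?bump_ge0//; have [->|bz] := eqVneq (cbump c dl z) 0; first exact: ler0n.
rewrite (_ : enorm (z - c) <= _) ?bump_le1//; apply: le_trans (enorm_le_sum _) _.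
apply: (@le_trans _ _ (\sum_(i < n) 2 * dl)).
  by apply: ler_sum => i _; rewrite !mxE; exact: bump_box.
by rewrite sumr_const card_ord [leRHS]mulr_natl.
Qed.

Lemma integral_bump_gt0 : 0 < integral_Rn (cbump c dl).
Proof.
apply: lt_le_trans (integral_chi_gt0 n dl0) _.
rewrite -(@integral_Rn_translate _ _ _ (- c)); last exact: measurable_chi.
apply: le_integral_Rn; [exact: rint_chi_shift|exact: rint_bump|].
move=> z; rewrite /chi; case: ltP => [zc|_]; last exact: bump_ge0.
rewrite bump_eq1// => i; apply: le_trans (ltW zc).
by apply: le_trans (ler_coord_enorm (z - c) i); rewrite !mxE.
Qed.

End bump_properties.

Lemma bump_row_mx n m (a : 'rV[R]_n) (b : 'rV[R]_m) dl x y :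
  cbump (row_mx a b) dl (row_mx x y) = cbump a dl x * cbump b dl y.
Proof.
rewrite /cbump big_split_ord/=; congr (_ * _); apply: eq_bigr => i _.
  by rewrite !row_mxEl.
by rewrite !row_mxEr.
Qed.

Section iterated.
Variables (d : nat) (a b : 'rV[R]_d) (dl e : R) (f : 'rV[R]_(d + d) -> R).
Hypothesis dl0 : 0 < dl.
Let z0 : 'rV[R]_(d + d) := row_mx a b.
Hypothesis cf : forall z, box z0 (2 * dl) z -> {for z, continuous f}.
Hypothesis fe : forall z, box z0 (2 * dl) z -> `|f z - f z0| <= e.

Local Notation J := (integral_Rn (fun x => integral_Rn (fun y =>
  f (row_mx x y) * cbump a dl x * cbump b dl y))).
Local Notation P := (integral_Rn (cbump a dl) * integral_Rn (cbump b dl)).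

Let F (p : d.-tuple RM * d.-tuple RM) : R :=
  f (row_mx (rvec p.1) (rvec p.2)) * cbump a dl (rvec p.1) * cbump b dl (rvec p.2).

Let measurable_row_mx_pair i : measurable_fun setT
  (fun p : d.-tuple RM * d.-tuple RM => (row_mx (rvec p.1) (rvec p.2) : 'rV[R]_(d + d)) 0 i).
Proof.
rewrite -(splitK i); case: (fintype.split i) => j /=.
  apply: (eq_measurable_fun (fun p : d.-tuple RM * d.-tuple RM => rvec p.1 0 j)).
    by move=> p _; rewrite row_mxEl.
  exact: measurable_fst_coord.
apply: (eq_measurable_fun (fun p : d.-tuple RM * d.-tuple RM => rvec p.2 0 j)).
  by move=> p _; rewrite row_mxEr.
exact: measurable_snd_coord.
Qed.

Let mF : measurable_fun setT F.
Proof.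
have m := continuous_measurable_rvec (bumpM_continuous dl0 cf).
have := measurable_comp_rvec (f := fun z => cbump z0 dl z * f z) m measurable_row_mx_pair.
apply: eq_measurable_fun => p _ /=.
by rewrite /F -[RHS]mulrA -bump_row_mx mulrC.
Qed.

Let bd x y (A : R) : (forall z, box z0 (2 * dl) z -> f z <= A) ->
  f (row_mx x y) * cbump a dl x * cbump b dl y <= A * (cbump a dl x * cbump b dl y).
Proof.
move=> fA; rewrite -mulrA -bump_row_mx.
have [->|bz] := eqVneq (cbump (row_mx a b) dl (row_mx x y)) 0; first by rewrite !mulr0.
by rewrite ler_wpM2r ?bump_ge0// fA//; exact: bump_box.
Qed.

Let bd' x y (A : R) : (forall z, box z0 (2 * dl) z -> A <= f z) ->
  A * (cbump a dl x * cbump b dl y) <= f (row_mx x y) * cbump a dl x * cbump b dl y.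
Proof.
move=> fA; rewrite -mulrA -bump_row_mx.
have [->|bz] := eqVneq (cbump (row_mx a b) dl (row_mx x y)) 0; first by rewrite !mulr0.
by rewrite ler_wpM2r ?bump_ge0// fA//; exact: bump_box.
Qed.

Let fle z : box z0 (2 * dl) z -> f z <= f z0 + e.
Proof. by move=> /fe; rewrite ler_norml => /andP[_]; lra. Qed.

Let fge z : box z0 (2 * dl) z -> f z0 - e <= f z.
Proof. by move=> /fe; rewrite ler_norml => /andP[+ _]; lra. Qed.

Let K := `|f z0| + e.

Let FK x y : `|F (x, y)| <= K * cbump a dl (rvec x) * cbump b dl (rvec y).
Proof.
rewrite /F /= ler_norml -!mulrA -mulNr; apply/andP; split.
  rewrite [leRHS]mulrA; apply: bd' => z /fge; apply: le_trans.
  by rewrite /K opprD lerD2r; have := ler_norm (- f z0); rewrite normrN; lra.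
rewrite [leLHS]mulrA; apply: bd => z /fle /le_trans; apply.
by rewrite /K lerD2r ler_norm.
Qed.

(** On the support of the bumps f differs from f(a, b) by at most e. The integral is kept iterated,
    as in the covariance. *)
Lemma iterated_bump_bounds : (f z0 - e) * P <= J <= (f z0 + e) * P.
Proof.
have rK : rint (leb R d) (fun t => K * cbump a dl (rvec t)) by apply: rintZ; exact: rint_bump.
have rJ := dominated_rint_fst mF rK (rint_bump b dl0) FK.
have rin x : rint (leb R d) (fun t => f (row_mx x (rvec t)) * cbump a dl x * cbump b dl (rvec t)).
  pose t0 : d.-tuple RM := [tuple of [seq x 0 i | i <- ord_tuple d]].
  have -> : x = rvec t0 by apply/rowP => i; rewrite mxE tnth_map tnth_ord_tuple.
  apply: (rint_le (g := fun t => K * cbump a dl (rvec t0) * cbump b dl (rvec t))).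
  - exact: (measurableT_comp mF (measurable_pair1 t0)).
  - by apply: rintZ; exact: rint_bump.
  - by move=> t; exact: (FK t0 t).
have rin' A x : rint (leb R d) (fun t => A * (cbump a dl x * cbump b dl (rvec t))).
  by do 2 apply: rintZ; exact: rint_bump.
have EA A x : integral_Rn (fun y => A * (cbump a dl x * cbump b dl y)) =
    A * integral_Rn (cbump b dl) * cbump a dl x.
  rewrite !integral_RnZ; [by rewrite -mulrA [X in _ * X]mulrC|exact: rint_bump|].
  by apply: rintZ; exact: rint_bump.
have rc A : rint (leb R d) (fun t => integral_Rn (fun y => A * (cbump a dl (rvec t) * cbump b dl y))).
  by under eq_fun do rewrite EA; apply: rintZ; exact: rint_bump.
have E A : integral_Rn (fun x => integral_Rn (fun y => A * (cbump a dl x * cbump b dl y))) = A * P.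
  rewrite (eq_integral_Rn (EA A)) integral_RnZ; last exact: rint_bump.
  by rewrite mulrAC mulrA.
rewrite -!E; apply/andP; split; apply: le_integral_Rn => //.
  move=> x; apply: le_integral_Rn => //.
  by move=> y; exact: bd' fge.
move=> x; apply: le_integral_Rn => //.
by move=> y; exact: bd fle.
Qed.

End iterated.

Section kernel_symmetry.
Variables (d : nat) (U : set 'rV[R]_d) (g : 'rV[R]_d -> 'rV[R]_d -> R).
Hypothesis oU : open U.
Hypothesis cg : {within prod_dom U, continuous (kernel_fun g)}.

Lemma continuous_lsubmx n m : continuous (@lsubmx R 1 n m).
Proof.
move=> z W /nbhs_ballP[e /= e0 eW]; apply/nbhs_ballP; exists e => //= y [_ zy].
by apply: eW; split => // i j; rewrite !mxE; exact: zy.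
Qed.

Lemma continuous_rsubmx n m : continuous (@rsubmx R 1 n m).
Proof.
move=> z W /nbhs_ballP[e /= e0 eW]; apply/nbhs_ballP; exists e => //= y [_ zy].
by apply: eW; split => // i j; rewrite !mxE; exact: zy.
Qed.

Lemma open_prod_dom : open (prod_dom U).
Proof.
apply: openI.
  by apply: open_comp => // z _; exact: continuous_lsubmx.
by apply: open_comp => // z _; exact: continuous_rsubmx.
Qed.

Lemma kernel_continuous z : prod_dom U z -> {for z, continuous (kernel_fun g)}.
Proof.
move=> Uz; have := open_prod_dom; rewrite openE => /(_ z Uz) iz.
by have := cg; rewrite continuous_open_subspace; [move=> /(_ z); rewrite inE; apply|exact: open_prod_dom].
Qed.

Definition log_fun (z : 'rV[R]_(d + d)) := log_kernel g (lsubmx z) (rsubmx z).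

Let diff_sqr (y : 'rV[R]_(d + d)) := dotv (lsubmx y - rsubmx y) (lsubmx y - rsubmx y).

Let continuous_diff_sqr : continuous diff_sqr.
Proof.
apply: (@smoothk_continuous _ _ 0); apply: smoothk_sum => i.
have s : smoothk 0 (fun y : 'rV[R]_(d + d) => (lsubmx y - rsubmx y) 0 i).
  rewrite (_ : (fun _ => _) = fun y : 'rV[R]_(d + d) => y 0 (lshift d i) + -1 * y 0 (rshift d i)).
    by apply: smoothkD; [exact: smoothk_coord|apply: smoothkM; [exact: smoothk_cst|exact: smoothk_coord]].
  by apply/funext => y; rewrite !mxE mulN1r.
exact: smoothkM.
Qed.

Lemma log_fun_continuous z : prod_dom U z -> lsubmx z != rsubmx z -> {for z, continuous log_fun}.
Proof.
move=> Uz zd.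
have cD := continuous_diff_sqr.
have n0 : 0 < enorm (lsubmx z - rsubmx z) by rewrite enorm_gt0 subr_eq0.
have cn : {for z, continuous (fun y : 'rV[R]_(d + d) => enorm (lsubmx y - rsubmx y))}.
  apply: (@continuous_comp _ _ _ (fun y : 'rV[R]_(d + d) =>
    dotv (lsubmx y - rsubmx y) (lsubmx y - rsubmx y)) (@Num.sqrt R)).
    exact: cD.
  exact: sqrt_continuous.
apply: continuousD; last exact: kernel_continuous.
apply: (@continuous_comp _ _ _ (fun y : 'rV[R]_(d + d) => 1 / enorm (lsubmx y - rsubmx y)) (@ln R)).
  apply: continuousM; first exact: cst_continuous.
  by apply: continuousV => //; rewrite gt_eqF.
by apply: continuous_ln; rewrite div1r invr_gt0.
Qed.

Hypothesis covC : forall phi psi, test_fun U phi -> test_fun U psi ->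
  integral_Rn (fun x => integral_Rn (fun y => log_kernel g x y * phi x * psi y)) =
  integral_Rn (fun x => integral_Rn (fun y => log_kernel g x y * psi x * phi y)).

(* The covariance is only known tested against functions, hence the
  approximation of its value at a point by bumps. *)
Let near_pair (a b : 'rV[R]_d) (e : R) : U a -> U b -> a != b -> 0 < e ->
  exists2 dl : R, 0 < dl & forall z : 'rV[R]_(d + d), box (row_mx a b) (2 * dl) z ->
    [/\ prod_dom U z, {for z, continuous log_fun} & `|log_fun z - log_fun (row_mx a b)| <= e].
Proof.
move=> Ua Ub ab e0; set z0 : 'rV[R]_(d + d) := row_mx a b.
have Uz0 : prod_dom U z0 by rewrite /prod_dom /= row_mxKl row_mxKr.
have zd0 : lsubmx z0 != rsubmx z0 by rewrite row_mxKl row_mxKr.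
have n1 : nbhs z0 (prod_dom U) by apply: open_nbhs_nbhs; split => //; exact: open_prod_dom.
have n2 : nbhs z0 [set z : 'rV[R]_(d + d) | lsubmx z != rsubmx z].
  have D0 : 0 < diff_sqr z0 by rewrite /diff_sqr -sqr_enorm exprn_gt0// enorm_gt0 subr_eq0.
  have H := cvgr_gt _ (@continuous_diff_sqr z0) _ D0.
  have {}H := H (nbhs_filter z0).
  apply: (@filterS _ (nbhs z0) _ _ _ _ H) => z /=; apply: contraTneq => zz.
  by rewrite /diff_sqr zz subrr dotv0l ltxx.
have n3 : nbhs z0 [set z | `|log_fun z - log_fun z0| <= e].
  have /cvgrPdist_le/(_ _ e0) := log_fun_continuous Uz0 zd0.
  by apply: filterS => z /=; rewrite distrC.
have [dl dl0 H] := near_box (filterI n1 (filterI n2 n3)).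
exists dl => // z /H[Uz [zd zl]]; split => //; exact: log_fun_continuous.
Qed.

Let half_split (A B e : R) : A - e / 2 <= B + e / 2 -> A <= B + e.
Proof. lra. Qed.

(** The covariance of bumps at a and b, taken in either order, is the kernel value times the same
    masses up to e / 2. The reverse inequality is the same statement with a and b exchanged. *)
Let log_kernel_le (a b : 'rV[R]_d) : U a -> U b -> a != b -> log_kernel g a b <= log_kernel g b a.
Proof.
move=> Ua Ub ab; apply/ler_addgt0Pr => e e0.
have e2 : 0 < e / 2 by rewrite divr_gt0.
have [r1 r10 H1] := near_pair Ua Ub ab e2.
have ba : b != a by rewrite eq_sym.
have [r2 r20 H2] := near_pair Ub Ua ba e2.
(* One width for both orders, so that both covariances involve the same two bumps. *)
pose dl := Num.min r1 r2.
have dl0 : 0 < dl by rewrite lt_min r10.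
have {}H1 z : box (row_mx a b) (2 * dl) z -> [/\ prod_dom U z, {for z, continuous log_fun} &
    `|log_fun z - log_fun (row_mx a b)| <= e / 2].
  by move=> zb; apply: H1; apply: box_sub zb; rewrite ler_pM2l// ge_min lexx.
have {}H2 z : box (row_mx b a) (2 * dl) z -> [/\ prod_dom U z, {for z, continuous log_fun} &
    `|log_fun z - log_fun (row_mx b a)| <= e / 2].
  by move=> zb; apply: H2; apply: box_sub zb; rewrite ler_pM2l// ge_min lexx orbT.
have ta : test_fun U (cbump a dl).
  apply: bump_test_fun => // x xb.
  have [] // := H1 (row_mx x b); last by case; rewrite row_mxKl.
  move=> i; rewrite -(splitK i); case: (fintype.split i) => j /=.
    by rewrite !row_mxEl.
  by rewrite !row_mxEr subrr normr0 mulr_ge0// ltW.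
have tb : test_fun U (cbump b dl).
  apply: bump_test_fun => // x xb.
  have [] // := H1 (row_mx a x); last by case; rewrite row_mxKr.
  move=> i; rewrite -(splitK i); case: (fintype.split i) => j /=.
    by rewrite !row_mxEl subrr normr0 mulr_ge0// ltW.
  by rewrite !row_mxEr.
have := covC ta tb.
have J1 := @iterated_bump_bounds d a b dl (e / 2) log_fun dl0
  (fun z zb => let: And3 _ c _ := H1 z zb in c) (fun z zb => let: And3 _ _ c := H1 z zb in c).
have J2 := @iterated_bump_bounds d b a dl (e / 2) log_fun dl0
  (fun z zb => let: And3 _ c _ := H2 z zb in c) (fun z zb => let: And3 _ _ c := H2 z zb in c).
have E x y : log_fun (row_mx x y) = log_kernel g x y by rewrite /log_fun row_mxKl row_mxKr.
have JE phi psi : integral_Rn (fun x => integral_Rn (fun y => log_fun (row_mx x y) * phi x * psi y)) =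
    integral_Rn (fun x => integral_Rn (fun y => log_kernel g x y * phi x * psi y)).
  by apply: eq_integral_Rn => x; apply: eq_integral_Rn => y; rewrite E.
move=> cE; move/andP: J1 => [J1 _]; move/andP: J2 => [_ J2].
rewrite (E a b) (JE (cbump a dl) (cbump b dl)) in J1.
rewrite (E b a) (JE (cbump b dl) (cbump a dl)) in J2.
have p1 := integral_bump_gt0 a dl0; have p2 := integral_bump_gt0 b dl0.
have H : (log_kernel g a b - e / 2) * (integral_Rn (cbump a dl) * integral_Rn (cbump b dl)) <=
    (log_kernel g b a + e / 2) * (integral_Rn (cbump a dl) * integral_Rn (cbump b dl)).
  by rewrite [X in _ <= _ * X]mulrC; apply: le_trans J1 _; rewrite cE.
apply: half_split; by rewrite -(ler_pM2r (mulr_gt0 p1 p2)).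
Qed.

Lemma log_kernel_sym (a b : 'rV[R]_d) : U a -> U b -> a != b -> log_kernel g a b = log_kernel g b a.
Proof.
move=> Ua Ub ab; apply/eqP; rewrite eq_le !log_kernel_le//.
by rewrite eq_sym.
Qed.

End kernel_symmetry.

End localization.

(** * Off-diagonal sums and separation of the points *)

Section separation.
Context {R : realType}.

Lemma sum_offdiag_sym n (F : 'I_n -> 'I_n -> R) :
  (forall j k, k != j -> F j k = F k j) ->
  \sum_(j < n) \sum_(k < n | k != j) F j k =
  2 * \sum_(j < n) \sum_(k < n | (j < k)%N) F j k.
Proof.
move=> Fs.
have E j : \sum_(k | k != j) F j k =
    \sum_(k < n | (j < k)%N) F j k + \sum_(k < n | (k < j)%N) F j k.
  rewrite (bigID (fun k : 'I_n => (j < k)%N))/=; congr (_ + _); apply: eq_bigl => k.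
    by rewrite -(inj_eq val_inj)/=; case: ltngtP.
  by rewrite -(inj_eq val_inj)/=; case: ltngtP.
rewrite (eq_bigr _ (fun j _ => E j)) big_split/= mulr_natl mulr2n; congr (_ + _).
rewrite (exchange_big_dep xpredT)//=; apply: eq_bigr => k _; apply: eq_bigr => j jk.
by apply: Fs; rewrite -(inj_eq val_inj)/= ltn_eqF.
Qed.

(** As n >= 2 the index set is nonempty, and being finite it has a minimal distance, positive by
    injectivity, that bounds the infimum below. *)
Lemma half_inf_separation d n (x : 'I_n -> 'rV[R]_d) (j : 'I_n) : (2 <= n)%N -> injective x ->
  let r := 1 / 2 * inf [set enorm (x j - x k) | k in [set k : 'I_n | k != j]] in
  0 < r /\ forall k, k != j -> 2 * r <= enorm (x j - x k).
Proof.
move=> n2 xi; set S := (X in inf X).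
have [k0 k0j] : exists k0 : 'I_n, k0 != j.
  have n0 : (0 < n)%N by exact: ltn_trans n2.
  have [j0|j0] := eqVneq j (Ordinal n0); last by exists (Ordinal n0); rewrite eq_sym.
  by exists (Ordinal n2); rewrite j0.
have [k1 k1j k1P] := @arg_minP _ _ _ k0 (fun k => k != j) (fun k => enorm (x j - x k)) k0j.
have k1x : 0 < enorm (x j - x k1).
  by rewrite enorm_gt0 subr_eq0; apply: contraNneq k1j => /xi ->.
have lS : lbound S (enorm (x j - x k1)) by move=> _ [k /= kj <-]; exact: k1P.
have S0 : S !=set0 by exists (enorm (x j - x k0)); exists k0.
have i1 : enorm (x j - x k1) <= inf S by exact: lb_le_inf.
split; first by rewrite mulr_gt0// (lt_le_trans k1x).
move=> k kj; rewrite (_ : 2 * (1 / 2 * inf S) = inf S); last by field.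
by apply: ge_inf; [exists (enorm (x j - x k1))|exists k].
Qed.

End separation.

Lemma rint_sobolev_weight (R : realType) n (s : R) (h1 h2 : 'rV[R]_n -> R) :
  measurable_Rn h1 -> measurable_Rn h2 ->
  (eintegral_Rn (fun xi => ((1 + enorm xi ^+ 2) `^ s * (h1 xi ^+ 2 + h2 xi ^+ 2))%R) < +oo)%E ->
  rint (leb R n) (fun t => (1 + enorm (rvec t) ^+ 2) `^ s * (h1 (rvec t) ^+ 2 + h2 (rvec t) ^+ 2)).
Proof.
move=> m1 m2 fin; apply: rintP.
  apply: measurable_funM; last by apply: measurable_funD; exact: measurable_funX.
  apply: (measurableT_comp (measurable_powR s)); apply: measurable_funD => //.
  by apply: measurable_funX; apply: measurable_enorm => i; exact: measurable_rvec_coord.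
apply: le_lt_trans fin; rewrite le_eqVlt; apply/orP; left; apply/eqP.
apply: eq_integral => t _; rewrite ger0_norm// mulr_ge0 ?powR_ge0//.
by rewrite addr_ge0 ?sqr_ge0.
Qed.

(** * Choice of the radius and the constant *)

Section assembly.
Context {R : realType}.
Variables (d : nat) (U : set 'rV[R]_d) (g : 'rV[R]_d -> 'rV[R]_d -> R) (s : R).
Hypothesis oU : open U.
Hypothesis U0 : U 0.
Hypothesis ds : d%:R < s.
Hypothesis d0 : (0 < d)%N.
Hypothesis cg : {within prod_dom U, continuous (kernel_fun g)}.
Hypothesis sg : sobolev_loc s (prod_dom U) (kernel_fun g).
Hypothesis Lsym : forall a b, U a -> U b -> a != b -> log_kernel g a b = log_kernel g b a.

Let scale_le1 (u v w : R) : 0 < u -> u * (4 * w * v + 1) <= 1 -> 4 * w * (u * v) <= 1.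
Proof. by lra. Qed.

(** In the application, [w1] is the integral of rho D, [w2] the sum of the ln r_j, [w3] the diagonal
    of g, [w4] the term A I, and [u], [v] the off-diagonal energies of the logarithm and of g. *)
Let combine_bounds (w1 w2 w3 w4 N T B M u v : R) :
  w2 - N * T + w1 <= u -> - (w3 + v) <= w4 + B -> w4 <= w1 -> w3 <= N * M -> B <= N * B ->
  - (1 / 2 * (u + v)) <= 1 / 2 * - w2 + 1 / 2 * (T + M + B) * N.
Proof. by lra. Qed.

Lemma log_kernel_energy : exists2 eps : R, 0 < eps /\ eball 0 eps `<=` U &
  exists C : R, forall (n : nat) (q : 'I_n -> R) (x : 'I_n -> 'rV[R]_d),
    (2 <= n)%N -> (forall j, q j = -1 \/ q j = 1) -> injective x ->
    (forall j, eball 0 eps (x j)) ->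
    - (\sum_(j < n) \sum_(k < n | (j < k)%N) q j * q k * log_kernel g (x j) (x k))
    <= 1 / 2 * (\sum_(j < n)
         ln (1 / (1 / 2 * inf [set enorm (x j - x k) | k in [set k : 'I_n | k != j]])))
       + C * n%:R.
Proof.
pose kf := kernel_fun g.
have Uz0 : prod_dom U 0 by rewrite /prod_dom /= !linear0.
have n1 : nbhs (0 : 'rV[R]_(d + d)) (prod_dom U).
  by apply: open_nbhs_nbhs; split => //; exact: open_prod_dom.
have n2 : nbhs (0 : 'rV[R]_(d + d)) [set z | `|kf z - kf 0| <= 1].
  have /cvgrPdist_le/(_ _ ltr01) := kernel_continuous oU cg Uz0.
  by apply: filterS => z /=; rewrite distrC.
have [dl dl0 box_in] := near_box (filterI n1 n2).
pose G z := cbump 0 dl z * kf z; pose M := `|kf 0| + 1.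
have cG : continuous G.
  by apply: bumpM_continuous => // z /box_in[Uz _]; exact: kernel_continuous Uz.
have mG : measurable_Rn G by exact: continuous_measurable_rvec.
have kM z : box 0 (2 * dl) z -> `|kf z| <= M.
  move=> /box_in[_ /= H]; rewrite -[kf z](subrK (kf 0)) /M addrC.
  by rewrite (le_trans (ler_normD _ _))// lerD2l.
have GM z : `|G z| <= M.
  rewrite normrM ger0_norm ?bump_ge0//.
  have [->|bz] := eqVneq (cbump 0 dl z) 0; first by rewrite mul0r addr_ge0.
  apply: le_trans (kM z (bump_box dl0 bz)).
  by rewrite ler_piMl// bump_le1.
have [|_ [h1 [h2 [mh1 mh2 hF /(rint_sobolev_weight mh1 mh2) hi]]]] := sg (phi := cbump 0 dl).
  by apply: bump_test_fun => // z /box_in[].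
pose K0 := (2 * pi) `^ (2 * s) : R.
pose H := integral_Rn (fun z => (1 + enorm z ^+ 2) `^ s * (h1 z ^+ 2 + h2 z ^+ 2)).
have H0 : 0 <= H.
  by apply: integral_Rn_ge0 => z; rewrite mulr_ge0 ?powR_ge0// addr_ge0 ?sqr_ge0.
have KH0 : 0 <= K0 * H by rewrite mulr_ge0 ?powR_ge0.
have A0 : 0 <= (K0 * H + 1) / 2 by rewrite divr_ge0// addr_ge0.
have [tau0 [L [rho [tau01 L0 [rrho rho01] rhot spec]]]] := swt_cpow_le_kscale ds A0.
(* A unit vector at which the constant [logc] is evaluated; it exists because d > 0. *)
pose e : 'rV[R]_d := delta_mx 0 (Ordinal d0).
have e1 : enorm e = 1 by rewrite /enorm /e -/(basis_vec _) dotv_basis /basis_vec mxE !eqxx sqrtr1.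
(* In order: the bump is 1 at all pairs of points; mutual distances are at most 1; [eps_dim] holds;
   all points stay in the unit ball up to the scale tau0 + L. *)
pose eps : R := Num.min dl (Num.min (1 / 2)
  (Num.min (4 * d%:R * expR 1 + 1)^-1 (expR (tau0 + L))^-1)).
have b0 : 0 < 4 * d%:R * expR 1 + 1 :> R by rewrite ltr_wpDl// !mulr_ge0 ?expR_ge0.
have eps0 : 0 < eps by rewrite !lt_min dl0 !invr_gt0 b0 expR_gt0 divr_gt0.
have eps_dl : eps <= dl by rewrite ge_min lexx.
have eps_half : eps <= 1 / 2 by rewrite !ge_min lexx orbT.
have eps_b : eps <= (4 * d%:R * expR 1 + 1)^-1 by rewrite !ge_min lexx !orbT.
have eps_tau : eps <= (expR (tau0 + L))^-1 by rewrite !ge_min lexx !orbT.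
have eps_dim : 4 * d%:R * (eps * expR 1) <= 1.
  have : eps * (4 * d%:R * expR 1 + 1) <= 1 by rewrite -ler_pdivlMr// mul1r.
  exact: scale_le1.
have eps_range : eps * expR (tau0 + L) <= 1.
  by rewrite -ler_pdivlMr ?expR_gt0// mul1r.
have coordE (y : 'rV[R]_d) i : eball 0 eps y -> `|y 0 i| <= dl.
  rewrite /eball /= subr0 => /ltW ye.
  by apply: le_trans (ler_coord_enorm y i) _; exact: le_trans ye eps_dl.
have pairE (y z : 'rV[R]_d) : eball 0 eps y -> eball 0 eps z ->
    forall i, `|row_mx y z 0 i - (0 : 'rV[R]_(d + d)) 0 i| <= dl.
  move=> ye ze i; rewrite [(0 : 'rV_(d + d)) 0 i]mxE subr0 -(splitK i); case: (fintype.split i) => j /=.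
    by rewrite row_mxEl coordE.
  by rewrite row_mxEr coordE.
have pair_box (y z : 'rV[R]_d) : eball 0 eps y -> eball 0 eps z ->
    box 0 (2 * dl) (row_mx y z).
  by move=> ye ze i; apply: le_trans (pairE y z ye ze i) _; rewrite ler_peMl// ?ler1n// ltW.
have ballU : eball 0 eps `<=` U.
  by move=> y ye; have [[/=]] := box_in _ (pair_box y y ye ye); rewrite row_mxKl.
exists eps => //.
pose T := tau0 + \int[@lebesgue_measure R]_tau rho tau + logc e; pose B := K0 * H / 2.
(* T is the cost per charge of the logarithmic part, M bounds the diagonal of g, B is the constant
   term of the Fourier bound, and 1 / 2 passes from ordered to unordered pairs. *)
exists (1 / 2 * (T + M + B)) => n q x n2' q1 xi xe.
have q2 j : q j ^+ 2 = 1 by case: (q1 j) => ->; rewrite ?sqrrN expr1n.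
pose r j := 1 / 2 * inf [set enorm (x j - x k) | k in [set k : 'I_n | k != j]].
have r0 j : 0 < r j by have [] := half_inf_separation j n2' xi.
have rx j k : k != j -> 2 * r j <= enorm (x j - x k).
  by have [_] := half_inf_separation j n2' xi; exact.
have xeps j : enorm (x j) <= eps by have := xe j; rewrite /eball /= subr0 => /ltW.
have xd j k : enorm (x j - x k) <= 1.
  apply: le_trans (ler_enormB _ 0 _) _; rewrite subr0 sub0r enormN.
  by rewrite (le_trans (lerD (xeps j) (xeps k)))//; move: eps_half; lra.
have r1 j : r j <= 1.
  have n0 : (0 < n)%N by exact: ltn_trans n2'.
  have [k kj] : exists k : 'I_n, k != j.
    have [j0|j0] := eqVneq j (Ordinal n0); last by exists (Ordinal n0); rewrite eq_sym.
    by exists (Ordinal n2'); rewrite j0.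
  have := le_trans (rx j k kj) (xd j k); have := r0 j; lra.
have r01 j : 0 < r j <= 1 by rewrite r0 r1.
have E1 := log_energy_ge e1 q2 r01 rx xeps (ltW eps0) eps_half eps_dim tau01 rrho rho01 rhot.
have xrange j : enorm (x j) * expR (tau0 + L) <= 1.
  by apply: le_trans eps_range; rewrite ler_wpM2r ?expR_ge0.
have E2 := kernel_energy ds mG GM mh1 mh2 hF hi (rint_swt_cpow ds q2 L0 xrange) (fun j k => cG _).
have E3 := spec n q x q2 xrange.
have GE j k : G (row_mx (x j) (x k)) = g (x j) (x k).
  by rewrite /G bump_eq1 ?mul1r// /kf /kernel_fun ?row_mxKl ?row_mxKr//; exact: pairE.
pose Sg := \sum_j \sum_(k | k != j) q j * q k * g (x j) (x k).
pose Sl := \sum_j \sum_(k | k != j) q j * q k * - ln (enorm (x j - x k)).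
(* The Fourier bound concerns the full double sum, so the diagonal of g has to be split off; it is
   at most n M. *)
have diag : \sum_j \sum_k q j * q k * G (row_mx (x j) (x k)) = \sum_j g (x j) (x j) + Sg.
  rewrite -big_split; apply: eq_bigr => j _ /=; rewrite (bigD1 j)//= GE -expr2 q2 mul1r.
  by congr (_ + _); apply: eq_bigr => k _; rewrite GE.
have diagM : \sum_j g (x j) (x j) <= n%:R * M.
  rewrite mulr_natl -[X in _ *+ X](card_ord n) -sumr_const; apply: ler_sum => j _.
  by rewrite -GE; exact: le_trans (ler_norm _) (GM _).
have LE : \sum_(j < n) \sum_(k < n | (j < k)%N) q j * q k * log_kernel g (x j) (x k) =
    1 / 2 * (Sl + Sg).
  have -> : Sl + Sg = \sum_j \sum_(k | k != j) q j * q k * log_kernel g (x j) (x k).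
    rewrite -big_split; apply: eq_bigr => j _; rewrite -big_split; apply: eq_bigr => k kj /=.
    have xjk : 0 < enorm (x j - x k) by apply: lt_le_trans (rx j k kj); rewrite mulr_gt0.
    by rewrite /log_kernel div1r lnV ?posrE// mulrDr.
  rewrite sum_offdiag_sym; first by field.
  move=> j k kj; rewrite Lsym; [by rewrite [q j * _]mulrC|exact: ballU|exact: ballU|].
  by rewrite eq_sym (inj_eq xi).
have lnE : \sum_(j < n) ln (1 / (1 / 2 *
    inf [set enorm (x j - x k) | k in [set k : 'I_n | k != j]])) = - \sum_j ln (r j).
  by rewrite -sumrN; apply: eq_bigr => j _; rewrite -/(r j) div1r lnV// posrE.
rewrite LE lnE.
have nB : B <= n%:R * B.
  have B0 : 0 <= B by rewrite divr_ge0.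
  by rewrite ler_peMl// ler1n ltnW.
move: E1 E2; rewrite -/Sl diag -/T -/K0 -/H -/B => E1 E2.
move: E1 E2 E3 diagM nB.
exact: combine_bounds.
Qed.

End assembly.

Theorem theorem7p1 (R : realType) (d : nat) (U : set 'rV[R]_d)
    (dO : measure_display) (Omega : measurableType dO)
    (P : probability Omega R) (X : ('rV[R]_d -> R) -> {RV P >-> R})
    (g : 'rV[R]_d -> 'rV[R]_d -> R) (s : R)
    (hU : domain U) (hU0 : U 0)
    (hX : log_correlated_field U g X)
    (hs : d%:R < s)
    (hg : sobolev_loc s (prod_dom U) (kernel_fun g)) :
  exists2 eps : R, 0 < eps /\ eball 0 eps `<=` U &
  exists C : R,
    forall (n : nat) (q : 'I_n -> R) (x : 'I_n -> 'rV[R]_d),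
      (2 <= n)%N ->
      (forall j, q j = -1 \/ q j = 1) ->
      injective x ->
      (forall j, eball 0 eps (x j)) ->
      - (\sum_(j < n) \sum_(k < n | (j < k)%N)
           q j * q k * log_kernel g (x j) (x k))
      <= 1 / 2 * (\sum_(j < n)
           ln (1 / (1 / 2 *
             inf [set enorm (x j - x k) | k in [set k : 'I_n | k != j]])))
         + C * n%:R.
Proof.
case: d U X g s hU hU0 hX hs hg => [|d] U X g s hU hU0 hX hs hg.
  (* In dimension 0 there are no two distinct points, so the inequality is vacuous. *)
  exists 1; first by split => // x _; rewrite (_ : x = 0)//; apply/rowP => -[].
  exists 0 => n q x n2 _ xinj _; have n0 : (0 < n)%N by exact: ltn_trans n2.
  have /xinj/(congr1 val)// : x (Ordinal n0) = x (Ordinal n2) by apply/rowP => -[].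
have [cg _ _ cov] := hX; have [oU _ _] := hU.
apply: (log_kernel_energy oU hU0 hs _ cg hg) => // a b Ua Ub ab.
apply: (log_kernel_sym oU cg _ Ua Ub ab) => phi psi tphi tpsi.
have := cov psi phi tpsi tphi.
(* The product of the two field values commutes, which makes the tested covariance symmetric in phi
   and psi. *)
have -> : (fun w => X psi w * X phi w) = (fun w => X phi w * X psi w).
  by apply/funext => w; rewrite mulrC.
by rewrite (cov phi psi tphi tpsi) => -[].
Qed.
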